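(* Let $N\ge1$, $u_1,\dots,u_N\in\mathbb C^*$ and $z\in\mathbb C^*$. If $\mathcal F_{u_1}\otimes\cdots\otimes\mathcal F_{u_N}$ is irreducible, then there exists a unique Whittaker vector $W(z|u_1,\dots,u_N)$.
   Context: $q\in\mathbb C^*$, $|q|\ne1$; $q^{1/2}$ is fixed. The Lie algebra $\mathfrak{Diff}_q$ has basis $E_{k,l}$ ($(k,l)\in\mathbb Z^2\setminus\{(0,0)\}$), $c$, $c'$, with $c,c'$ central and $[E_{k,l},E_{r,s}]=(q^{(sk-lr)/2}-q^{(lr-sk)/2})E_{k+r,l+s}+\delta_{k,-r}\delta_{l,-s}(c'k+cl)$; $H_k=E_{0,k}$, $E(z)=\sum_kE_{1,k}z^{-k}$, $F(z)=\sum_kE_{-1,k}z^{-k}$. Fock module $\mathcal F_u$: the Fock space (vacuum $|0\rangle$) of the Heisenberg algebra $[a_k,a_l]=k\delta_{k+l,0}$ with $c\mapsto1$, $c'\mapsto0$, $H_k\mapsto a_k$, $E(z)\mapsto\frac{u}{1-q}\exp\big(\sum_{k>0}\frac{q^{-k/2}-q^{k/2}}{k}a_{-k}z^k\big)\exp\big(\sum_{k<0}\frac{q^{-k/2}-q^{k/2}}{k}a_{-k}z^k\big)$, $F(z)\mapsto\frac{u^{-1}}{1-q^{-1}}\exp\big(\sum_{k>0}\frac{q^{k/2}-q^{-k/2}}{k}a_{-k}z^k\big)\exp\big(\sum_{k<0}\frac{q^{k/2}-q^{-k/2}}{k}a_{-k}z^k\big)$. It is graded with $\deg|0\rangle=0$,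 $\deg E_{a,b}=-b$. Tensor products use the Lie algebra coproduct. A Whittaker vector $W=W(z|u_1,\dots,u_N)$ is an element of the graded completion of $\mathcal F_{u_1}\otimes\cdots\otimes\mathcal F_{u_N}$ such that $E_{0,k}W=\frac{z^k}{q^{k/2}-q^{-k/2}}W$ and $E_{Nk,k}W=\frac{((-q^{-1/2})^Nu_1\cdots u_Nz)^k}{q^{-k/2}-q^{k/2}}W$ for all $k>0$; $E_{k_1,k_2}W=0$ for all $Nk_2>k_1>0$; and $W=|0\rangle\otimes\cdots\otimes|0\rangle+\cdots$, where the dots denote terms of nonzero degree. *)

(* Defs.v *)
(* Throughout, s : C stands for the fixed root q^(1/2), so that q^(n/2) is s ^ n
   (n : int) and q is s ^+ 2. *)
From HB Require Import structures.
From mathcomp Require Import all_boot all_order all_algebra.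
From mathcomp Require Import finmap.
From mathcomp Require Export reals complex monalg.

Set Implicit Arguments.
Unset Strict Implicit.
Unset Printing Implicit Defensive.

Import GRing.Theory Num.Theory.

Local Open Scope ring_scope.

(* ---- Modules over the Lie algebra Diff_q ---- *)

(* The operators by which the basis elements E_{k,l}, c, c' of Diff_q act. *)
Record diffq_action (V : Type) := DiffqAction {
  actE : int -> int -> V -> V;
  actc : V -> V;
  actc' : V -> V
}.

(* E_{0,0} is not an element of the basis; the value 0 is assigned to it. This
   agrees with the commutation relation, whose right-hand side vanishes for
   (k,l) = (0,0), and in which E_{k+r,l+s} has coefficient 0 whenever
   (k+r,l+s) = (0,0). *)
Record diffq_module (C : fieldType) (s : C) (V : lmodType C)
    (A : diffq_action V) : Prop := DiffqModule {
  actE_linear : forall k l, linear (actE A k l);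
  actc_linear : linear (actc A);
  actc'_linear : linear (actc' A);
  actE00 : forall v, actE A 0 0 v = 0;
  actc_central : forall k l v, actc A (actE A k l v) = actE A k l (actc A v);
  actc'_central : forall k l v, actc' A (actE A k l v) = actE A k l (actc' A v);
  actcc' : forall v, actc A (actc' A v) = actc' A (actc A v);
  actE_comm : forall k l r t v,
    actE A k l (actE A r t v) - actE A r t (actE A k l v) =
      (s ^ (t * k - l * r) - s ^ (l * r - t * k)) *: actE A (k + r) (l + t) v
      + (if (k == - r) && (l == - t)
         then k%:~R *: actc' A v + l%:~R *: actc A v else 0)
}.

Record diffq_submodule (C : fieldType) (V : lmodType C)
    (A : diffq_action V) (S : V -> Prop) : Prop := DiffqSubmodule {
  sub0 : S 0;
  subP : forall a v w, S v -> S w -> S (a *: v + w);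
  subE : forall k l v, S v -> S (actE A k l v);
  subc : forall v, S v -> S (actc A v);
  subc' : forall v, S v -> S (actc' A v)
}.

Definition diffq_irreducible (C : fieldType) (V : lmodType C)
    (A : diffq_action V) : Prop :=
  (exists v : V, v <> 0) /\
  forall S : V -> Prop, diffq_submodule A S ->
    (forall v, S v -> v = 0) \/ (forall v, S v).

(* ---- The Fock space ---- *)

(* Linear extension of a map defined on the basis K of {malg C[K]}. *)
Definition lext (C : fieldType) (K : choiceType) (V : lmodType C)
    (f : K -> V) (v : {malg C[K]}) : V :=
  \sum_(b <- msupp v) v@_b *: f b.

(* The monomial b stands for (prod_j a_{-(j+1)}^(b j)) |0>: the j-th variable
   (j >= 0) is a_{-(j+1)}, and |0> is the monomial 1. *)
Notation fock_basis := {cmonom nat}.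
Notation fock C := {malg C[fock_basis]}.

Definition fock_deg (b : fock_basis) : nat :=
  (\sum_(j <- finsupp b) j.+1 * b j)%N.

(* a_{-(j+1)} is the multiplication by the j-th variable and a_{j+1} is j+1
   times the derivation with respect to it. There is no a_0 in the Heisenberg
   algebra; it is set to 0, in accordance with E_{0,0}. *)
Definition heis (C : fieldType) (k : int) : fock C -> fock C :=
  match k with
  | Posz 0 => fun=> 0
  | Posz j.+1 =>
      lext (fun b : fock_basis => (j.+1 * b j)%N%:R *: << divcm b (ucm j) >>)
  | Negz j => lext (fun b : fock_basis => << mulcm b (ucm j) >>)
  end.

(* The coefficient of z^m in exp (sum_(k > 0) B_k z^k), expanded as
   sum_r 1/r! sum_(k_1 + ... + k_r = m, all k_i > 0) B_{k_1} ... B_{k_r}. *)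
Definition exp_coef (C : fieldType) (V : lmodType C) (B : nat -> V -> V)
    (m : nat) (v : V) : V :=
  \sum_(r < m.+1) r`!%:R^-1 *:
    \sum_(t : r.-tuple 'I_m.+1 |
            all (fun k : 'I_m.+1 => 0 < k)%N t && (\sum_(k <- t) k == m)%N)
      foldr (fun k : 'I_m.+1 => B k) v t.

(* The coefficient of z^n in the vertex operator
     exp (sum_(k > 0) x_k a_{-k} z^k) exp (sum_(k < 0) x_k a_{-k} z^k),
   i.e. the sum over j >= 0 of the coefficient of z^(n+j) in the first factor
   composed with that of z^(-j) in the second one. The latter lowers the degree
   by j, so that only the j not exceeding the degree of v contribute. *)
Definition vertex_coef (C : fieldType) (x : int -> C) (n : int) (v : fock C) :
    fock C :=
  \sum_(j < (\max_(b <- msupp v) fock_deg b)%N.+1)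
    match n + j%:Z with
    | Posz m =>
        exp_coef (fun k w => x k%:Z *: heis (- k%:Z) w) m
          (exp_coef (fun k w => x (- k%:Z) *: heis k%:Z w) j v)
    | Negz _ => 0
    end.

(* A is the Fock module F_u. Since E(z) = sum_l E_{1,l} z^(-l), the operator
   E_{1,l} is the coefficient of z^(-l); likewise for F(z) and E_{-1,l}. As
   Diff_q is generated by c, c', H_k, E_{1,l} and E_{-1,l}, these conditions
   leave no freedom in the choice of A. *)
Record fock_module (C : fieldType) (s u : C) (A : diffq_action (fock C)) :
    Prop := FockModule {
  fock_diffq : diffq_module s A;
  fock_c : forall v, actc A v = v;
  fock_c' : forall v, actc' A v = 0;
  fock_H : forall k v, actE A 0 k v = heis k v;
  fock_E : forall l v,
    actE A 1 l v =
      (u / (1 - s ^+ 2)) *: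
        vertex_coef (fun k => (s ^ (- k) - s ^ k) / k%:~R) (- l) v;
  fock_F : forall l v,
    actE A (- 1) l v =
      (u^-1 / (1 - (s ^+ 2)^-1)) *:
        vertex_coef (fun k => (s ^ k - s ^ (- k)) / k%:~R) (- l) v
}.

(* ---- Tensor products of Fock spaces ---- *)

(* The N-fold tensor power of the free vector space on fock_basis is the free
   vector space on the N-tuples t, which stand for t_0 (x) ... (x) t_{N-1}. *)
Notation tensor_basis N := {ffun 'I_N -> fock_basis}.
Notation tensor_fock C N := {malg C[tensor_basis N]}.

(* id (x) ... (x) X (x) ... (x) id, with X in position i. *)
Definition tensor_at (C : fieldType) (N : nat) (i : 'I_N)
    (X : fock C -> fock C) : tensor_fock C N -> tensor_fock C N :=
  lext (fun t : tensor_basis N =>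
    lext (fun b : fock_basis =>
            << [ffun j => if j == i then b else t j] : tensor_basis N >>)
      (X << t i >>)).

Definition tensor_action (C : fieldType) (N : nat)
    (A : 'I_N -> diffq_action (fock C)) : diffq_action (tensor_fock C N) :=
  {| actE k l v := \sum_(i < N) tensor_at i (actE (A i) k l) v;
     actc v := \sum_(i < N) tensor_at i (actc (A i)) v;
     actc' v := \sum_(i < N) tensor_at i (actc' (A i)) v |}.

Definition tensor_deg (N : nat) (t : tensor_basis N) : nat :=
  (\sum_(i < N) fock_deg (t i))%N.

Definition tensor_vac (C : fieldType) (N : nat) : tensor_fock C N :=
  << [ffun=> onecm nat] : tensor_basis N >>.

(* ---- The graded completion and Whittaker vectors ---- *)

(* An element of the graded completion is the family W of its homogeneous
   components, W d being the one of degree d. *)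
Definition graded_completion (C : fieldType) (N : nat)
    (W : int -> tensor_fock C N) : Prop :=
  forall (d : int) t, t \in msupp (W d) -> (tensor_deg t)%:Z = d.

(* E_{k,l} has degree - l, hence sends the component of degree d + l to the one
   of degree d. *)
Definition completed_actE (C : fieldType) (V : lmodType C)
    (A : diffq_action V) (k l : int) (W : int -> V) : int -> V :=
  fun d => actE A k l (W (d + l)).

Record whittaker (C : fieldType) (s : C) (N : nat) (u : 'I_N -> C) (z : C)
    (A : diffq_action (tensor_fock C N)) (W : int -> tensor_fock C N) :
    Prop := Whittaker {
  whittaker_completion : graded_completion W;
  whittaker_E0 : forall k : int, 0 < k -> forall d,
    completed_actE A 0 k W d = (z ^ k / (s ^ k - s ^ (- k))) *: W d;
  whittaker_EN : forall k : int, 0 < k -> forall d,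
    completed_actE A (N%:Z * k) k W d =
      (((- s^-1) ^+ N * (\prod_(i < N) u i) * z) ^ k / (s ^ (- k) - s ^ k))
        *: W d;
  whittaker_E : forall k1 k2 : int, 0 < k1 -> k1 < N%:Z * k2 -> forall d,
    completed_actE A k1 k2 W d = 0;
  whittaker_vac : W 0 = tensor_vac C N
}.

(* Main.v *)
Require Import Defs.
From mathcomp Require Import all_boot all_order all_algebra.
From mathcomp Require Import finmap boolp ring zify.
Set Implicit Arguments.
Unset Strict Implicit.
Unset Printing Implicit Defensive.
Import Order.TTheory GRing.Theory Num.Theory.
Local Open Scope fset_scope.
Local Open Scope ring_scope.

(** The proof passes to fermions. By the boson-fermion correspondence, F_u is
    the neutral part of the semi-infinite wedge space on modes m in Z, in which
      E_{k,l} = sum_m (u q^(l/2 - m - 1))^k :psi_{m-l} psi^*_m: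
                + delta_{l,0} u^k / (1 - q^k).
    Thus, in the basis S_D of F_u indexed by neutral states D (the Schur basis),
    E_{k,l} is a sum of hops of a particle from m to m - l ([E_S]), and the
    index k enters only through the k-th power of a node attached to the hop.
    As q is not a root of unity, distinct hops have distinct nodes, and linear
    combinations over k isolate single hops ([closed_hop]). The correspondence
    itself is obtained by showing that the wedge space satisfies the relations
    of Diff_q ([wedgeE_comm]) and has the same vacuum values as F_u, and by
    comparing the vectors generated from the two vacua ([matched]). In a tensor
    product of N modules the modes carry a colour i and the position
    x_{i,m} = u_i q^(-m-1), and the nodes of E_{k,l} are q^(l/2) x_{i,m}.

    Irreducibility enters through one principle ([annihilated_eq0]). Consider
    the vectors v with <0|w v = 0 for all words w in a given set of operators.
    If for l > 0 every <0|E_{k,l} v = 0 follows from the vanishing of the words,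
    these vectors form a submodule; it does not contain the vacuum, hence it is
    zero. For the set of all E_{k,l} with l > 0 this shows that the positions
    x_{i,m} are pairwise distinct ([irreducible_nonresonant]): a coincidence
    x_{i,m} = x_{j,m'} gives rise to a nonzero singular vector, a signed sum of
    products of a column and a row Schur vector. For the cone 0 <= k <= N l,
    l > 0, it gives uniqueness: <0|E_{k,l} has N l nodes, so that by the
    Vandermonde argument ([moments_eq0]) the values for 0 <= k < N l determine
    those for all k; the difference of two Whittaker vectors, in the lowest
    degree where they differ, is killed by the operators of the cone, and
    therefore is zero ([whittaker_unique]).

    For existence, W is written down explicitly. It is the sum of phi(D) S_D
    over N-coloured states D that are neutral in every colour, where phi is a
    product of one-body factors and of differences x_p - x_r raised to plus or
    minus one, according to the charges of p and r. The coefficient of S_D in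
    E_{k,b} W is a sum over the modes p into which a hop of length b can lead.
    The ratio of the weights before and after the hop is a constant times
      x_p^(-1) prod_z (x_p - x_z) / prod_y (x_p - x_y),
    where y runs over the other modes of this kind, and z over the modes that
    are occupied in D while z - b is not ([hop_ratioE], [shift_prod_target]).
    There are N b more of the former than of the latter, as the sea of each
    colour is shifted by b. Lagrange interpolation then evaluates the sum: it
    vanishes for 0 < k < N b, and for k = 0 and k = N b it is the scalar
    required of a Whittaker vector, independently of D ([whit_sum]). *)

(** * States of the fermionic Fock space, and hops between them *)

(** The sums over all integers below have finite support but no fixed range; a
    finite range is enlarged or shifted by comparing supports. *)
Lemma eq_big_supp (R : Type) (idx : R) (op : Monoid.com_law idx) (T : eqType)
    (s1 s2 : seq T) (F : T -> R) :
  uniq s1 -> uniq s2 ->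
  (forall x, x \in s1 -> x \notin s2 -> F x = idx) ->
  (forall x, x \in s2 -> x \notin s1 -> F x = idx) ->
  \big[op/idx]_(x <- s1) F x = \big[op/idx]_(x <- s2) F x.
Proof.
move=> u1 u2 h1 h2.
have E (r r' : seq T) : (forall x, x \in r -> x \notin r' -> F x = idx) ->
    \big[op/idx]_(x <- r) F x = \big[op/idx]_(x <- [seq x <- r | x \in r']) F x.
  move=> h; rewrite (bigID (mem r')) /= [X in op _ X]big_seq_cond [X in op _ X]big1.
    by rewrite Monoid.mulm1 big_filter.
  by move=> x /andP[]; apply: h.
rewrite (E s1 s2 h1) (E s2 s1 h2); apply: perm_big; apply: uniq_perm.
- exact: filter_uniq.
- exact: filter_uniq.
by move=> x; rewrite !mem_filter andbC.
Qed.

Definition win (n : nat) : seq int := [seq i%:Z - n%:Z | i <- iota 0 n.*2].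

Lemma mem_win n m : (m \in win n) = (- n%:Z <= m) && (m < n%:Z).
Proof.
apply/mapP/idP => [ [j]|/andP[h1 h2]].
  by rewrite mem_iota => h ->; lia.
exists (absz (m + n%:Z)); last by lia.
by rewrite mem_iota; lia.
Qed.

Lemma win_uniq n : uniq (win n).
Proof. by rewrite map_inj_uniq ?iota_uniq // => i j; lia. Qed.

Lemma sum_win_shift (V : nmodType) (F : int -> V) n (t : int) :
  (forall m, (m \notin win n) || (m - t \notin win n) -> F m = 0) ->
  \sum_(m <- win n) F (m + t) = \sum_(m <- win n) F m.
Proof.
move=> h.
rewrite -(big_map (fun m => m + t) xpredT F); apply: eq_big_supp.
- by rewrite map_inj_uniq ?win_uniq // => i j; lia.
- exact: win_uniq.
- by move=> x _ hx; apply: h; rewrite hx.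
move=> x hx hn; apply: h; apply/orP; right; apply: contra hn => hm.
by apply/mapP; exists (x - t) => //; lia.
Qed.

Lemma sum_win_tel (V : zmodType) (H : int -> V) n (l : int) :
  - n%:Z <= l <= n%:Z ->
  \sum_(m <- win n) (H (m + 1) - H m) *+ (m < l)%R = H l - H (- n%:Z).
Proof.
move=> /andP[hl1 hl2].
rewrite /win big_map.
have E : forall k, (k <= n.*2)%N ->
    \sum_(i <- iota 0 k) (H (i%:Z - n%:Z + 1) - H (i%:Z - n%:Z)) *+ (i%:Z - n%:Z < l)%R
   = H (Num.min (k%:Z - n%:Z) l) - H (- n%:Z).
  elim=> [|k IH] hk.
    by rewrite big_nil add0r min_l ?subrr // .
  rewrite -addn1 iotaD big_cat /= big_seq1 add0n IH ?(ltnW hk) //.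
  case: (ltP (k%:Z - n%:Z) l) => h.
    rewrite mulr1n min_l; last by lia.
    by rewrite addrC subrKA; congr (H _ - _); lia.
  by rewrite mulr0n addr0 min_r //; lia.
by rewrite E // min_r //; lia.
Qed.

Section Fermions.
Variables (T : choiceType) (lt : rel T) (C : fieldType).
Implicit Types (a b m z : T) (D : {fset T}).

(** Adding and removing a particle are the same operation on a symmetric
    difference. *)
Definition tog m D := if m \in D then D `\ m else m |` D.

Lemma mem_tog x m D : (x \in tog m D) = (x \in D) (+) (x == m).
Proof.
rewrite /tog; case: ifP => h; rewrite !inE; case: eqVneq => [->|_]; rewrite ?h //=.
- by rewrite addbF.
- by rewrite addbF.
Qed.

Lemma togC a b D : tog a (tog b D) = tog b (tog a D).
Proof. by apply/fsetP => x; rewrite !mem_tog -!addbA [(x == b) (+) _]addbC. Qed.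

Lemma togK m D : tog m (tog m D) = D.
Proof. by apply/fsetP => x; rewrite !mem_tog -addbA addbb addbF. Qed.

Lemma tog_notin m D : m \notin D -> tog m D = m |` D.
Proof. by rewrite /tog => /negbTE ->. Qed.

Lemma big_tog (R : Type) (idx : R) (op : Monoid.com_law idx) (F : T -> R) m D :
  m \notin D ->
  \big[op/idx]_(z <- tog m D) F z = op (F m) (\big[op/idx]_(z <- D) F z).
Proof. by move=> h; rewrite tog_notin // big_fsetU1. Qed.

(** The Koszul sign of a fermionic mode: one factor -1 for each element of [D]
    below [m]. *)
Definition sg m D : C := \prod_(z <- D) (-1) ^+ (lt z m).

Lemma sg_tog a b D : sg a (tog b D) = (-1) ^+ (lt b a) * sg a D.
Proof.
case: (boolP (b \in D)) => h; last by rewrite /sg big_tog.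
rewrite /sg -{2}(togK b D) [X in _ = _ * X]big_tog; first by rewrite mulrA -expr2 sqrr_sign mul1r.
by rewrite mem_tog h eqxx.
Qed.

Lemma sg2 a D : sg a D * sg a D = 1.
Proof.
rewrite /sg -big_split /= big1 // => z _.
by rewrite -expr2 sqrr_sign.
Qed.

End Fermions.

Notation state := {fset int}.
Notation lti := (fun a b : int => a < b).

Section Modes.
Variable (C : fieldType).
Implicit Types (a b c d m : int) (D : state) (f g : state -> C).

Notation sgi := (sg lti C).

Lemma lti_tot a b : a != b -> lti b a = ~~ lti a b.
Proof. by move=> h; rewrite /= -leNgt le_eqVlt eq_sym (negbTE h). Qed.

(** A finite set of integers stands for a set of occupied modes, namely its
    symmetric difference with the Dirac sea of the negative integers, so that
    [fset0] is the vacuum. Normal ordering is relative to this sea. *)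
Definition occ m D := (m < 0) (+) (m \in D).

Lemma occ_tog m a D : occ m (tog a D) = occ m D (+) (m == a).
Proof. by rewrite /occ mem_tog addbA. Qed.

(** The fermionic operators of mode [a], acting on functions of states: [psi]
    creates a particle at [a] and [psis] removes one. Functions without
    finiteness condition are allowed, because every value is a finite
    expression. *)
Definition psi a f D : C := (occ a D)%:R * (sgi a D * f (tog a D)).
Definition psis a f D : C := (~~ occ a D)%:R * (sgi a D * f (tog a D)).

Lemma sg_swap a b D f : a != b ->
  sgi a D * (sgi b (tog a D) * f (tog b (tog a D))) =
  - (sgi b D * (sgi a (tog b D) * f (tog a (tog b D)))).
Proof.
move=> h; rewrite !sg_tog (togC b a) (lti_tot h).
case: (a < b) => /=; rewrite ?expr0 ?expr1; ring.
Qed.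

Lemma psi_anti a b f D : psi a (psi b f) D = - psi b (psi a f) D.
Proof.
rewrite /psi !occ_tog; case: (eqVneq a b) => [->|h].
  by rewrite addbT; case: (occ b D); rewrite /= ?(mul0r, mulr0, oppr0).
rewrite !addbF; case: (occ a D); case: (occ b D);
  by rewrite /= !(mul0r, mulr0, oppr0, mul1r) // sg_swap.
Qed.

Lemma psis_anti a b f D : psis a (psis b f) D = - psis b (psis a f) D.
Proof.
rewrite /psis !occ_tog; case: (eqVneq a b) => [->|h].
  by rewrite addbT; case: (occ b D); rewrite /= ?(mul0r, mulr0, oppr0).
rewrite !addbF; case: (occ a D); case: (occ b D);
  by rewrite /= !(mul0r, mulr0, oppr0, mul1r) // sg_swap.
Qed.

(** Together with [psi_anti] and [psis_anti], the canonical anticommutation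
    relations. *)
Lemma psi_psis a b f D :
  psis a (psi b f) D = (a == b)%:R * f D - psi b (psis a f) D.
Proof.
rewrite /psis /psi !occ_tog; case: (eqVneq a b) => [->|h].
  rewrite addbT togK !sg_tog /= ltxx expr0 mul1r !mulrA.
  by case: (occ b D); rewrite /= !(mul0r, mulr0, oppr0, mul1r, mulr1, subr0, sub0r, add0r) ?sg2 ?mul1r ?subrr.
rewrite !addbF mul0r add0r; case: (occ a D); case: (occ b D);
  by rewrite /= !(mul0r, mulr0, oppr0, mul1r) // sg_swap.
Qed.

Definition hop a b f := psi a (psis b f).

Lemma hop_comm a b c d f D :
  hop a b (hop c d f) D - hop c d (hop a b f) D =
  (b == c)%:R * hop a d f D - (a == d)%:R * hop c b f D.
Proof.
rewrite /hop.
have Ep x g h D0 : g =1 h -> psi x g D0 = psi x h D0 by move=> E; rewrite /psi E.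
have El x y g h D0 : psi x (fun D1 => y * g D1 - h D1) D0 = y * psi x g D0 - psi x h D0.
  by rewrite /psi; ring.
rewrite (Ep a _ _ _ (psi_psis b c (psis d f))) El psi_anti.
have -> : psi c (psi a (psis b (psis d f))) D = - psi c (psi a (psis d (psis b f))) D.
  rewrite (Ep c _ (fun D0 => 0 * 0 - psi a (psis d (psis b f)) D0)); last first.
    move=> D0; rewrite /= mul0r sub0r.
    rewrite (Ep a _ (fun D1 => 0 * 0 - psis d (psis b f) D1)).
      by rewrite (El a 0 (fun=>0)) mul0r sub0r.
    by move=> D1; rewrite /= mul0r sub0r psis_anti.
  by rewrite (El c 0 (fun=>0)) mul0r sub0r.
rewrite (Ep c _ _ _ (psi_psis d a (psis b f))) El.
by rewrite (eq_sym d a); ring.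
Qed.

(** The normally ordered bilinear [psi a (psis b _)]: its vacuum value is
    subtracted, and the infinite sums below become finite at each state. *)
Definition nhop a b f D : C := hop a b f D - ((a == b) && (a < 0)%R)%:R * f D.

(** The commutator of two normally ordered bilinears is that of matrix units,
    plus the Japanese cocycle, which comes from the reordering. *)
Lemma nhop_comm a b c d f D :
  nhop a b (nhop c d f) D - nhop c d (nhop a b f) D =
  (b == c)%:R * nhop a d f D - (a == d)%:R * nhop c b f D
  + ((b == c) && (a == d))%:R * ((a < 0)%R%:R - (b < 0)%R%:R) * f D.
Proof.
have El x y k g h D0 : hop x y (fun D1 => g D1 - k * h D1) D0
    = hop x y g D0 - k * hop x y h D0.
  by rewrite /hop /psi /psis; ring.
rewrite /nhop !El.
have := hop_comm a b c d f D.
move=> /(congr1 (fun x => x + hop c d (hop a b f) D)); rewrite subrK => ->.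
rewrite (eq_sym c b); case: (eqVneq b c) => [->|h1] /=; case: (eqVneq a d) => [->|h2] /=; ring.
Qed.

(** The value at [D] of the bilinear [nhop a b f] involves the single state
    [hopd a b D], with coefficient [hopc a b D] ([nhopE]). By [hopc_hopd] this
    is also the coefficient with which the basis vector of [D] changes when
    its particle at [a] moves to [b]. *)
Definition hopc a b D : C :=
  if a == b then (occ a D)%:R - (a < 0)%R%:R
  else (occ a D && ~~ occ b D)%:R * (sgi a D * sgi b (tog a D)).

Definition hopd a b D : state := if a == b then D else tog b (tog a D).

Lemma nhopE a b f D : nhop a b f D = hopc a b D * f (hopd a b D).
Proof.
rewrite /nhop /hop /psi /psis /hopc /hopd occ_tog; case: (eqVneq a b) => [->|h].
  rewrite addbT negbK togK sg_tog ltxx expr0 mul1r.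
  by case: (occ b D); case: (b < 0)%R; rewrite /= !(mul1r, mul0r) ?mulrA ?sg2; ring.
rewrite addbF /= mul0r subr0.
by case: (occ a D); case: (occ b D); rewrite /= !(mul0r,mul1r,mulr0) ?mulrA.
Qed.

Lemma hopd_sym a b D : hopd a b (hopd b a D) = D.
Proof.
by rewrite /hopd; case: (eqVneq a b) => // _; rewrite !togK.
Qed.

Lemma hopdC a b D : hopd a b D = hopd b a D.
Proof. by rewrite /hopd; case: (eqVneq a b) => // _; rewrite togC. Qed.

End Modes.

(** * The action of Diff_q on functions of states *)

Lemma sum_delta (R : pzRingType) (T : eqType) (s : seq T) (x : T) (F : T -> R) :
  uniq s ->
  \sum_(m <- s) (m == x)%:R * F m = (x \in s)%:R * F x.
Proof.
move=> us; case: (boolP (x \in s)) => h; last first.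
  rewrite mul0r big_seq big1 // => m hm.
  by case: eqVneq hm h => [->->|_]; rewrite ?mul0r.
rewrite (bigD1_seq x) //= eqxx big1 ?addr0 // => m /negbTE ->.
by rewrite mul0r.
Qed.

Section FermionModule.
Variables (C : fieldType) (s u : C).
Implicit Types (k l r t m : int) (D : state) (f g : state -> C).

(** In the wedge space E_{k,l} is the sum over m of [wt k l m] times the
    bilinear that moves a particle from m to m - l; up to normalisation these
    are the matrix coefficients of q-difference operators. *)
Definition wt k l m : C := u ^ k * s ^ (k * (l - 2 * m - 2)).

(** The eigenvalue of E_{k,0} on the vacuum: the regularised sum of u^k
    q^(-k(m+1)) over the occupied modes m < 0. *)
Definition eps k : C := u ^ k / (1 - s ^ (2 * k)).

(** Beyond this bound a state coincides with the vacuum. *)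
Definition bound D : nat := \max_(z <- D) (absz z).+1.

Lemma boundP z D : z \in D -> (absz z < bound D)%N.
Proof. by move=> h; rewrite /bound (big_rem z) //= leq_maxl. Qed.

Lemma bound_le n D : (forall z, z \in D -> (absz z < n)%N) -> (bound D <= n)%N.
Proof. by move=> h; apply/bigmax_leqP_seq => z /h. Qed.

Notation hopc := (@hopc C).

Lemma hopc_ne a b D : hopc a b D != 0 ->
  (a < (bound D)%:Z) && (- (bound D)%:Z <= b).
Proof.
have H1 : occ a D -> a < (bound D)%:Z.
  rewrite /occ; case: (boolP (a \in D)) => [/boundP h _|_]; first by lia.
  by rewrite addbF => h; lia.
have H2 : ~~ occ b D -> - (bound D)%:Z <= b.
  rewrite /occ; case: (boolP (b \in D)) => [/boundP h _|_]; first by lia.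
  by rewrite addbF => h; lia.
rewrite /hopc; case: (eqVneq a b) => [E|_].
  move: H2; rewrite -E /occ; case: (boolP (a \in D)) => [/boundP|] h; first by lia.
  by rewrite addbF subrr eqxx.
case: (boolP (occ a D)) => ha; case: (boolP (occ b D)) => hb; rewrite ?mul0r ?eqxx //=.
by rewrite H1 // H2.
Qed.

Lemma hopc_win m l D n : (bound D + absz l <= n)%N -> m \notin win n ->
  hopc (m - l) m D = 0.
Proof.
move=> hn; rewrite mem_win => h; apply/eqP; apply: contraNT h => /hopc_ne.
by lia.
Qed.

Lemma bound_hopd a b D : hopc a b D != 0 ->
  (bound (hopd a b D) <= bound D + `|a - b| + 1)%N.
Proof.
move=> /hopc_ne h; apply: bound_le => z; rewrite /hopd.
case: (eqVneq a b) => [_ /boundP|_]; first by lia.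
rewrite !mem_tog; case: (eqVneq z b) => [->|_]; first by lia.
case: (eqVneq z a) => [->|_]; first by lia.
by rewrite !addbF => /boundP; lia.
Qed.

Definition hop_sum k l f D : C :=
  \sum_(m <- win (bound D + absz l)) wt k l m * nhop (m - l) m f D.

Lemma hop_sum_win n k l f D : (bound D + absz l <= n)%N ->
  hop_sum k l f D = \sum_(m <- win n) wt k l m * nhop (m - l) m f D.
Proof.
move=> hn; apply: eq_big_supp; try exact: win_uniq.
- by move=> m _ /(hopc_win hn); rewrite nhopE => ->; rewrite mul0r mulr0.
- by move=> m _ /(hopc_win (leqnn _)); rewrite nhopE => ->; rewrite mul0r mulr0.
Qed.

Lemma hop_sum_comp n k l r t f D : (bound D + absz l + absz l + absz t + 1 <= n)%N ->
  hop_sum k l (hop_sum r t f) D = \sum_(m <- win n) \sum_(m' <- win n)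
     wt k l m * wt r t m' * nhop (m - l) m (nhop (m' - t) m' f) D.
Proof.
move=> hn; rewrite (@hop_sum_win n) //; last by lia.
apply: eq_bigr => m _; rewrite nhopE.
case: (eqVneq (hopc (m - l) m D) 0) => [h|h].
  by rewrite h big1 ?mul0r ?mulr0 // => m' _; rewrite nhopE h mul0r mulr0.
rewrite (@hop_sum_win n); last by have := bound_hopd h; lia.
rewrite !mulr_sumr; apply: eq_bigr => m' _.
by rewrite [nhop (m - l) m _ D]nhopE; ring.
Qed.

(** A telescoping sum, since the difference of the two indicator functions is
    supported on an interval of length l. *)
Lemma sum_cocycle (H : int -> C) n l : (absz l <= n)%N ->
  \sum_(m <- win n) (H (m + 1) - H m) * ((m - l < 0)%R%:R - (m < 0)%R%:R) = H l - H 0.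
Proof.
move=> hn.
have E1 := @sum_win_tel _ H n l; have E0 := @sum_win_tel _ H n 0.
have -> : H l - H 0 = (H l - H (- n%:Z)) - (H 0 - H (- n%:Z)) by ring.
rewrite -E1; last by lia.
rewrite -E0; last by lia.
rewrite -sumrB; apply: eq_bigr => m _.
by rewrite subr_lt0 mulrBr !mulr_natr.
Qed.

Hypotheses (hs : s != 0) (hu : u != 0).
Hypothesis hsn : forall n : nat, (0 < n)%N -> s ^+ n != 1.

Lemma exprz_neq1 k : k != 0 -> s ^ k != 1.
Proof.
case: k => n h; first by apply: hsn; rewrite lt0n.
by rewrite NegzE -exprnN invr_eq1 hsn.
Qed.

(** The weights multiply like elements of the quantum torus; the two orders of
    multiplication give the two powers of q in the bracket of Diff_q. *)
Lemma wt_mul k l r t m :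
  wt k l (m - t) * wt r t m = s ^ (t * k - l * r) * wt (k + r) (l + t) m.
Proof.
rewrite /wt mulrACA -expfzDr // [RHS]mulrCA -!expfzDr //; congr (_ * s ^ _); lia.
Qed.

Lemma wt_mul' k l r t m :
  wt k l m * wt r t (m - l) = s ^ (l * r - t * k) * wt (k + r) (l + t) m.
Proof. by rewrite mulrC wt_mul (addrC r) (addrC t). Qed.

(** The cocycle, summed against the weights, is a geometric series unless k +
    r = 0. The series is absorbed by the shift [eps] of the zero modes, and
    the resonant case leaves the central charge l. *)
Lemma central_term k l r n : (absz l <= n)%N ->
  \sum_(m <- win n) wt k l m * wt r (- l) (m - l) *
      ((m - l < 0)%R%:R - (m < 0)%R%:R) =
  (s ^ (- l * k - l * r) - s ^ (l * r - (- l) * k)) * eps (k + r)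
   + (k == - r)%:R * l%:~R.
Proof.
move=> hn; case: (eqVneq k (- r)) => [->|h].
  rewrite (_ : - l * - r - l * r = 0); last by lia.
  rewrite (_ : l * r - - l * - r = 0); last by lia.
  rewrite subrr mul0r add0r [true%:R * _]mul1r -(subr0 l%:~R) -[0 in RHS]/(0%:~R).
  rewrite -(sum_cocycle (fun m => m%:~R) hn); apply: eq_bigr => m _; congr (_ * _).
  rewrite wt_mul' subrr addNr /wt expr0z mul0r expr0z !mulr1.
  rewrite intrD addrAC subrr add0r.
  by rewrite (_ : l * r - - l * - r = 0) //; lia.
rewrite [false%:R * _]mul0r addr0.
have h2 : 2 * (k + r) != 0 by lia.
have h3 : 1 - s ^ (2 * (k + r)) != 0 by rewrite subr_eq0 eq_sym exprz_neq1.
pose H m := s ^ (l * (k + r) - 2 * m * (k + r)) * eps (k + r).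
have := sum_cocycle H hn; rewrite /H => E.
transitivity (s ^ (- l * (k + r)) * eps (k + r) - s ^ (l * (k + r)) * eps (k + r)); last first.
  by rewrite -mulrBl; congr ((s ^ _ - s ^ _) * _); lia.
move: E; rewrite (_ : l * (k + r) - 2 * l * (k + r) = - l * (k + r)); last by lia.
rewrite mulr0 mul0r subr0 => <-; apply: eq_bigr => m _; congr (_ * _).
rewrite wt_mul' -mulrBl /wt subrr.
rewrite [s ^ (l * (k + r) - 2 * m * (k + r))](_ : _ =
  s ^ (l * (k + r) - 2 * (m + 1) * (k + r)) * s ^ (2 * (k + r))); last first.
  by rewrite -expfzDr //; congr (s ^ _); lia.
rewrite -{1}[s ^ _ in RHS]mulr1 -mulrBr /eps.
rewrite mulrCA -expfzDr //.
rewrite [s ^ _](_ : _ = s ^ (l * (k + r) - 2 * (m + 1) * (k + r))); last by congr (s ^ _); lia.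
by field.
Qed.

(** Both compositions are double sums over a common finite window; [nhop_comm]
    leaves single sums, which [wt_mul] identifies. *)
Lemma hop_sum_comm k l r t f D :
  hop_sum k l (hop_sum r t f) D - hop_sum r t (hop_sum k l f) D =
  (s ^ (t * k - l * r) - s ^ (l * r - t * k)) * hop_sum (k + r) (l + t) f D
  + (l == - t)%:R * ((s ^ (t * k - l * r) - s ^ (l * r - t * k)) * eps (k + r)
   + (k == - r)%:R * l%:~R) * f D.
Proof.
(* Twice each index: a second hop may start where the first one ended. *)
pose n := (bound D + 2 * absz l + 2 * absz t + 1)%N.
rewrite (@hop_sum_comp n) ?(@hop_sum_comp n r t); [|rewrite /n; lia|rewrite /n; lia].
rewrite [X in _ - X]exchange_big /= -sumrB.
have T m m' : wt k l m * wt r t m' * nhop (m - l) m (nhop (m' - t) m' f) D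
   - wt r t m' * wt k l m * nhop (m' - t) m' (nhop (m - l) m f) D =
      (m' == m + t)%:R * (wt k l m * wt r t m' * nhop (m - l) m' f D) +
      ((m' == m - l)%:R * (- (wt k l m * wt r t m' * nhop (m' - t) m f D)) +
      (m' == m - l)%:R * ((l == - t)%:R * (wt k l m * wt r t m' * ((m - l < 0)%R%:R - (m < 0)%R%:R) * f D))).
  rewrite [wt r t m' * _]mulrC -mulrBr nhop_comm.
  have -> : (m == m' - t) = (m' == m + t) by lia.
  have -> : (m - l == m') = (m' == m - l) by lia.
  have -> : ((m' == m + t) && (m' == m - l)) = (m' == m - l) && (l == - t) by lia.
  by rewrite -mulnb natrM; ring.
under eq_bigr => m _.
  rewrite -sumrB.
  under eq_bigr => m' _ do rewrite T.
  rewrite !big_split /= !sum_delta ?win_uniq //.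
  over.
rewrite !big_split /= addrA; congr (_ + _).
  rewrite mulrBl; congr (_ + _).
    pose F m' := (m' - t \in win n)%:R * ((m' \in win n)%:R *
      (wt k l (m' - t) * wt r t m' * nhop (m' - (l + t)) m' f D)).
    transitivity (\sum_(m <- win n) F (m + t)).
      apply: eq_big_seq => m hm.
      by rewrite /F addrK hm mul1r (_ : m + t - (l + t) = m - l) //; lia.
    rewrite sum_win_shift /F; last first.
      by move=> m /orP[] /negbTE ->; rewrite !(mul0r, mulr0).
    rewrite (@hop_sum_win n) ?mulr_sumr; last by rewrite /n; lia.
    apply: eq_big_seq => m hm.
    rewrite hm mul1r wt_mul nhopE.
    case: (eqVneq (hopc (m - (l + t)) m D) 0) => [->|h]; first by rewrite !(mul0r, mulr0).
    suff -> : m - t \in win n by rewrite mul1r !mulrA ?mulNr.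
    by have := hopc_ne h; rewrite mem_win /n; lia.
  rewrite (@hop_sum_win n) ?mulr_sumr; last by rewrite /n; lia.
  rewrite -sumrN; apply: eq_big_seq => m hm.
  rewrite wt_mul' (_ : m - l - t = m - (l + t)); last by lia.
  rewrite nhopE.
  case: (eqVneq (hopc (m - (l + t)) m D) 0) => [->|h]; first by rewrite !(mul0r, mulr0, oppr0).
  suff -> : m - l \in win n by rewrite mul1r !mulrA ?mulNr.
  by have := hopc_ne h; rewrite mem_win /n; lia.
case: (eqVneq l (- t)) => [E|h]; last first.
  by rewrite !mul0r big1 // => m _; rewrite mul0r mulr0.
rewrite mul1r.
have -> : t = - l by lia.
rewrite -(@central_term k l r n); last by rewrite /n; lia.
rewrite mulr_suml; apply: eq_big_seq => m hm.
rewrite mul1r.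
case: (boolP (m - l \in win n)) => h; first by rewrite mul1r.
rewrite mul0r; have -> : (m - l < 0) = (m < 0).
  by move: h hm; rewrite !mem_win /n; lia.
by rewrite subrr mulr0 mul0r.
Qed.

Definition wedgeE k l f D : C :=
  if (k == 0) && (l == 0) then 0 else hop_sum k l f D + (l == 0)%:R * eps k * f D.

(** The wedge space is a module over Diff_q with c = 1 and c' = 0. *)
Lemma wedgeE_comm k l r t f D :
  wedgeE k l (wedgeE r t f) D - wedgeE r t (wedgeE k l f) D =
  (s ^ (t * k - l * r) - s ^ (l * r - t * k)) * wedgeE (k + r) (l + t) f D
  + ((k == - r) && (l == - t))%:R * l%:~R * f D.
Proof.
have Elin a b g h c D0 : hop_sum a b (fun D1 => g D1 + c * h D1) D0 = hop_sum a b g D0 + c * hop_sum a b h D0.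
  rewrite /hop_sum mulr_sumr -big_split /=; apply: eq_bigr => m _.
  by rewrite !nhopE; ring.
have E0 a b D0 : hop_sum a b (fun=> 0) D0 = 0.
  by rewrite /hop_sum big1 // => m _; rewrite !nhopE !mulr0.
rewrite /wedgeE; case: (boolP ((k == 0) && (l == 0))) => [/andP[/eqP -> /eqP ->]|h1].
  rewrite !mul0r !mulr0 E0 !subrr !mul0r addr0.
  by case: ifP => _; rewrite ?addr0 subr0.
case: (boolP ((r == 0) && (t == 0))) => [/andP[/eqP -> /eqP ->]|h2].
  rewrite !mul0r !mulr0 E0 addr0 !subrr !mul0r add0r oppr0.
  by case: (eqVneq l 0) => [->|]; rewrite ?mulr0 ?andbF !mul0r.
rewrite !Elin.
rewrite (_ : (k + r == 0) = (k == - r)); last by lia.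
rewrite (_ : (l + t == 0) = (l == - t)); last by lia.
transitivity (hop_sum k l (hop_sum r t f) D - hop_sum r t (hop_sum k l f) D); first by ring.
rewrite hop_sum_comm; case: (eqVneq k (- r)) => [->|hk] /=; case: (eqVneq l (- t)) => [->|hl] /=; try ring.
rewrite (_ : t * - r - - t * r = 0); last by lia.
rewrite (_ : - t * r - t * - r = 0); last by lia.
by ring.
Qed.

End FermionModule.

(** * Separating hops by interpolation *)

(** Such polynomials turn the dependence of E_{k,l} on k into a projection
    onto a single hop. *)
Lemma lagrange_poly (C : fieldType) (ys : seq C) (y0 : C) : uniq ys -> y0 \in ys ->
  exists p : {poly C}, (size p <= size ys)%N /\
    forall y, y \in ys -> p.[y] = (y == y0)%:R.
Proof.
move=> us h0; pose r := rem y0 ys; pose p0 := \prod_(y <- r) ('X - y%:P).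
have hr : size ys = (size r).+1 by rewrite size_rem // prednK //; case: (ys) h0.
have n0 : p0.[y0] != 0.
  rewrite horner_prod prodf_seq_neq0; apply/allP => y.
  rewrite mem_rem_uniq // inE => /andP[h _] /=.
  by rewrite !hornerE subr_eq0 eq_sym.
exists (p0.[y0]^-1 *: p0); split.
  by rewrite (leq_trans (size_scale_leq _ _)) // size_prod_XsubC hr.
move=> y hy; rewrite hornerZ; case: (eqVneq y y0) => [->|h].
  by rewrite mulVf.
have: root p0 y by rewrite root_prod_XsubC mem_rem_uniq // inE h.
by move=> /eqP ->; rewrite mulr0.
Qed.

(** The Vandermonde argument, in the form used for uniqueness: only as many
    moments as there are nodes need to vanish. *)
Lemma moments_eq0 (C : fieldType) (T : eqType) (r : seq T) (x l : T -> C) :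
  uniq r -> {in r &, injective x} ->
  (forall a, (a < size r)%N -> \sum_(i <- r) x i ^+ a * l i = 0) ->
  {in r, forall i, l i = 0}.
Proof.
move=> ur xi h i hi.
have um : uniq (map x r) by rewrite map_inj_in_uniq.
have [p [sp hp]] := lagrange_poly um (map_f x hi).
transitivity (\sum_(j <- r) p.[x j] * l j).
  rewrite (bigD1_seq i) //= hp ?map_f // eqxx mul1r big_seq_cond big1 ?addr0 //.
  move=> j /andP[hj hji]; rewrite hp ?map_f // (_ : (x j == x i) = false) ?mul0r //.
  by apply/negbTE; apply: contra hji => /eqP/xi -> //.
rewrite size_map in sp.
under eq_bigr => j _ do rewrite (horner_coef_wide _ sp) mulr_suml.
rewrite exchange_big big1 //= => a _.
under eq_bigr => j _ do rewrite -mulrA.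
by rewrite -mulr_sumr h // mulr0.
Qed.

Section Delta.
Variables (C : fieldType) (s u : C).
Implicit Types (k l r t m : int) (D : state) (f g : state -> C).

Notation wedgeE := (wedgeE s u).
Notation hopc := (@hopc C).

Definition delta D : state -> C := fun D' => (D' == D)%:R.

Lemma hopc_hopd a b D : hopc a b (hopd a b D) = hopc b a D.
Proof.
rewrite /hopc /hopd; case: (eqVneq a b) => [->//|h].
have hb : (b == a) = false by rewrite eq_sym (negbTE h).
rewrite !occ_tog !eqxx (negbTE h) hb !addbF !addbT negbK.
congr (_ * _); first by rewrite andbC.
rewrite [tog a (tog b _)]togC togK.
rewrite (togC b) [sg _ _ a (tog a _)]sg_tog [sg _ _ b (tog b _)]sg_tog /= !ltxx !expr0 !mul1r.
by rewrite mulrC.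
Qed.

Lemma nhop_delta a b D D' :
  nhop a b (delta D) D' = hopc b a D * delta (hopd b a D) D'.
Proof.
have E X : hopd a b (hopd a b X) = X by rewrite (hopdC a b X) hopd_sym.
rewrite nhopE /delta (hopdC b); have -> : (hopd a b D' == D) = (D' == hopd a b D).
  by apply/eqP/eqP => [<-|->]; rewrite E.
case: eqVneq => [->|_]; last by rewrite !mulr0.
by rewrite hopc_hopd.
Qed.

(** The weight of a hop in E_{k,l} is the k-th power of this node, and
    distinct hops have distinct nodes. *)
Definition rho l m : C := u * s ^ (l - 2 * m - 2).

Lemma wt_rho k l m : wt s u k l m = rho l m ^ k.
Proof. by rewrite /wt /rho expfzMl exprz_exp mulrC [_ * k]mulrC mulrC. Qed.

Lemma wedgeE_delta k l D n : (bound D + absz l <= n)%N -> k != 0 \/ l != 0 -> forall D',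
  wedgeE k l (delta D) D' = \sum_(m <- win n) rho l m ^ k * (hopc m (m - l) D * delta (hopd m (m - l) D) D')
     + (l == 0)%:R * eps s u k * delta D D'.
Proof.
move=> hn hkl D'; rewrite /wedgeE ifF; last by lia.
congr (_ + _).
rewrite (@hop_sum_win C s u (n + bound D' + absz l)); last by lia.
have E m : wt s u k l m * nhop (m - l) m (delta D) D' =
   rho l m ^ k * (hopc m (m - l) D * delta (hopd m (m - l) D) D').
  by rewrite wt_rho nhop_delta.
under eq_bigr => m _ do rewrite E.
apply: eq_big_supp; rewrite ?win_uniq // => m; last by rewrite !mem_win; lia.
move=> _; rewrite mem_win => h.
case: (eqVneq (hopc m (m - l) D) 0) => [->|/hopc_ne]; first by rewrite mul0r mulr0.
by lia.
Qed.

Lemma hopc_vac m l : l >= 0 -> hopc m (m - l) fset0 = 0.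
Proof.
move=> hl; rewrite /hopc /occ !in_fset0 !addbF.
case: eqVneq => h; first by rewrite subrr.
by rewrite (_ : _ && _ = false) ?mul0r //; lia.
Qed.

Lemma wedgeE_vac k l : l >= 0 -> forall D,
  wedgeE k l (delta fset0) D = (l == 0)%:R * eps s u k * delta fset0 D.
Proof.
move=> hl D; case: (boolP ((k == 0) && (l == 0))) => [/andP[/eqP -> /eqP ->]|h].
  by rewrite /wedgeE /eps !eqxx /= mulr0 !expr0z subrr invr0 !mulr0 mul0r.
rewrite (wedgeE_delta (leqnn _)); last by move: h; case: eqVneq => // _; [right|left].
rewrite big1 ?add0r // => m _.
by rewrite hopc_vac // mul0r mulr0.
Qed.

Lemma hopc_vac_neg m l : l <= 0 -> hopc (m - l) m fset0 = 0.
Proof.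
by move=> hl; rewrite -[X in hopc _ X](_ : m - l - (- l) = m) ?hopc_vac //; lia.
Qed.

Lemma wedgeE_at_vac k l f : l <= 0 -> wedgeE k l f fset0 = (l == 0)%:R * eps s u k * f fset0.
Proof.
move=> hl; rewrite /wedgeE; case: ifP => [/andP[/eqP -> /eqP ->]|_].
  by rewrite /eps !eqxx /= mulr0 !expr0z subrr invr0 !mulr0 mul0r.
rewrite /hop_sum big1 ?add0r // => m _.
by rewrite nhopE hopc_vac_neg // mul0r mulr0.
Qed.

(** For l = n > 0 the dual vacuum sees exactly n hops: those that refill the
    modes -n, ..., -1 of the sea from the modes 0, ..., n-1. This count of
    nodes is what makes the cone 0 <= k <= N l of the Whittaker conditions
    large enough. *)
Lemma wedgeE_at_vac_pos k (n : nat) f : (0 < n)%N ->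
  wedgeE k n%:Z f fset0 =
  \sum_(i < n) rho n i ^ k * nhop (i%:Z - n%:Z) i f fset0.
Proof.
move=> hn; rewrite /wedgeE ifF; last by lia.
rewrite (_ : (n%:Z == 0) = false); last by lia.
rewrite !mul0r addr0.
have -> : \sum_(i < n) rho n i ^ k * nhop (i%:Z - n%:Z) i f fset0 =
   \sum_(m <- [seq i%:Z | i <- iota 0 n]) wt s u k n%:Z m * nhop (m - n%:Z) m f fset0.
  rewrite big_map -[n in iota 0 n]subn0 big_mkord.
  by apply: eq_bigr => i _; rewrite wt_rho.
apply: eq_big_supp.
- exact: win_uniq.
- by rewrite map_inj_uniq ?iota_uniq // => i j; lia.
- move=> m h1 h2; rewrite nhopE /hopc /occ !in_fset0 !addbF ifF; last by lia.
  rewrite (_ : _ && _ = false) ?mul0r ?mulr0 //.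
  apply/negP => h; case/mapP: h2; exists (absz m); last by lia.
  by rewrite mem_iota; lia.
by move=> m /mapP[j]; rewrite mem_iota => h ->; rewrite mem_win; lia.
Qed.

Hypotheses (hs : s != 0) (hu : u != 0).
Hypothesis hsn : forall n : nat, (0 < n)%N -> s ^+ n != 1.

Lemma rho_inj l : injective (rho l).
Proof.
move=> m m' /(mulfI hu) h.
have : s ^ (2 * (m' - m)) = 1.
  apply: (mulfI (expfz_neq0 (l - 2 * m' - 2) hs)).
  by rewrite -expfzDr // mulr1 -h; congr (s ^ _); lia.
case: (eqVneq m m') => // hm /eqP; rewrite (negbTE (exprz_neq1 hsn _)) //; lia.
Qed.

Variable S : (state -> C) -> Prop.
Hypothesis S0 : S (fun=> 0).
Hypothesis Slin : forall a f g, S f -> S g -> S (fun D => a * f D + g D).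
Hypothesis SE : forall k l f, S f -> S (wedgeE k l f).

Lemma closed_sum (T : Type) (r : seq T) (c : T -> C) (F : T -> state -> C) :
  (forall i, S (F i)) -> S (fun D => \sum_(i <- r) c i * F i D).
Proof.
move=> h; elim: r => [|i r IH].
  by rewrite (_ : (fun D => _) = (fun=> 0)) //; apply/funext => D; rewrite big_nil.
rewrite (_ : (fun D => _) = (fun D => c i * F i D + \sum_(i <- r) c i * F i D)).
  exact: Slin.
by apply/funext => D; rewrite big_cons.
Qed.

(** The nodes [rho l m] are distinct, hence a linear combination over k of the
    operators E_{k,l} performs one single hop. *)
Lemma closed_hop D a b : a != b -> S (delta D) ->
  S (fun D' => hopc a b D * delta (hopd a b D) D').
Proof.
move=> hab hD; pose l := a - b; pose n := (bound D + absz l)%N.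
have hl : l != 0 by rewrite /l; lia.
case: (boolP (a \in win n)) => ha; last first.
  rewrite (_ : (fun D' => _) = (fun=> 0)) //; apply/funext => D'.
  case: (eqVneq (hopc a b D) 0) => [->|/hopc_ne]; first by rewrite mul0r.
  by move: ha; rewrite mem_win /n /l; lia.
have um : uniq (map (rho l) (win n)).
  by rewrite map_inj_uniq ?win_uniq //; exact: rho_inj.
(* p selects the node of the hop from a among all nodes of the window. *)
have [p [_ hp]] := lagrange_poly um (map_f (rho l) ha).
rewrite (_ : (fun D' => _) = (fun D' => \sum_(k <- iota 0 (size p)) p`_k * wedgeE k%:Z l (delta D) D')).
  by apply: closed_sum => k; apply: SE.
apply/funext => D'.
under eq_bigr => k _.
  rewrite (wedgeE_delta (leqnn _)); last by right.
  rewrite (negbTE hl) !mul0r addr0 mulr_sumr.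
  over.
rewrite exchange_big /=.
rewrite (bigD1_seq a) ?win_uniq //= [X in _ + X]big_seq_cond [X in _ + X]big1 ?addr0; last first.
  move=> m /andP[hm hma].
  under eq_bigr => k _ do rewrite mulrA -exprnP.
  rewrite -mulr_suml -[X in iota 0 X]subn0 big_mkord -horner_coef hp ?map_f //.
  by rewrite (inj_eq (rho_inj (l := l))) (negbTE hma) mul0r.
under eq_bigr => k _ do rewrite mulrA -exprnP.
rewrite -mulr_suml -[X in iota 0 X]subn0 big_mkord -horner_coef hp ?map_f //.
rewrite eqxx mul1r (_ : a - l = b) //; rewrite /l; lia.
Qed.

End Delta.

(** * Linear maps on free vector spaces, vertex operators at the vacuum *)

Section LinearFunctions.
Variables (C : fieldType) (V W : lmodType C) (f : V -> W).
Hypothesis fl : linear f.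

Lemma lin0 : f 0 = 0.
Proof. by have := fl (-1) 0 0; rewrite scaler0 addr0 scaleN1r addNr. Qed.
Lemma linZ a v : f (a *: v) = a *: f v.
Proof. by rewrite -[a *: v]addr0 fl lin0 addr0. Qed.
Lemma linD v w : f (v + w) = f v + f w.
Proof. by rewrite -[v]scale1r fl !scale1r. Qed.
Lemma linB v w : f (v - w) = f v - f w.
Proof. by rewrite linD -scaleN1r linZ scaleN1r. Qed.
Lemma lin_sum (T : Type) (r : seq T) (P : pred T) (F : T -> V) :
  f (\sum_(i <- r | P i) F i) = \sum_(i <- r | P i) f (F i).
Proof. exact: (big_morph f linD lin0). Qed.
Lemma lin_comb X Y Z a c d :
  f (X + (a *: Y + c *: (d *: Z))) = f X + (a *: f Y + c *: (d *: f Z)).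
Proof. by rewrite !linD !linZ. Qed.
End LinearFunctions.

Section LinearCombinators.
Variables (C : fieldType) (U V W : lmodType C).

Lemma islin_comp (f : V -> W) (g : U -> V) : linear f -> linear g -> linear (fun v => f (g v)).
Proof. by move=> hf hg a v w; rewrite hg hf. Qed.

Lemma islin_add (f g : V -> W) : linear f -> linear g -> linear (fun v => f v + g v).
Proof. by move=> hf hg a v w; rewrite hf hg scalerDr addrACA. Qed.

Lemma islin_scale (f : V -> W) c : linear f -> linear (fun v => c *: f v).
Proof. by move=> hf a v w; rewrite hf scalerDr !scalerA mulrC. Qed.

Lemma islin_id : linear (id : V -> V).
Proof. by []. Qed.

Lemma islin_zero : linear (fun _ : V => 0 : W).
Proof. by move=> a v w; rewrite scaler0 addr0. Qed.

Lemma islin_sum (T : Type) (r : seq T) (f : T -> V -> W) :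
  (forall i, linear (f i)) -> linear (fun v => \sum_(i <- r) f i v).
Proof.
by move=> hf a v w; rewrite scaler_sumr -big_split; apply: eq_bigr => i _; apply: hf.
Qed.
End LinearCombinators.

Section Lext.
Variables (C : fieldType) (K : choiceType).
Implicit Types (v w : {malg C[K]}) (b : K).

Lemma malg_sumE v : v = \sum_(b <- msupp v) v@_b *: << b >>.
Proof.
rewrite {1}[v]monalgE; apply: eq_bigr => b _.
by apply/malgP => c; rewrite mcoeffZ !mcoeffU mulrnAr mulr1.
Qed.

Variable (V : lmodType C).
Implicit Types f : K -> V.

Lemma lextE f v (D : {fset K}) : msupp v `<=` D -> lext f v = \sum_(b <- D) v@_b *: f b.
Proof.
move=> h; rewrite /lext; apply: (big_fset_incl _ h) => b _ hb.
by rewrite mcoeff_outdom // scale0r.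
Qed.

Lemma lext_linear f : linear (lext f).
Proof.
move=> a v w; pose D := msupp v `|` msupp w.
rewrite (@lextE f v D) ?fsubsetUl // (@lextE f w D) ?fsubsetUr //.
rewrite (@lextE f _ D); last first.
  apply: fsubset_trans (msuppD_le _ _) _; apply: fsetSU; exact: msuppZ_le.
rewrite scaler_sumr -big_split; apply: eq_bigr => b _ /=.
by rewrite mcoeffD mcoeffZ scalerDl scalerA.
Qed.

Lemma lextU f b : lext f << b >> = f b.
Proof. by rewrite /lext msuppU oner_eq0 big_seq_fset1 mcoeffUU scale1r. Qed.

(** Identities between linear operators are proved on the basis. *)
Lemma lin_ext (f g : {malg C[K]} -> V) : linear f -> linear g ->
  (forall b, f << b >> = g << b >>) -> f =1 g.
Proof.
move=> hf hg h v; rewrite [v]malg_sumE !lin_sum //.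
by apply: eq_bigr => b _; rewrite !linZ // h.
Qed.

End Lext.

Lemma malg_neq0 (C : fieldType) (K : choiceType) (v : {malg C[K]}) : v != 0 -> exists b, v@_b != 0.
Proof.
move=> h; apply: contrapT => hn; case/eqP: h; apply/malgP => b; rewrite mcoeff0.
by apply/eqP; apply: contrapT => hb; apply: hn; exists b; apply/negP.
Qed.

Lemma mcoeff_linear (C : fieldType) (K : choiceType) (b : K) :
  linear (fun v : {malg C[K]} => v@_b : C^o).
Proof. by move=> a v w; rewrite mcoeffD mcoeffZ. Qed.

Lemma mcoeff_sum (C : fieldType) (K : choiceType) (b : K) (T : Type) (r : seq T) (P : pred T) (F : T -> {malg C[K]}) :
  (\sum_(i <- r | P i) F i)@_b = \sum_(i <- r | P i) (F i)@_b.
Proof. exact: (lin_sum (@mcoeff_linear C K b)). Qed.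

Lemma mcoeff_lext (C : fieldType) (K K' : choiceType) (f : K -> {malg C[K']}) (v : {malg C[K]})
  (c : K') : (lext f v)@_c = \sum_(b <- msupp v) v@_b * (f b)@_c.
Proof. by rewrite /lext mcoeff_sum; apply: eq_bigr => b _; rewrite mcoeffZ. Qed.

Notation one_mon := (onecm nat).

Section Heisenberg.
Variable (C : fieldType).
Implicit Types (v w : fock C) (b : fock_basis).

Lemma heis_raise j b : heis (Negz j) << b >> = << mulcm b (ucm j) >> :> fock C.
Proof. by rewrite /heis lextU. Qed.

Lemma heis_raise_vac k v : k < 0 -> (heis k v)@_one_mon = 0.
Proof.
case: k => // j _; rewrite /heis mcoeff_lext big1 // => b _.
rewrite mcoeffU1; case: eqP => [E|_]; last by rewrite mulr0.
have := congr1 (fun m : fock_basis => m j) E.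
by rewrite mulcmE ucmE eqxx onecmE addn1.
Qed.

Lemma heis_lower j v b :
  (heis (Posz j.+1) v)@_b = (j.+1 * (b j).+1)%:R * v@_(mulcm b (ucm j)).
Proof.
pose c := mulcm b (ucm j).
rewrite /heis (@lextE _ _ _ _ _ (c |` msupp v)) ?fsubsetUr // mcoeff_sum.
have E b' : (v@_b' *: ((j.+1 * b' j)%:R *: << divcm b' (ucm j) >>) : fock C)@_b =
   (b' == c)%:R * ((j.+1 * (b j).+1)%:R * v@_c).
  rewrite !mcoeffZ mcoeffU1; case: (eqVneq b' c) => [->|h].
    have -> : divcm c (ucm j) = b.
      by apply/eqP/cmP => i; rewrite divcmE mulcmE addnK.
    by rewrite eqxx mulr1 mul1r mulrC mulcmE ucmE eqxx addn1.
  rewrite mul0r; case: (posnP (b' j)) => [->|hj]; first by rewrite muln0 mul0r mulr0.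
  case: eqP => [E|_]; last by rewrite !mulr0.
  case/eqP: h; apply/eqP/cmP => i.
  have := congr1 (fun m : fock_basis => m i) E.
  rewrite divcmE !mulcmE !ucmE; case: eqVneq => [<-|_]; last by rewrite subn0 addn0.
  by move=> <-; rewrite subnK.
under eq_bigr => b' _ do rewrite E.
by rewrite sum_delta ?fset_uniq // !inE eqxx mul1r.
Qed.

Lemma exp_coef0 (B : nat -> fock C -> fock C) m w : m = 0%N -> exp_coef B m w = w.
Proof.
move=> ->; rewrite /exp_coef big_ord1 fact0 invr1 scale1r (big_pred1 [tuple]) //=.
move=> t; rewrite (tuple0 t) /= big_nil; exact/esym/eqP.
Qed.

Lemma exp_coef1 (B : nat -> fock C -> fock C) m w : m = 1%N -> exp_coef B m w = B 1%N w.
Proof.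
move=> ->; rewrite /exp_coef big_ord_recl big_ord1 fact0 invr1 scale1r /= big1 ?add0r; last first.
  by move=> t; rewrite (tuple0 t) /= big_nil.
rewrite (big_pred1 [tuple ord_max : 'I_2]) /=.
  by rewrite scale1r.
case/tupleP => a t; rewrite (tuple0 t) /= big_cons big_nil.
case: a => [[|[|a]] ha] //=; apply/esym/eqP => //.
Qed.

Lemma exp_coef_vac (x : nat -> C) m w : (0 < m)%N ->
  (exp_coef (fun k w => x k *: heis (- k%:Z) w) m w)@_one_mon = 0.
Proof.
move=> hm; rewrite /exp_coef mcoeff_sum big1 // => r _.
rewrite mcoeffZ mcoeff_sum big1 ?mulr0 // => t /andP[].
case: t => [[|k t] ht] /=; first by rewrite big_nil => _ /eqP E; rewrite -E in hm.
move=> /andP[hk _] _; rewrite mcoeffZ heis_raise_vac ?mulr0 //.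
by rewrite oppr_lt0.
Qed.

Lemma max_deg_vac : (\max_(b <- msupp (<< one_mon >> : fock C)) fock_deg b)%N = 0%N.
Proof.
rewrite msuppU oner_eq0 big_seq_fset1 /fock_deg big1_seq // => j.
by rewrite mem_finsupp /= onecmE.
Qed.

(** On the vacuum, the annihilation part of a vertex operator acts as the
    identity, and so does the constant term of its creation part. Dually, in
    [vertex_at_vac], no creation operator has a component along the vacuum. *)
Lemma vertex_vac0 (x : int -> C) : vertex_coef x 0 << one_mon >> = << one_mon >>.
Proof. by rewrite /vertex_coef max_deg_vac big_ord1 !exp_coef0. Qed.

Lemma vertex_vac1 (x : int -> C) :
  vertex_coef x 1 << one_mon >> = x 1 *: heis (-1) << one_mon >>.
Proof.
rewrite /vertex_coef max_deg_vac big_ord1 exp_coef1; last by [].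
rewrite exp_coef0; last by [].
by [].
Qed.

Lemma vertex_at_vac (x : int -> C) v : (vertex_coef x 0 v)@_one_mon = v@_one_mon.
Proof.
rewrite /vertex_coef mcoeff_sum big_ord_recl [X in _ + X]big1 ?addr0; last first.
  by move=> j _; exact: (@exp_coef_vac (fun k => x k%:Z)).
rewrite exp_coef0; last by [].
by rewrite exp_coef0.
Qed.

End Heisenberg.

Section Vacuum.
Variables (C : fieldType) (s u : C) (V : lmodType C) (E : int -> int -> V -> V).
Variables (v0 : V) (phi : V -> C^o).
Hypothesis hs : s != 0.
Hypothesis hsn : forall n : nat, (0 < n)%N -> s ^+ n != 1.
Hypothesis El : forall k l, linear (E k l).
Hypothesis phil : linear phi.
Hypothesis Ecomm : forall k l r t v, ~~ ((k == - r) && (l == - t)) ->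
  E k l (E r t v) = E r t (E k l v) +
    (s ^ (t * k - l * r) - s ^ (l * r - t * k)) *: E (k + r) (l + t) v.
Hypothesis E0vac : forall b, 0 < b -> E 0 b v0 = 0.
Hypothesis E1vac : E 1 0 v0 = (u / (1 - s ^+ 2)) *: v0.
Hypothesis E1vac' : E 1 (-1) v0 = (u / (1 - s ^+ 2) * (s^-1 - s)) *: E 0 (-1) v0.
Hypothesis phi0 : forall b v, b < 0 -> phi (E 0 b v) = 0.
Hypothesis phi1 : forall v, phi (E 1 0 v) = (u / (1 - s ^+ 2)) * phi v.

Lemma exprz_sub_neq0 b : b != 0 -> s ^ b - s ^ (- b) != 0.
Proof.
move=> hb; rewrite subr_eq0; apply/eqP => h.
have := exprz_neq1 hsn (k := b + b); rewrite expfzDr // {2}h -expfzDr // subrr expr0z eqxx.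
by move=> H; apply: notF; apply: H; lia.
Qed.

(** Since [E_{1,0}, E_{k,b}] is a nonzero multiple of E_{k+1,b} for b <> 0,
    every E_{k,b} with k > 0 is obtained from E_{0,b}; the values at the
    vacuum follow by induction on k. *)
Lemma E_step (k b : int) v : b != 0 ->
  E (1 + k) b v = (s ^ b - s ^ (- b))^-1 *: (E 1 0 (E k b v) - E k b (E 1 0 v)).
Proof.
move=> hb; have /Ecomm -> : ~~ ((1 == - k) && (0 == - b)) by lia.
have -> : b * 1 - 0 * k = b by lia.
have -> : 0 * k - b * 1 = - b by lia.
by rewrite add0r [E k b _ + _]addrC addrK scalerA mulVf ?scale1r // exprz_sub_neq0.
Qed.

Lemma E_vac_pos (k : nat) b : 0 < b -> E k b v0 = 0.
Proof.
move=> hb; elim: k => [|k IH]; first exact: E0vac.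
rewrite (_ : k.+1%:Z = 1 + k%:Z) ?E_step; [|lia|lia].
by rewrite IH E1vac (linZ (El _ _)) IH scaler0 (lin0 (El _ _)) subrr scaler0.
Qed.

Lemma phi_E_neg (k : nat) b v : b < 0 -> phi (E k b v) = 0.
Proof.
move=> hb; elim: k v => [|k IH] v; first exact: phi0.
rewrite (_ : k.+1%:Z = 1 + k%:Z) ?E_step; [|lia|lia].
by rewrite (linZ phil) (linB phil) phi1 !IH mulr0 subr0 scaler0.
Qed.

(** On the vacuum, E_{1,-1} is a multiple of E_{0,-1}, and E_{k,1} vanishes.
    Hence [E_{1,-1}, E_{k,1}], which gives E_{k+1,0}, and [E_{k,1}, E_{0,-1}],
    which gives E_{k,0}, have proportional values there. *)
Lemma E_vac_eps (k : nat) : (0 < k)%N -> E k 0 v0 = eps s u k *: v0.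
Proof.
elim: k => // k IH _; case: (posnP k) => [->|hk].
  by rewrite E1vac /eps expr1z.
have hk1 : s ^ (k%:Z + 1) - s ^ (- (k%:Z + 1)) != 0 by rewrite exprz_sub_neq0 //; lia.
have C1 := @Ecomm 1 (-1) k 1 v0.
rewrite E_vac_pos // (lin0 (El _ _)) E1vac' (linZ (El _ _)) in C1.
have C2 := @Ecomm k 1 0 (-1) v0.
rewrite E_vac_pos // (lin0 (El _ _)) add0r in C2.
rewrite C2 in C1; last by lia.
have {C1} := C1 ltac:(lia).
have -> : -1 * k%:Z - 1 * 0 = - k%:Z by lia.
have -> : 1 * 0 - -1 * k%:Z = k%:Z by lia.
have -> : 1 * 1 - -1 * k%:Z = k%:Z + 1 by lia.
have -> : -1 * k%:Z - 1 * 1 = - (k%:Z + 1) by lia.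
have -> : (1 - 1 : int) = 0 by lia.
have -> : (- 1 + 1 : int) = 0 by lia.
have -> : k%:Z + 0 = k%:Z by lia.
have -> : 1 + k%:Z = k.+1%:Z by lia.
rewrite IH // !scalerA => /eqP; rewrite eq_sym addrC addr_eq0.
move=> /eqP h; apply: (scalerI hk1); rewrite h scalerA -scaleNr; congr (_ *: v0).
have n2 : 1 - s ^+ 2 != 0 by rewrite subr_eq0 eq_sym hsn.
have nk : 1 - s ^ (2 * k%:Z) != 0 by rewrite subr_eq0 eq_sym exprz_neq1 //; lia.
have nk1 : 1 - s ^ (2 * k.+1%:Z) != 0 by rewrite subr_eq0 eq_sym exprz_neq1 //; lia.
have e1 : s ^ k%:Z * s ^ (- k%:Z) = 1 by rewrite -expfzDr // subrr.
have e2 : s ^ (2 * k%:Z) = s ^ k%:Z * s ^ k%:Z by rewrite -expfzDr //; congr (s ^ _); lia.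
have e3 : s ^ (2 * k.+1%:Z) = s ^ k%:Z * s ^ k%:Z * s ^+ 2.
  by rewrite -!exprnP -exprD -exprD; congr (s ^+ _); lia.
have e4 : s ^ (k%:Z + 1) = s ^ k%:Z * s by rewrite expfzDr // expr1z.
have e5 : s ^ (- (k%:Z + 1)) = s ^ (- k%:Z) / s by rewrite opprD expfzDr // exprN1.
have e6 : u ^ k.+1%:Z = u * u ^ k%:Z by rewrite -exprnP exprS.
rewrite /eps e3 e2 e4 e5 e6 in nk nk1 *.
have x0 : s ^ k%:Z != 0 by apply: expfz_neq0.
have -> : s ^ (- k%:Z) = (s ^ k%:Z)^-1 by rewrite invr_expz.
move: (s ^ k%:Z) (u ^ k%:Z) x0 nk nk1 n2 => x y x0 nk nk1 n2.
by field; rewrite hs x0 nk nk1 n2.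
Qed.

End Vacuum.

(** * Charge, energy and vacuum values *)

Section ChargeDegree.
Implicit Types (D : state).

(** The number of particles minus the number of holes. *)
Definition charge D : int := \sum_(z <- D) (if z < 0 then -1 else 1).
Definition energy D : int := \sum_(z <- D) (absz z)%:Z.

Lemma big_tog_signed (F : int -> int) m D :
  \sum_(z <- tog m D) F z = \sum_(z <- D) F z + (if m \in D then - F m else F m).
Proof.
case: (boolP (m \in D)) => h; last by rewrite big_tog // addrC.
rewrite -{2}(togK m D) [X in _ = X + _]big_tog; first by rewrite /= addrAC subrr add0r.
by rewrite mem_tog h eqxx.
Qed.

Lemma charge_tog m D : charge (tog m D) = charge D + (if occ m D then -1 else 1).
Proof.
rewrite /charge big_tog_signed /occ; congr (_ + _).
by case: (m < 0); case: (m \in D).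
Qed.

Lemma energy_tog m D : energy (tog m D) = energy D + (if occ m D then - m else m).
Proof.
rewrite /energy big_tog_signed /occ; congr (_ + _).
by case: ltP => h; case: (m \in D) => /=; lia.
Qed.

Variable C : fieldType.
Notation hopc := (@hopc C).

Lemma hopc_occ a b D : a != b -> hopc a b D != 0 -> occ a D && ~~ occ b D.
Proof.
by rewrite /hopc => /negbTE ->; case: (_ && _); rewrite // mul0r eqxx.
Qed.

Lemma hopc_sqr a b D : a != b -> occ a D -> ~~ occ b D -> hopc a b D * hopc a b D = 1.
Proof.
rewrite /hopc => /negbTE -> -> ->; rewrite /= mul1r mulrACA !sg2 //; exact: mulr1.
Qed.

Lemma hopc_neq0 a b D : a != b -> occ a D -> ~~ occ b D -> hopc a b D != 0.
Proof.
move=> h1 h2 h3; apply/eqP => E; have := hopc_sqr h1 h2 h3.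
by rewrite E mul0r => /eqP; rewrite eq_sym oner_eq0.
Qed.

Lemma charge_hopd a b D : hopc a b D != 0 -> charge (hopd a b D) = charge D.
Proof.
rewrite /hopd; case: (eqVneq a b) => // h /(hopc_occ h) /andP[h1 h2].
rewrite !charge_tog occ_tog eq_sym (negbTE h) h1 (negbTE h2) /=; lia.
Qed.

Lemma energy_hopd a b D : hopc a b D != 0 -> energy (hopd a b D) = energy D - a + b.
Proof.
rewrite /hopd; case: (eqVneq a b) => [->|h]; first by lia.
move=> /(hopc_occ h) /andP[h1 h2].
by rewrite !energy_tog occ_tog eq_sym (negbTE h) h1 (negbTE h2) /=.
Qed.

Lemma energy0 : energy fset0 = 0. Proof. by rewrite /energy big_seq_fset0. Qed.
Lemma charge0 : charge fset0 = 0. Proof. by rewrite /charge big_seq_fset0. Qed.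

Lemma neutral_pair D : charge D = 0 -> D != fset0 ->
  exists p h, [/\ p \in D, h \in D, 0 <= p & h < 0].
Proof.
move=> hc hD.
have [/hasP[p hp p0]|/hasPn hp] := boolP (has (fun z => 0 <= z) D); last first.
  case/fset0Pn: hD => z hz; exfalso.
  suff : charge D < 0 by rewrite hc.
  rewrite /charge (big_fsetD1 z) //=.
  have -> : z < 0 by have := hp _ hz; lia.
  rewrite /= big_seq_cond.
  rewrite -[X in _ < X]addr0; apply: ltr_leD => //.
  by apply: sumr_le0 => i; rewrite andbT !inE => /andP[_ /hp]; case: ifP => //; lia.
have [/hasP[h hh h0]|/hasPn hh] := boolP (has (fun z => z < 0) D); last first.
  exfalso; suff : charge D > 0 by rewrite hc.
  rewrite /charge (big_fsetD1 p) //=.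
  have -> : (p < 0) = false by lia.
  rewrite /= big_seq_cond.
  rewrite -[X in X < _]addr0; apply: ltr_leD => //.
  by apply: sumr_ge0 => i; rewrite andbT !inE => /andP[_ /hh]; case: ifP => //; lia.
by exists p, h.
Qed.

(** A neutral state other than the vacuum has a particle and a hole, and a hop
    that fills the hole decreases its size. *)
Lemma neutral_ind (Q : state -> Prop) :
  Q fset0 ->
  (forall D a b, charge D = 0 -> a != b -> hopc a b D != 0 -> Q D -> Q (hopd a b D)) ->
  forall D, charge D = 0 -> Q D.
Proof.
move=> h0 hh D; have [n] := ubnP (#|` D|); elim: n D => // n IH D hn hc.
case: (eqVneq D fset0) => [->//|hD].
have [p [h [hp hhD p0 h0']]] := neutral_pair hc hD.
pose D' := hopd p h D.
have hph : p != h by lia.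
have e : hopc p h D != 0.
  apply: hopc_neq0 => //; rewrite /occ ?hp ?hhD.
    by rewrite (_ : (p < 0) = false) //; lia.
  by rewrite h0'.
have hD' : D = hopd h p D' by rewrite /D' hopd_sym.
rewrite hD'; apply: hh.
- by rewrite charge_hopd.
- by rewrite eq_sym.
- by rewrite /D' (hopdC p h) hopc_hopd.
apply: IH; last by rewrite charge_hopd.
have : D' = D `\ p `\ h.
  rewrite /D' /hopd (negbTE hph) {2}/tog hp /tog !inE hhD eq_sym hph //.
move=> ->; have := cardfsD1 h (D `\ p); have := cardfsD1 p D.
rewrite !inE hp hhD eq_sym hph /= => E1 E2.
by move: hn; rewrite E1 E2 !add1n ltnS => /ltnW.
Qed.

End ChargeDegree.

Section FockModule.
Variables (C : fieldType) (s u : C).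
Hypothesis hs : s != 0.
Hypothesis hsn : forall n : nat, (0 < n)%N -> s ^+ n != 1.
Variable (A : diffq_action (fock C)).
Hypothesis fm : fock_module s u A.
Implicit Types (k l r t : int) (v w : fock C) (f g : state -> C) (b : fock_basis).

Notation E := (actE A).
Notation vac := (<< one_mon >> : fock C).
Notation wedgeE := (wedgeE s u).
Notation hopc := (@hopc C).
Notation delta := (@delta C).

Lemma E_linear k l : linear (E k l).
Proof. exact: actE_linear (fock_diffq fm) k l. Qed.

Lemma E_comm k l r t v :
  E k l (E r t v) = E r t (E k l v) +
   ((s ^ (t * k - l * r) - s ^ (l * r - t * k)) *: E (k + r) (l + t) v
    + ((k == - r) && (l == - t))%:R *: (l%:~R *: v)).
Proof.
have := actE_comm (fock_diffq fm) k l r t v.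
rewrite (fock_c fm) (fock_c' fm) scaler0 add0r => h.
rewrite -[LHS](subrK (E r t (E k l v))) h [RHS]addrC; congr (_ + _ + _).
by case: ifP; rewrite ?scale1r ?scale0r.
Qed.

Lemma E_comm_ne k l r t v : ~~ ((k == - r) && (l == - t)) ->
  E k l (E r t v) = E r t (E k l v) +
   (s ^ (t * k - l * r) - s ^ (l * r - t * k)) *: E (k + r) (l + t) v.
Proof. by move=> h; rewrite E_comm (negbTE h) scale0r addr0. Qed.

(** Replacing (k, s, u) by (-k, 1/s, 1/u) preserves the relations, so that the
    analysis of E_{1,l} also applies to E_{-1,l}. *)
Lemma mirror_comm k l r t v : ~~ ((k == - r) && (l == - t)) ->
  E (- k) l (E (- r) t v) = E (- r) t (E (- k) l v) +
   (s^-1 ^ (t * k - l * r) - s^-1 ^ (l * r - t * k)) *: E (- (k + r)) (l + t) v.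
Proof.
move=> h; rewrite E_comm_ne; last by lia.
have -> : t * - k - l * - r = - (t * k - l * r) by lia.
have -> : l * - r - t * - k = - (l * r - t * k) by lia.
have -> : - k - r = - (k + r) by lia.
by rewrite !exprz_inv.
Qed.

Lemma sV_neq n : (0 < n)%N -> s^-1 ^+ n != 1.
Proof. by move=> h; rewrite exprVn invr_eq1 hsn. Qed.

Lemma H_pos (b : int) : 0 < b -> E 0 b vac = 0.
Proof.
case: b => [[|j]|j] // _; rewrite (fock_H fm) /= lextU onecmE muln0 scale0r //.
Qed.

Lemma H_neg (b : int) v : b < 0 -> (E 0 b v)@_one_mon = 0.
Proof. by move=> h; rewrite (fock_H fm) heis_raise_vac. Qed.

Lemma fockE_vac_pos k (b : int) : 0 < b -> E k b vac = 0.
Proof.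
move=> hb; case: k => n.
  apply: (E_vac_pos hs hsn E_linear E_comm_ne (u := u)) => //; first exact: H_pos.
  by rewrite (fock_E fm) oppr0 vertex_vac0.
rewrite NegzE.
apply: (@E_vac_pos _ _ u^-1 _ (fun k l => E (- k) l) vac _ sV_neq _ mirror_comm) => //.
- by rewrite invr_eq0.
- by move=> *; apply: E_linear.
- by move=> *; rewrite oppr0; apply: H_pos.
by rewrite (fock_F fm) oppr0 vertex_vac0 exprVn.
Qed.

Lemma fockE_at_vac_neg k (b : int) v : b < 0 -> (E k b v)@_one_mon = 0.
Proof.
move=> hb; case: k => n.
  apply: (@phi_E_neg _ s u _ E (fun v => v@_one_mon) hs hsn (mcoeff_linear one_mon) E_comm_ne) => //.
    by move=> *; apply: H_neg.
  by move=> w; rewrite (fock_E fm) oppr0 mcoeffZ vertex_at_vac.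
rewrite NegzE.
apply: (@phi_E_neg _ s^-1 u^-1 _ (fun k l => E (- k) l) (fun v => v@_one_mon) _ sV_neq (mcoeff_linear one_mon) mirror_comm) => //.
- by rewrite invr_eq0.
- by move=> *; rewrite oppr0; apply: H_neg.
by move=> w; rewrite (fock_F fm) oppr0 mcoeffZ vertex_at_vac exprVn.
Qed.

Lemma fockE_vac_eps k : E k 0 vac = eps s u k *: vac.
Proof.
case: k => [[|n]|n].
- rewrite (actE00 (fock_diffq fm)) /eps mulr0 !expr0z subrr invr0 mulr0 scale0r //.
- apply: (E_vac_eps hs hsn E_linear E_comm_ne) => //.
  + exact: H_pos.
  + by rewrite (fock_E fm) oppr0 vertex_vac0.
  + rewrite (fock_E fm) opprK vertex_vac1 scalerA (fock_H fm).
    by rewrite -exprnN expr1z divr1 expr1.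
rewrite NegzE.
have -> : eps s u (- n.+1%:Z) = eps s^-1 u^-1 n.+1%:Z.
  by rewrite /eps !exprz_inv mulrN.
apply: (@E_vac_eps _ s^-1 u^-1 _ (fun k l => E (- k) l) vac _ sV_neq _ mirror_comm) => //.
- by rewrite invr_eq0.
- by move=> *; apply: E_linear.
- by move=> *; rewrite oppr0; apply: H_pos.
- by rewrite (fock_F fm) oppr0 vertex_vac0 exprVn.
rewrite (fock_F fm) opprK vertex_vac1 scalerA oppr0 (fock_H fm).
by rewrite invrK -exprnN expr1z divr1 expr1 exprVn.
Qed.

End FockModule.

(** * The Schur basis of the Fock module *)

Section Monomials.
Implicit Types b : fock_basis.

Lemma fock_degE b (D : {fset nat}) : finsupp b `<=` D ->
  fock_deg b = (\sum_(j <- D) j.+1 * b j)%N.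
Proof.
move=> h; rewrite /fock_deg; apply: (big_fset_incl _ h) => j _.
by rewrite mem_finsupp negbK => /eqP ->; rewrite muln0.
Qed.

Lemma fock_deg_mul b j : fock_deg (mulcm b (ucm j)) = (fock_deg b + j.+1)%N.
Proof.
pose D := finsupp b `|` (finsupp (mulcm b (ucm j)) `|` [fset j]).
rewrite (@fock_degE b D) ?fsubsetUl // (@fock_degE _ D); last first.
  by apply/fsubsetP => x hx; rewrite !inE hx orbT.
under eq_bigr => i _ do rewrite mulcmE ucmE mulnDr.
rewrite big_split /=; congr (_ + _)%N.
rewrite (big_fsetD1 j) /=; last by rewrite !inE eqxx !orbT.
rewrite eqxx muln1 big_seq_cond big1 ?addn0 // => i; rewrite !inE eq_sym.
by case: eqVneq => //=; rewrite muln0.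
Qed.

Lemma monomial_ind (Q : fock_basis -> Prop) :
  Q one_mon -> (forall b j, Q b -> Q (mulcm b (ucm j))) -> forall b, Q b.
Proof.
move=> h1 hm b; have [n] := ubnP (fock_deg b); elim: n b => // n IH b hb.
case: (fset_0Vmem (finsupp b)) => [h0|[j hj]].
  suff -> : b = one_mon by [].
  apply/eqP/cmP => i; rewrite onecmE; apply/eqP.
  by rewrite -[_ == _]negbK -mem_finsupp h0.
have hb' : b = mulcm (divcm b (ucm j)) (ucm j).
  apply/eqP/cmP => i; rewrite mulcmE divcmE ucmE; case: eqVneq => [<-|_].
    by rewrite subnK // lt0n -mem_finsupp.
  by rewrite subn0 addn0.
rewrite hb'; apply: hm; apply: IH.
by move: hb; rewrite {1}hb' fock_deg_mul; lia.
Qed.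

End Monomials.

Section Matching.
Variables (C : fieldType) (s u : C).
Hypotheses (hs : s != 0) (hu : u != 0).
Hypothesis hsn : forall n : nat, (0 < n)%N -> s ^+ n != 1.
Hypothesis hchar : forall n : nat, n.+1%:R != 0 :> C.
Variable (A : diffq_action (fock C)).
Hypothesis fm : fock_module s u A.
Implicit Types (k l r t : int) (v w : fock C) (f g : state -> C) (b : fock_basis).

Notation E := (actE A).
Notation vac := (<< one_mon >> : fock C).
Notation wedgeE := (wedgeE s u).
Notation hopc := (@hopc C).
Notation delta := (@delta C).

(** The boson-fermion correspondence as a relation: a vector of the Fock
    module matches a function of states when both arise from their vacua by
    the same linear combinations and the same operators E_{k,l} with l < 0.
    This saves the construction of a map, and the proofs that the relation is
    functional, total and equivariant are inductions. *)
Inductive matched : fock C -> (state -> C) -> Prop :=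
| matched_vac : matched vac (delta fset0)
| matched_lin a v f w g : matched v f -> matched w g ->
    matched (a *: v + w) (fun D => a * f D + g D)
| matched_neg k l v f : l < 0 -> matched v f -> matched (E k l v) (wedgeE k l f).

Lemma matched0 : matched 0 (fun=> 0).
Proof.
have := matched_lin (-1) matched_vac matched_vac; rewrite scaleN1r addNr.
by congr matched; apply/funext => D; rewrite mulN1r addNr.
Qed.

Lemma matchedZ a v f : matched v f -> matched (a *: v) (fun D => a * f D).
Proof.
move=> h; have := matched_lin a h matched0; rewrite addr0.
by congr matched; apply/funext => D; rewrite addr0.
Qed.

Lemma matched_sum (T : Type) (r : seq T) (a : T -> C) (F : T -> fock C)
    (G : T -> state -> C) :
  (forall i, a i = 0 \/ matched (F i) (G i)) ->
  matched (\sum_(i <- r) a i *: F i) (fun D => \sum_(i <- r) a i * G i D).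
Proof.
move=> h; elim: r => [|i r IH].
  rewrite big_nil (_ : (fun D => _) = (fun=> 0)); first exact: matched0.
  by apply/funext => D; rewrite big_nil.
rewrite big_cons; case: (h i) => [ha|hm].
  rewrite ha scale0r add0r; move: IH; congr matched; apply/funext => D.
  by rewrite big_cons ha mul0r add0r.
move: (matched_lin (a i) hm IH); congr matched; apply/funext => D.
by rewrite big_cons.
Qed.

Lemma hop_sum_lin k l a f g D :
  hop_sum s u k l (fun D => a * f D + g D) D = a * hop_sum s u k l f D + hop_sum s u k l g D.
Proof.
rewrite /hop_sum mulr_sumr -big_split; apply: eq_bigr => m _ /=.
by rewrite !nhopE; ring.
Qed.

Lemma wedgeE_lin k l a f g D :
  wedgeE k l (fun D => a * f D + g D) D = a * wedgeE k l f D + wedgeE k l g D.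
Proof.
rewrite /wedgeE; case: ifP => _; first by rewrite mulr0 addr0.
by rewrite hop_sum_lin; ring.
Qed.

Lemma wedgeE_zero k l D : wedgeE k l (fun=> 0) D = 0.
Proof.
rewrite /wedgeE /hop_sum big1 ?mulr0 ?addr0 ?if_same // => m _.
by rewrite nhopE !mulr0.
Qed.

(** The operators with l >= 0 are moved to the vacuum by the commutation
    relations, which are the same on both sides; there [wedgeE_vac] and its
    bosonic counterpart agree. *)
Lemma matched_E k l v f : matched v f -> matched (E k l v) (wedgeE k l f).
Proof.
move=> h; elim: h k l => {v f}.
- move=> k l; case: (ltrP l 0) => hl; first by apply: matched_neg => //; exact: matched_vac.
  have -> : wedgeE k l (delta fset0) = (fun D => (l == 0)%:R * eps s u k * delta fset0 D).
    by apply/funext => D; rewrite wedgeE_vac.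
  suff -> : E k l vac = ((l == 0)%:R * eps s u k) *: vac by exact/matchedZ/matched_vac.
  case: (eqVneq l 0) => [->|h]; first by rewrite mul1r (fockE_vac_eps hs hsn fm).
  by rewrite mul0r scale0r (fockE_vac_pos hs hsn fm) //; lia.
- move=> a v f w g _ IHv _ IHw k l.
  have := matched_lin a (IHv k l) (IHw k l); rewrite (E_linear fm k l a v w).
  by congr matched; apply/funext => D; rewrite wedgeE_lin.
move=> r t v f ht hv IH k l.
rewrite (E_comm fm).
have -> : wedgeE k l (wedgeE r t f) = (fun D => 1 * wedgeE r t (wedgeE k l f) D +
   ((s ^ (t * k - l * r) - s ^ (l * r - t * k)) * wedgeE (k + r) (l + t) f D
     + (((k == - r) && (l == - t))%:R * (l%:~R * f D)))).
  apply/funext => D; rewrite mul1r mulrA -wedgeE_comm //; ring.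
rewrite -[E r t (E k l v)]scale1r.
apply: (matched_lin 1); first exact/matched_neg/IH.
by apply: matched_lin; [exact: IH | exact/matchedZ/matchedZ].
Qed.

(** Both functionals vanish on the image of every E_{k,l} with l < 0. *)
Lemma matched_at_vac v f : matched v f -> v@_one_mon = f fset0.
Proof.
elim=> {v f}; first by rewrite mcoeffUU /delta eqxx.
  by move=> a v f w g _ IHv _ IHw; rewrite mcoeffD mcoeffZ IHv IHw.
move=> k l v f hl _ _; rewrite (fockE_at_vac_neg hs hsn fm) // wedgeE_at_vac; last by lia.
by rewrite (_ : (l == 0) = false) ?mul0r //; lia.
Qed.

(** The coefficient at a monomial is, up to a nonzero integer, the vacuum
    coefficient after applying annihilation operators, and these preserve the
    relation. *)
Lemma matched_inj v : matched v (fun=> 0) -> v = 0.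
Proof.
move=> hv; apply/malgP => b; rewrite mcoeff0.
elim/monomial_ind: b v hv => [|b j IH] v hv; first exact: matched_at_vac hv.
have hE : matched (E 0 j.+1%:Z v) (fun=> 0).
  have := matched_E 0 j.+1%:Z hv; congr matched; apply/funext => D.
  by rewrite wedgeE_zero.
have := IH _ hE; rewrite (fock_H fm) heis_lower => /eqP.
rewrite mulf_eq0 mulnS addSn (negbTE (hchar _)) /= => /eqP //.
Qed.

Lemma matched_uniq v w f : matched v f -> matched w f -> v = w.
Proof.
move=> hv hw; apply/eqP; rewrite -subr_eq0; apply/eqP/matched_inj.
have := matched_lin (-1) hw hv; rewrite scaleN1r addrC.
by congr matched; apply/funext => D; rewrite mulN1r addNr.
Qed.

Lemma matched_exists v : exists f, matched v f.
Proof.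
have H b : exists f, matched << b >> f.
  elim/monomial_ind: b => [|b j [f hf]]; first by exists (delta fset0); exact: matched_vac.
  exists (wedgeE 0 (Negz j) f); have := matched_E 0 (Negz j) hf.
  by rewrite (fock_H fm) heis_raise.
case: (choice H) => F hF.
exists (fun D => \sum_(b <- msupp v) v@_b * F b D).
by rewrite {1}[v]malg_sumE; apply: matched_sum => b; right.
Qed.

(** From the vacuum, every neutral state is reached by hops, which
    [closed_hop] expresses through the operators E_{k,l}. *)
Lemma matched_delta D : charge D = 0 -> exists v, matched v (delta D).
Proof.
apply: (@neutral_ind C (fun D => exists v, matched v (delta D))); first by exists vac; exact: matched_vac.
move=> {}D a b _ hab hc hD.
have [v hv] : exists v, matched v (fun D' => hopc a b D * delta (hopd a b D) D').
  apply: (@closed_hop _ s u hs hu hsn (fun f => exists v, matched v f)) => //.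
  - by exists 0; exact: matched0.
  - by move=> c f g [v hv] [w hw]; exists (c *: v + w); exact: matched_lin.
  by move=> k l f [v hv]; exists (E k l v); exact: matched_E.
exists ((hopc a b D)^-1 *: v); have := matchedZ (hopc a b D)^-1 hv.
by congr matched; apply/funext => D'; rewrite mulKf.
Qed.

(** If zero matched some neutral state, the reverse hops would make it match
    the vacuum. *)
Lemma matched_delta_neq0 D v : charge D = 0 -> matched v (delta D) -> v != 0.
Proof.
move=> hD hv; apply/eqP => v0; rewrite {}v0 in hv; move: D hD hv.
apply: (@neutral_ind C (fun D => matched 0 (delta D) -> False)).
  by move/matched_at_vac; rewrite mcoeff0 /delta eqxx => /eqP; rewrite eq_sym oner_eq0.
move=> D a b hD hab hc IH hm; apply: IH.
have hc' : hopc b a (hopd a b D) != 0 by rewrite hopdC hopc_hopd.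
have := @closed_hop _ s u hs hu hsn (matched 0) matched0 _ _ (hopd a b D) b a _ hm.
rewrite hopd_sym => H; have {}H : matched 0 (fun D' => hopc b a (hopd a b D) * delta D D').
  apply: H => //; last by rewrite eq_sym.
  - by move=> c f g hf hg; have := matched_lin c hf hg; rewrite scaler0 addr0.
  by move=> k l f hf; have := matched_E k l hf; rewrite (lin0 (E_linear fm k l)).
have := matchedZ (hopc b a (hopd a b D))^-1 H; rewrite scaler0.
by congr matched; apply/funext => D'; rewrite mulKf.
Qed.

End Matching.

Section Schur.
Variables (C : fieldType) (s u : C).
Hypotheses (hs : s != 0) (hu : u != 0).
Hypothesis hsn : forall n : nat, (0 < n)%N -> s ^+ n != 1.
Hypothesis hchar : forall n : nat, n.+1%:R != 0 :> C.
Variable (A : diffq_action (fock C)).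
Hypothesis fm : fock_module s u A.
Implicit Types (k l r t : int) (v w : fock C) (f g : state -> C) (b : fock_basis).
Notation E := (actE A).
Notation vac := (<< one_mon >> : fock C).
Notation hopc := (@hopc C).
Notation delta := (@delta C).
Notation matched := (matched s u A).

Variable S : state -> fock C.
Hypothesis HS : forall D, charge D = 0 -> matched (S D) (delta D).

Lemma S_vac : S fset0 = vac.
Proof. apply: (matched_uniq hs hu hsn hchar fm (HS charge0)); exact: matched_vac. Qed.

Lemma S_at_vac D : charge D = 0 -> (S D)@_one_mon = (D == fset0)%:R.
Proof. by move=> h; rewrite (matched_at_vac hs hu hsn fm (HS h)) /delta eq_sym. Qed.

Lemma S_neq0 D : charge D = 0 -> S D != 0.
Proof. by move=> h; apply: (matched_delta_neq0 hs hu hsn fm h (HS h)). Qed.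

(** The formula for the action of Diff_q in the Schur basis, on which
    everything below rests. *)
Lemma E_S k l D n : charge D = 0 -> (bound D + absz l <= n)%N -> k != 0 \/ l != 0 ->
  E k l (S D) = \sum_(m <- win n) (rho s u l m ^ k * hopc m (m - l) D) *: S (hopd m (m - l) D)
     + ((l == 0)%:R * eps s u k) *: S D.
Proof.
move=> hD hn hkl; apply: (matched_uniq hs hu hsn hchar fm (matched_E hs hu hsn fm k l (HS hD))).
pose c m := rho s u l m ^ k * hopc m (m - l) D.
have H m : c m = 0 \/ matched (S (hopd m (m - l) D)) (delta (hopd m (m - l) D)).
  rewrite /c; case: (eqVneq (hopc m (m - l) D) 0) => [->|h]; first by left; rewrite mulr0.
  by right; apply: HS; rewrite (@charge_hopd C).
have := matched_lin ((l == 0)%:R * eps s u k) (HS hD) (matched_sum (win n) H).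
rewrite addrC; congr matched; apply/funext => D'.
rewrite (wedgeE_delta _ _ hn hkl) addrC; congr (_ + _).
by apply: eq_bigr => m _; rewrite mulrA.
Qed.

(** By induction on the monomial, since the annihilation operators are sums of
    hops of known energy. *)
Lemma S_homogeneous D b : charge D = 0 -> (S D)@_b != 0 -> (fock_deg b)%:Z = energy D.
Proof.
move: b D; apply: (@monomial_ind (fun b => forall D, charge D = 0 -> (S D)@_b != 0 ->
  (fock_deg b)%:Z = energy D)) => [|b j IH] D hD.
  rewrite S_at_vac //; case: (eqVneq D fset0) => [-> _|_]; last by rewrite eqxx.
  by rewrite energy0 (@fock_degE _ fset0) ?big_seq_fset0 //; apply/fsubsetP => i; rewrite mem_finsupp onecmE.
move=> hb.
have : (E 0 j.+1%:Z (S D))@_b != 0.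
  by rewrite (fock_H fm) heis_lower mulf_neq0 // mulnS addSn.
rewrite (E_S hD (leqnn _)); last by right.
rewrite mcoeffD mcoeffZ mul0r mul0r addr0 mcoeff_sum => h.
have [m hm] : exists m, hopc m (m - j.+1%:Z) D * (S (hopd m (m - j.+1%:Z) D))@_b != 0.
  apply: contrapT => hn; case/eqP: h; apply: big1 => m _.
  rewrite mcoeffZ expr0z mul1r; apply/eqP; apply: contrapT => h; apply: hn; exists m.
  exact/negP.
move: hm; rewrite mulf_eq0 negb_or => /andP[h1 h2].
have := IH _ _ h2; rewrite (@charge_hopd C) // => /(_ hD).
rewrite (@energy_hopd C) // fock_deg_mul; lia.
Qed.

End Schur.

(** * Pure tensors, and vectors annihilated by words *)

Lemma mcoeff_comb (C : fieldType) (K : choiceType) (X Y Z : {malg C[K]}) (a c d : C) b :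
  (X + (a *: Y + c *: (d *: Z)))@_b = X@_b + (a * Y@_b + c * (d * Z@_b)).
Proof. by rewrite mcoeffD mcoeffD mcoeffZ mcoeffZ mcoeffZ. Qed.

Lemma mcoeff_lin0 (C : fieldType) (V : lmodType C) (K : choiceType) (X : V -> {malg C[K]}) b :
  linear X -> (X 0)@_b = 0.
Proof. by move=> hX; rewrite (lin0 hX) mcoeff0. Qed.

Lemma mcoeff_ne (C : fieldType) (K : choiceType) (b b' : K) :
  b != b' -> (<< b >> : {malg C[K]})@_b' = 0.
Proof. by move=> h; rewrite mcoeffU (negbTE h). Qed.

Section PureTensors.
Variables (C : fieldType) (N : nat).
Implicit Types (f g : 'I_N -> fock C) (t : tensor_basis N) (i j : 'I_N) (X Y : fock C -> fock C).

Definition tens_supp f : {fset tensor_basis N} :=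
  let U : {fset fock_basis} := \bigcup_(i <- enum 'I_N) msupp (f i) in
  seq_fset tt (map (fun h : {ffun 'I_N -> U} => [ffun i => fsval (h i)] : tensor_basis N)
    (enum {: {ffun 'I_N -> U}})).

Lemma tens_exists f :
  {v : tensor_fock C N | forall t, v@_t = \prod_i (f i)@_(t i)}.
Proof.
exists [malg t in tens_supp f => \prod_i (f i)@_(t i)] => t.
rewrite mcoeffE; case: ifP => // /negbT ht; apply/esym/eqP.
rewrite prodf_seq_eq0; apply: contraNT ht => /hasPn h.
have hU i : t i \in \bigcup_(i <- enum 'I_N) msupp (f i).
  apply/bigfcupP; exists i; first by rewrite mem_enum.
  by rewrite -mcoeff_neq0; have := h i (mem_index_enum i).
rewrite seq_fsetE; apply/mapP; exists [ffun i => [` hU i]]; first by rewrite mem_enum.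
by apply/ffunP => i; rewrite !ffunE.
Qed.

(** The coefficients determine the pure tensor; its support is finite, because
    it lies in a product of supports. *)
Definition tens f : tensor_fock C N := sval (tens_exists f).

Lemma mcoeff_tens f t : (tens f)@_t = \prod_i (f i)@_(t i).
Proof. exact: (svalP (tens_exists f)). Qed.

Definition updf f i v : 'I_N -> fock C := fun j => if j == i then v else f j.
Definition updt t i b : tensor_basis N := [ffun j => if j == i then b else t j].

Lemma mcoeff_tens_updf f i v t :
  (tens (updf f i v))@_t = v@_(t i) * \prod_(j | j != i) (f j)@_(t j).
Proof.
rewrite mcoeff_tens (bigD1 i) //= /updf eqxx; congr (_ * _).
by apply: eq_bigr => j /negbTE ->.
Qed.

Lemma tens_basis t : tens (fun i => << t i >>) = << t >>.
Proof.
apply/malgP => t'; rewrite mcoeff_tens [RHS]mcoeffU; case: eqVneq => [->|h].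
  by rewrite big1 // => i _; rewrite mcoeffUU.
have [i hi] : exists i, t i != t' i.
  apply/existsP; apply: contraNT h => /existsPn h; apply/eqP/ffunP => i.
  by have := h i; rewrite negbK => /eqP.
by rewrite (bigD1 i) //= (mcoeff_ne _ hi) mul0r.
Qed.

Lemma tens_ext f g : f =1 g -> tens f = tens g.
Proof. by move=> h; congr tens; apply/funext. Qed.

Lemma updf_id f i : updf f i (f i) =1 f.
Proof. by move=> j; rewrite /updf; case: eqVneq => [->|]. Qed.

Lemma updf_eq f i v : updf f i v i = v.
Proof. by rewrite /updf eqxx. Qed.

Lemma updf_ne f i j v : i != j -> updf f j v i = f i.
Proof. by rewrite /updf => /negbTE ->. Qed.

Lemma updfC f i j v w : i != j ->
  updf (updf f i v) j w =1 updf (updf f j w) i v.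
Proof. by move=> h k; rewrite /updf; case: (eqVneq k j) => [->|] //; rewrite eq_sym (negbTE h). Qed.

Lemma updf_updf f i v w : updf (updf f i v) i w =1 updf f i w.
Proof. by move=> k; rewrite /updf; case: eqVneq. Qed.

Lemma tens_linear f i : linear (fun v => tens (updf f i v)).
Proof.
move=> a v w; apply/malgP => t.
by rewrite mcoeffD mcoeffZ !mcoeff_tens_updf mcoeffD mcoeffZ mulrDl mulrA.
Qed.

Lemma tens_updZ f i a v : tens (updf f i (a *: v)) = a *: tens (updf f i v).
Proof. exact: (linZ (tens_linear f i) a v). Qed.

Lemma tens_upd_comb f i (X Y Z : fock C) (a c d : C) :
  tens (updf f i (X + (a *: Y + c *: (d *: Z)))) =
  tens (updf f i X) + (a *: tens (updf f i Y) + c *: (d *: tens (updf f i Z))).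
Proof.
apply/malgP => t.
by rewrite mcoeff_comb !mcoeff_tens_updf mcoeff_comb; ring.
Qed.

Lemma tens_upd_sum f i (T : Type) (r : seq T) (G : T -> fock C) :
  tens (updf f i (\sum_(x <- r) G x)) = \sum_(x <- r) tens (updf f i (G x)).
Proof. exact: (lin_sum (tens_linear f i)). Qed.

Lemma mcoeff_tensor_at i X v t : (tensor_at i X v)@_t =
  \sum_(t' <- msupp v) v@_t' * ((updt t' i (t i) == t)%:R * (X << t' i >>)@_(t i)).
Proof.
rewrite /tensor_at mcoeff_lext; apply: eq_bigr => t' _; congr (_ * _).
rewrite mcoeff_lext.
have E b : (X << t' i >>)@_b * (<< updt t' i b >> : tensor_fock C N)@_t =
   (b == t i)%:R * ((updt t' i (t i) == t)%:R * (X << t' i >>)@_(t i)).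
  rewrite mcoeffU; case: (eqVneq b (t i)) => [->|h]; first by rewrite mul1r mulrC.
  rewrite mul0r; case: eqP => [E|_]; last by rewrite mulr0.
  by case/eqP: h; rewrite -E ffunE eqxx.
under eq_bigr => b _ do rewrite E.
rewrite sum_delta ?fset_uniq //; case: (boolP (_ \in _)) => [_|h]; first by rewrite mul1r.
by rewrite mul0r mcoeff_outdom // mulr0.
Qed.

Lemma tensor_at_linear i X : linear (tensor_at i X : tensor_fock C N -> tensor_fock C N).
Proof. exact: lext_linear. Qed.

(** An operator in position i acts on the i-th factor only; the sum over the
    tensor basis that defines it collapses to the line of basis tensors that
    differ from the given one in position i. *)
Lemma tensor_at_tens i X f : linear X ->
  tensor_at i X (tens f) = tens (updf f i (X (f i))).
Proof.
move=> hX; apply/malgP => t; rewrite mcoeff_tensor_at mcoeff_tens_updf.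
pose G t' := (tens f)@_t' * ((updt t' i (t i) == t)%:R * (X << t' i >>)@_(t i)).
transitivity (\sum_(t' <- [seq updt t i b | b <- msupp (f i)]) G t').
  apply: eq_big_supp; rewrite ?fset_uniq //.
  - rewrite map_inj_uniq ?fset_uniq // => b b' /ffunP/(_ i).
    by rewrite !ffunE eqxx.
  - move=> t' _ ht; rewrite /G; case: eqP => [E|_]; last by rewrite mul0r mulr0.
    have Et : t' = updt t i (t' i).
      apply/ffunP => j; rewrite ffunE; case: eqVneq => [->//|hj].
      by rewrite -E ffunE (negbTE hj).
    rewrite mcoeff_tens (bigD1 i) //= mcoeff_outdom ?mul0r //.
    by apply: contra ht => h; rewrite Et map_f.
  by move=> t' _ ht; rewrite /G mcoeff_outdom ?mul0r.
rewrite big_map {2}[f i]malg_sumE (lin_sum hX) mcoeff_sum mulr_suml.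
apply: eq_bigr => b _; rewrite (linZ hX) mcoeffZ /G.
have -> : updt (updt t i b) i (t i) = t.
  by apply/ffunP => j; rewrite !ffunE; case: eqVneq => [->|].
rewrite eqxx mul1r ffunE eqxx mcoeff_tens (bigD1 i) //= ffunE eqxx mulrAC; congr (_ * _ * _).
by apply: eq_bigr => j /negbTE hj; rewrite ffunE hj.
Qed.

End PureTensors.

#[local] Arguments actE : simpl never.

Section TensorModule.
Variables (C : fieldType) (s : C) (N : nat) (u : 'I_N -> C).
Hypotheses (hs : s != 0) (hu : forall i, u i != 0).
Hypothesis hsn : forall n : nat, (0 < n)%N -> s ^+ n != 1.
Variable (F : 'I_N -> diffq_action (fock C)).
Hypothesis hF : forall i, fock_module s (u i) (F i).
Implicit Types (k l r : int) (v w : tensor_fock C N) (i j : 'I_N) (t : tensor_basis N).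

Notation E := (actE (tensor_action F)).
Notation vacN := ([ffun => one_mon] : tensor_basis N).

Lemma Ei_linear i k l : linear (actE (F i) k l).
Proof. exact: (E_linear (hF i)). Qed.

Lemma tE_linear k l : linear (E k l).
Proof.
apply: (@islin_sum _ _ _ _ _ (fun i => tensor_at i (actE (F i) k l))) => i.
exact: tensor_at_linear.
Qed.

Lemma tE_tens k l f : E k l (tens f) = \sum_i tens (updf f i (actE (F i) k l (f i))).
Proof. by apply: eq_bigr => i _; rewrite tensor_at_tens //; exact: Ei_linear. Qed.

Lemma tE_tE_tens k l r (q : int) f : E k l (E r q (tens f)) = \sum_j \sum_i
  tens (updf (updf f j (actE (F j) r q (f j))) i
     (actE (F i) k l (updf f j (actE (F j) r q (f j)) i))).
Proof.
rewrite (tE_tens r q) (lin_sum (tE_linear k l)); apply: eq_bigr => j _.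
exact: tE_tens.
Qed.

(** Operators in distinct positions commute, hence the coproduct is again a
    module, of central charge N. *)
Lemma tE_comm k l r (q : int) v :
  E k l (E r q v) = E r q (E k l v) +
   ((s ^ (q * k - l * r) - s ^ (l * r - q * k)) *: E (k + r) (l + q) v
    + ((k == - r) && (l == - q))%:R *: ((l%:~R * N%:R) *: v)).
Proof.
set c1 := s ^ _ - _; set c2 := _%:R.
pose L v := E k l (E r q v).
pose R v := E r q (E k l v) + (c1 *: E (k + r) (l + q) v + c2 *: ((l%:~R * N%:R) *: v)).
apply: (@lin_ext _ _ _ L R).
- exact: islin_comp (tE_linear _ _) (tE_linear _ _).
- apply: islin_add; first exact: islin_comp (tE_linear _ _) (tE_linear _ _).
  apply: islin_add; apply: islin_scale; first exact: tE_linear.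
  exact/islin_scale/islin_id.
move=> t; rewrite /L /R -tens_basis; move: (fun i => << t i >> : fock C) => f.
rewrite (tE_tE_tens k l r q) (tE_tE_tens r q k l) (tE_tens (k + r)) exchange_big /=.
have -> : c1 *: (\sum_i tens (updf f i (actE (F i) (k + r) (l + q) (f i)))) +
    c2 *: (l%:~R * N%:R *: tens f) =
   \sum_i (c1 *: tens (updf f i (actE (F i) (k + r) (l + q) (f i))) + c2 *: (l%:~R *: tens f)).
  rewrite big_split -scaler_sumr /= sumr_const card_ord; congr (_ + _).
  by rewrite -scaler_nat !scalerA; congr (_ *: _); ring.
rewrite -big_split; apply: eq_bigr => i _ /=.
rewrite (bigD1 i) //= [in RHS](bigD1 i) //= addrAC; congr (_ + _); last first.
  apply: eq_bigr => j hj; rewrite !updf_ne // 1?eq_sym //.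
  by apply: tens_ext; apply: updfC.
rewrite !(tens_ext (updf_updf _ _ _ _)) !updf_eq.
rewrite (E_comm (hF i)) -/c1 -/c2.
rewrite -(tens_ext (updf_id f i)); exact: tens_upd_comb.
Qed.

(** The partial evaluation of a tensor by the dual vacuum in all positions but
    the i-th. *)
Definition vac_slice i v : fock C :=
  lext (fun t : tensor_basis N =>
    if [forall j, (j != i) ==> (t j == one_mon)] then << t i >> else 0) v.

Lemma vac_slice_linear i : linear (vac_slice i).
Proof. exact: lext_linear. Qed.

Lemma tens_at_vac (f : 'I_N -> fock C) i (w : fock C) : (tens (updf f i w))@_vacN =
   w@_one_mon * \prod_(j | j != i) (f j)@_one_mon.
Proof.
rewrite mcoeff_tens_updf ffunE; congr (_ * _).
by apply: eq_bigr => j _; rewrite ffunE.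
Qed.

Lemma vac_slice_basis (X : fock C -> fock C) i t : linear X ->
  (X (vac_slice i << t >>))@_one_mon = (tens (updf (fun i => << t i >>) i (X << t i >>)))@_vacN.
Proof.
move=> hX; rewrite tens_at_vac /vac_slice lextU; case: ifP => [/forallP h|/negbT].
  rewrite big1 ?mulr1 // => j hj; rewrite mcoeffU.
  by have := h j; rewrite hj /= => ->.
rewrite negb_forall => /existsP[j]; rewrite negb_imply => /andP[hj hj'].
have P0 : \prod_(m | m != i) (<< t m >> : fock C)@_one_mon = 0.
  apply/eqP/prodf_eq0; exists j; first exact: hj.
  exact/eqP/(mcoeff_ne C hj').
by apply: etrans (mcoeff_lin0 _ hX) _; rewrite P0 mulr0.
Qed.

Lemma E_at_vac k l v : (E k l v)@_vacN = \sum_i (actE (F i) k l (vac_slice i v))@_one_mon.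
Proof.
apply: (@lin_ext _ _ C^o (fun v => (E k l v)@_vacN)
  (fun v => \sum_i (actE (F i) k l (vac_slice i v))@_one_mon)).
- by move=> a x y; rewrite tE_linear mcoeffD mcoeffZ.
- move=> a x y; rewrite scaler_sumr -big_split; apply: eq_bigr => i _ /=.
  by rewrite vac_slice_linear Ei_linear mcoeffD mcoeffZ.
move=> t; rewrite -{1}tens_basis tE_tens mcoeff_sum; apply: eq_bigr => i _.
by rewrite vac_slice_basis //; exact: Ei_linear.
Qed.

Lemma vac_slice_at_vac i v : (vac_slice i v)@_one_mon = v@_vacN.
Proof.
apply: (@lin_ext _ _ C^o (fun v => (vac_slice i v)@_one_mon) (fun v => v@_vacN)).
- by move=> a x y; rewrite vac_slice_linear mcoeffD mcoeffZ.
- by move=> a x y; rewrite mcoeffD mcoeffZ.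
move=> t; rewrite (@vac_slice_basis id) //.
by rewrite (tens_ext (updf_id (fun i => << t i >>) i)) tens_basis.
Qed.

Lemma Ei_at_vac0 i k m : (actE (F i) k 0 m)@_one_mon = eps s (u i) k * m@_one_mon.
Proof.
have [f hf] := matched_exists hs (hu i) hsn (hF i) m.
have := matched_E hs (hu i) hsn (hF i) k 0 hf.
move=> /(matched_at_vac hs (hu i) hsn (hF i)) ->.
by rewrite (matched_at_vac hs (hu i) hsn (hF i) hf) wedgeE_at_vac // eqxx mul1r.
Qed.

(** The dual vacuum is an eigenfunctional of the operators with l <= 0. *)
Lemma E_at_vac_le0 k l v : l <= 0 -> v@_vacN = 0 -> (E k l v)@_vacN = 0.
Proof.
move=> hl hv; rewrite E_at_vac big1 // => i _.
case: (eqVneq l 0) => [->|h]; first by rewrite Ei_at_vac0 vac_slice_at_vac hv mulr0.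
by apply: (fockE_at_vac_neg hs hsn (hF i)); lia.
Qed.

(** For l = n > 0 the functional v |-> <0|E_{k,n} v depends on k through N n
    nodes only. *)
Lemma E_at_vac_gt0 (n : nat) v : (0 < n)%N ->
  exists L : 'I_N * nat -> C, forall k,
   (E k n v)@_vacN = \sum_(p <- [seq (i, m) | i <- enum 'I_N, m <- iota 0 n])
      rho s (u p.1) n p.2 ^ k * L p.
Proof.
move=> hn.
have hf i : exists f, matched s (u i) (F i) (vac_slice i v) f by exact: (matched_exists hs (hu i) hsn (hF i) (vac_slice i v)).
have [f {}hf] := choice hf.
exists (fun p => nhop (p.2%:Z - n%:Z) p.2 (f p.1) fset0) => k.
rewrite E_at_vac big_allpairs big_enum; apply: eq_bigr => i _ /=.
rewrite (matched_at_vac hs (hu i) hsn (hF i) (matched_E hs (hu i) hsn (hF i) k n (hf i))).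
by rewrite wedgeE_at_vac_pos // -[n in iota 0 n]subn0 big_mkord.
Qed.

Section Words.
Variable L : int -> int -> bool.

Definition word (ws : seq (int * int)) v := foldl (fun w p => E p.1 p.2 w) v ws.

Lemma word_linear ws : linear (word ws).
Proof.
elim: ws => [|p ws IH] a v w //=.
by rewrite tE_linear IH.
Qed.

(** The letters of a word act from the head of the list. The empty word is
    included, which excludes the vacuum. *)
Definition annihilated v :=
  forall ws, all (fun p => L p.1 p.2) ws -> (word ws v)@_vacN = 0.

Hypothesis Lbase : forall k l v, 0 < l -> annihilated v -> (E k l v)@_vacN = 0.

(** By induction on the word: an operator with arbitrary index commutes past
    the letters of the word, at the price of shorter words, until it meets the
    dual vacuum. *)
Lemma annihilated_E k l v : annihilated v -> annihilated (E k l v).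
Proof.
move=> hv ws; elim: ws v hv k l => [|[r q] ws IH] v hv k l /=.
  move=> _; case: (ltrP 0 l) => hl; first exact: Lbase.
  by apply: E_at_vac_le0 => //; exact: (hv [::]).
move=> /andP[hL hws].
have hE : annihilated (E r q v) by move=> ws' h'; apply: (hv ((r, q) :: ws')); rewrite /= hL.
have comb (x y z c1 c2 d : C) : x = 0 -> y = 0 -> z = 0 -> x + (c1 * y + c2 * (d * z)) = 0.
  by move=> -> -> ->; rewrite !mulr0 !addr0.
apply: etrans (congr1 (fun x => (word ws x)@_vacN) (tE_comm r q k l v)) _.
apply: etrans (congr1 (mcoeff vacN) (lin_comb (word_linear ws) _ _ _ _ _ _)) _.
apply: etrans (mcoeff_comb _ _ _ _ _ _ _) _.
exact: (comb _ _ _ _ _ _ (IH _ hE k l hws) (IH _ hv (r + k) (q + l) hws) (hv ws hws)).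
Qed.

Lemma annihilated_submodule : diffq_submodule (tensor_action F) annihilated.
Proof.
have h0 : annihilated 0 by move=> ws _; rewrite (lin0 (word_linear ws)) mcoeff0.
have hl a v w : annihilated v -> annihilated w -> annihilated (a *: v + w).
  by move=> hv hw ws h; rewrite word_linear mcoeffD mcoeffZ hv // hw // mulr0 addr0.
split=> //.
- by move=> k l v; exact: annihilated_E.
- move=> v hv; have -> : actc (tensor_action F) v = N%:R *: v.
    pose L1 v := actc (tensor_action F) v; apply: (@lin_ext _ _ _ L1 (fun v => N%:R *: v)).
    + apply: (@islin_sum _ _ _ _ _ (fun i => tensor_at i (actc (F i)))) => i.
      exact: tensor_at_linear.
    + exact/islin_scale/islin_id.
    move=> t; rewrite /L1 -tens_basis /=.
    under eq_bigr => i _.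
      rewrite tensor_at_tens; last exact: (actc_linear (fock_diffq (hF i))).
      rewrite (fock_c (hF i)) (tens_ext (updf_id _ i)).
      over.
    by rewrite sumr_const card_ord scaler_nat.
  by rewrite -[_ *: v]addr0; apply: hl.
move=> v hv; have -> : actc' (tensor_action F) v = 0; last exact: h0.
pose L1 v := actc' (tensor_action F) v; apply: (@lin_ext _ _ _ L1 (fun v => 0)).
- apply: (@islin_sum _ _ _ _ _ (fun i => tensor_at i (actc' (F i)))) => i.
  exact: tensor_at_linear.
- exact: islin_zero.
move=> t; rewrite /L1 -tens_basis /= big1 // => i _.
rewrite tensor_at_tens; last exact: (actc'_linear (fock_diffq (hF i))).
by rewrite (fock_c' (hF i)); exact: (lin0 (tens_linear _ i)).
Qed.

(** The annihilated vectors form a submodule that does not contain the vacuum.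
    *)
Lemma annihilated_eq0 v : diffq_irreducible (tensor_action F) -> annihilated v -> v = 0.
Proof.
move=> [_ /(_ _ annihilated_submodule)] [h|h] hv; first exact: h.
have := h << vacN >> [::] isT; rewrite /= mcoeffUU => /eqP.
by rewrite oner_eq0.
Qed.

End Words.
End TensorModule.

(** * Uniqueness *)

Section Uniqueness.
Variables (C : fieldType) (s : C) (N : nat) (u : 'I_N -> C) (z : C).
Variable (F : 'I_N -> diffq_action (fock C)).

Notation E := (actE (tensor_action F)).
Notation vacN := ([ffun => one_mon] : tensor_basis N).

(** The position x_{i,m} = u_i q^(-m-1) of the mode m of colour i. *)
Definition place (p : 'I_N * int) : C := u p.1 * s ^ (- 2 * p.2 - 2).

(** The indices of the operators that occur in the Whittaker conditions. *)
Definition cone (k l : int) := [&& 0 <= k, k <= N%:Z * l & 0 < l].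

(** The Whittaker conditions say that E_{a,b} acts by the scalar [chi a b]. *)
Definition chi (a b : int) : C :=
  if a == 0 then z ^ b / (s ^ b - s ^ (- b))
  else if a == N%:Z * b then
    ((- s^-1) ^+ N * (\prod_(i < N) u i) * z) ^ b / (s ^ (- b) - s ^ b)
  else 0.

Lemma whittaker_cone W : (0 < N)%N -> whittaker s u z (tensor_action F) W ->
  forall a b d, cone a b -> E a b (W (d + b)) = chi a b *: W d.
Proof.
move=> hN hW a b d /and3P[h1 h2 h3]; rewrite /chi.
case: (eqVneq a 0) => [->|ha0]; first exact: (whittaker_E0 hW h3 d).
case: (eqVneq a (N%:Z * b)) => [->|haN]; first exact: (whittaker_EN hW h3 d).
rewrite scale0r; apply: (whittaker_E hW); first by lia.
by rewrite lt_neqAle haN.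
Qed.

Lemma graded_neg W d : graded_completion (W : int -> tensor_fock C N) -> d < 0 -> W d = 0.
Proof.
move=> hW hd; apply/malgP => t; rewrite mcoeff0; apply: mcoeff_outdom.
by apply/negP => /hW; lia.
Qed.

Lemma tensor_deg_vac : tensor_deg vacN = 0%N.
Proof.
apply: big1 => i _; rewrite ffunE (@fock_degE _ fset0) ?big_seq_fset0 //.
by apply/fsubsetP => j; rewrite mem_finsupp onecmE.
Qed.

Hypotheses (hs : s != 0) (hu : forall i, u i != 0).
Hypothesis hsn : forall n : nat, (0 < n)%N -> s ^+ n != 1.
Hypothesis hF : forall i, fock_module s (u i) (F i).
Hypothesis irr : diffq_irreducible (tensor_action F).

Lemma rho_place i l m : rho s (u i) l m = s ^ l * place (i, m).
Proof. by rewrite /rho /place /= mulrCA -expfzDr //; congr (_ * s ^ _); lia. Qed.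

(** If the positions are distinct, then the conditions for 0 <= k < N l are
    already as many as the nodes of <0|E_{k,l}, and all the others follow from
    [moments_eq0]. *)
Lemma cone_base : injective place -> forall k l v, 0 < l ->
  annihilated F cone v -> (E k l v)@_vacN = 0.
Proof.
move=> hinj k [n|n] v // hn hv.
have n0 : (0 < n)%N by lia.
have [L hL] := E_at_vac_gt0 hs hu hsn hF v n0.
set r := [seq (i, m) | i <- _, m <- _] in hL.
have sr : size r = (N * n)%N by rewrite size_allpairs size_enum_ord size_iota.
have ur : uniq r.
  by apply: allpairs_uniq; rewrite ?enum_uniq ?iota_uniq // => -[a b] [c d].
have L0 : {in r, forall p, L p = 0}.
  apply: (@moments_eq0 _ _ r (fun p => rho s (u p.1) n p.2)) => //.
    move=> [i m] [j m'] _ _ /=; rewrite !rho_place => /(mulfI (expfz_neq0 n hs))/hinj [-> h].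
    by congr (_, _); lia.
  move=> a ha; apply: etrans (esym (hL a%:Z)) _.
  by apply: (hv [:: (a%:Z, n%:Z)]); rewrite /= andbT /cone sr in ha *; lia.
by apply: etrans (hL k) _; rewrite big_seq big1 // => p /L0 ->; rewrite mulr0.
Qed.

(** In the lowest degree where two Whittaker vectors differ, their difference
    is killed by every operator of the cone, because these lower the degree;
    hence it is annihilated by all words. *)
Lemma whittaker_unique W W' : (0 < N)%N -> injective place ->
  whittaker s u z (tensor_action F) W -> whittaker s u z (tensor_action F) W' -> W = W'.
Proof.
move=> hN hinj hW hW'; apply/funext => -[d|d]; last first.
  by rewrite !graded_neg //; [exact: whittaker_completion hW' | exact: whittaker_completion hW].
have [n] := ubnP d; elim: n d => // n IH d hd.
have eq_lt (e : int) : e < d%:Z -> W e = W' e.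
  case: e => [e|e] he; first by apply: IH; lia.
  by rewrite !graded_neg //; [exact: whittaker_completion hW' | exact: whittaker_completion hW].
case: (posnP d) => [->|d0]; first by rewrite (whittaker_vac hW) (whittaker_vac hW').
apply/eqP; rewrite -subr_eq0; apply/eqP.
apply: (annihilated_eq0 hs hu hsn hF (cone_base hinj) irr).
(* The empty word: a component of positive degree has no vacuum coefficient. *)
have ev0 X : whittaker s u z (tensor_action F) X -> (X d%:Z)@_vacN = 0.
  move=> hX; apply: mcoeff_outdom; apply/negP => /(whittaker_completion hX).
  by rewrite tensor_deg_vac; lia.
case=> [|[a b] ws] /=.
  by move=> _; apply: etrans (mcoeffB _ _ _) _; rewrite (ev0 _ hW) (ev0 _ hW') subrr.
move=> /andP[hab _].
have hb : 0 < b by case/and3P: hab.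
have -> : E a b (W d%:Z - W' d%:Z) = 0.
  apply: etrans (linB (tE_linear F a b) _ _) _.
  have e1 := whittaker_cone hN hW (d%:Z - b) hab.
  have e2 := whittaker_cone hN hW' (d%:Z - b) hab.
  rewrite subrK in e1; rewrite subrK in e2.
  by rewrite e1 e2 eq_lt ?subrr //; lia.
by rewrite (lin0 (word_linear F ws)) mcoeff0.
Qed.

End Uniqueness.

(** * One-hook states *)

Section Hooks.
Variable C : fieldType.
Notation hopc := (@hopc C).

Lemma occ_pair (z x y : int) : occ z (tog x (tog y fset0)) = (z < 0) (+) (z == y) (+) (z == x).
Proof. by rewrite !occ_tog /occ in_fset0 addbF. Qed.

Lemma sg_pair (a x y : int) :
  sg lti C a (tog x (tog y fset0)) = (-1) ^+ (x < a)%R * (-1) ^+ (y < a)%R.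
Proof. by rewrite !sg_tog /sg big_seq_fset0 mulr1. Qed.

Lemma hopd0 a : hopd a a fset0 = fset0.
Proof. by rewrite /hopd eqxx. Qed.

(** [hopd (-n) 0 fset0] is the hook with a particle at 0 and a hole at -n (the
    vacuum for n = 0). Of the hops that lower its energy by b, only the one
    that moves the hole to b - n is allowed. *)
Lemma hopc_hole (n b : nat) (m : int) : (0 < b)%N ->
  hopc m (m - b%:Z) (hopd (- n%:Z) 0 fset0) =
  if (m == b%:Z - n%:Z) && (b <= n)%N then -1 else 0.
Proof.
move=> hb; case: (posnP n) => [->|hn].
  by rewrite oppr0 hopd0 hopc_vac // ifF //; lia.
rewrite /hopd ifF; last by lia.
rewrite /hopc ifF; last by lia.
rewrite !occ_pair.
have -> : ((m < 0) (+) (m == - n%:Z) (+) (m == 0)) &&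
   ~~ ((m - b%:Z < 0) (+) (m - b%:Z == - n%:Z) (+) (m - b%:Z == 0)) =
   ((m == b%:Z - n%:Z) && (b <= n)%N).
  by case: (ltP m 0); case: (ltP (m - b%:Z) 0); case: (eqVneq m (- n%:Z)); case: (eqVneq m 0);
    case: (eqVneq (m - b%:Z) (- n%:Z)); case: (eqVneq (m - b%:Z) 0) => /=; lia.
case: andP => [[/eqP -> hbn]|_]; last by rewrite mul0r.
rewrite sg_pair sg_tog sg_pair.
rewrite (_ : (0 < b%:Z - n%:Z) = false); last by lia.
rewrite (_ : (- n%:Z < b%:Z - n%:Z) = true); last by lia.
rewrite (_ : (b%:Z - n%:Z < b%:Z - n%:Z - b%:Z) = false); last by lia.
rewrite (_ : (0 < b%:Z - n%:Z - b%:Z) = false); last by lia.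
rewrite (_ : (- n%:Z < b%:Z - n%:Z - b%:Z) = false); last by lia.
by rewrite !expr0 expr1 !mul1r !mulr1.
Qed.

Lemma hopd_hole (n b : nat) : (0 < b)%N -> (b <= n)%N ->
  hopd (b%:Z - n%:Z) (b%:Z - n%:Z - b%:Z) (hopd (- n%:Z) 0 fset0) =
  hopd (- (n - b)%:Z) 0 fset0.
Proof.
move=> hb hbn; apply/fsetP => x; rewrite /hopd ifF; last by lia.
rewrite ifF; last by lia.
rewrite !mem_tog in_fset0 /=.
case: (eqVneq (- (n - b)%:Z) 0) => h; rewrite ?mem_tog in_fset0.
  by case: (eqVneq x (- n%:Z)); case: (eqVneq x 0); case: (eqVneq x (b%:Z - n%:Z));
   case: (eqVneq x (b%:Z - n%:Z - b%:Z)) => /=; lia.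
by case: (eqVneq x (- n%:Z)); case: (eqVneq x 0); case: (eqVneq x (b%:Z - n%:Z));
   case: (eqVneq x (b%:Z - n%:Z - b%:Z)); case: (eqVneq x (- (n - b)%:Z)) => /=; lia.
Qed.

(** [hopd (-1) p fset0] is the hook with a hole at -1 and a particle at p (the
    vacuum for p = -1). Only the particle can move down; the sign appears when
    it fills the hole. *)
Lemma hopc_part (p m : int) (b : nat) : (0 < b)%N -> -1 <= p ->
  hopc m (m - b%:Z) (hopd (-1) p fset0) =
  if (m == p) && (b%:Z <= p + 1) then (if p - b%:Z == -1 then -1 else 1) else 0.
Proof.
move=> hb hp; case: (eqVneq p (-1)) => [->|hp1].
  by rewrite hopd0 hopc_vac // ifF //; lia.
rewrite /hopd ifF; last by lia.
rewrite /hopc ifF; last by lia.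
rewrite !occ_pair.
have -> : ((m < 0) (+) (m == -1) (+) (m == p)) &&
   ~~ ((m - b%:Z < 0) (+) (m - b%:Z == -1) (+) (m - b%:Z == p)) =
   ((m == p) && (b%:Z <= p + 1)).
  by case: (ltP m 0); case: (ltP (m - b%:Z) 0); case: (eqVneq m (-1)); case: (eqVneq m p);
    case: (eqVneq (m - b%:Z) (-1)); case: (eqVneq (m - b%:Z) p) => /=; lia.
case: andP => [[/eqP -> hbn]|_]; last by rewrite mul0r.
rewrite sg_pair sg_tog sg_pair.
rewrite (_ : (p < p) = false); last by lia.
rewrite (_ : (-1 < p) = true); last by lia.
rewrite (_ : (p < p - b%:Z) = false); last by lia.
rewrite expr0 expr1 !mul1r.
case: eqVneq => h.
  rewrite (_ : (-1 < p - b%:Z) = false); last by lia.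
  by rewrite expr0 mulr1.
rewrite (_ : (-1 < p - b%:Z) = true); last by lia.
by rewrite expr1 mulrNN mulr1.
Qed.

Lemma hopd_part (p : int) (b : nat) : (0 < b)%N -> b%:Z <= p + 1 ->
  hopd p (p - b%:Z) (hopd (-1) p fset0) = hopd (-1) (p - b%:Z) fset0.
Proof.
move=> hb hbp; apply/fsetP => x; rewrite /hopd ifF; last by lia.
rewrite ifF; last by lia.
rewrite !mem_tog in_fset0 /=.
case: (eqVneq (-1) (p - b%:Z)) => h; rewrite ?mem_tog in_fset0.
  by case: (eqVneq x (-1)); case: (eqVneq x p); case: (eqVneq x (p - b%:Z)) => /=; lia.
by case: (eqVneq x (-1)); case: (eqVneq x p); case: (eqVneq x (p - b%:Z)) => /=; lia.
Qed.

Lemma charge_hook a b : occ a fset0 -> ~~ occ b fset0 -> charge (hopd a b fset0) = 0.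
Proof.
rewrite /hopd; case: (eqVneq a b) => [|h ha hb]; first by rewrite charge0.
by rewrite !charge_tog occ_tog eq_sym (negbTE h) ha (negbTE hb) charge0.
Qed.

Lemma charge_hole (n : nat) : charge (hopd (- n%:Z) 0 fset0) = 0.
Proof.
case: (posnP n) => [->|h]; first by rewrite oppr0 hopd0 charge0.
by apply: charge_hook; rewrite /occ in_fset0 addbF; lia.
Qed.

Lemma charge_part (p : int) : -1 <= p -> charge (hopd (-1) p fset0) = 0.
Proof.
case: (eqVneq p (-1)) => [->|h hp]; first by rewrite hopd0 charge0.
by apply: charge_hook; rewrite /occ in_fset0 addbF; lia.
Qed.

Lemma hole_eq0 (n : nat) : (hopd (- n%:Z) 0 fset0 == fset0) = (n == 0)%N.
Proof.
case: (posnP n) => [->|hn]; first by rewrite oppr0 hopd0 eqxx.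
apply/negbTE/fset0Pn; exists 0; rewrite /hopd ifF; last by lia.
by rewrite !mem_tog in_fset0 eqxx; lia.
Qed.

Variables (s u : C).
Hypotheses (hs : s != 0) (hu : u != 0).
Hypothesis hsn : forall n : nat, (0 < n)%N -> s ^+ n != 1.
Hypothesis hchar : forall n : nat, n.+1%:R != 0 :> C.
Variable (A : diffq_action (fock C)).
Hypothesis fm : fock_module s u A.
Variable S : state -> fock C.
Hypothesis HS : forall D, charge D = 0 -> matched s u A (S D) (@delta C D).
Notation E := (actE A).

Lemma E_S_single k (b : nat) D m0 c : (0 < b)%N -> charge D = 0 ->
  (forall m, hopc m (m - b%:Z) D = if m == m0 then c else 0) ->
  E k b (S D) = (rho s u b m0 ^ k * c) *: S (hopd m0 (m0 - b%:Z) D).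
Proof.
move=> hb hD h; pose n := (bound D + b + absz m0 + 1)%N.
rewrite (E_S hs hu hsn hchar fm HS (n := n)) //; [|rewrite /n; lia|right; lia].
rewrite (_ : (b%:Z == 0) = false); last by lia.
rewrite !mul0r scale0r addr0.
rewrite (bigD1_seq m0) ?win_uniq //=; last by rewrite mem_win /n; lia.
rewrite h eqxx big1 ?addr0 // => m /negbTE hm.
by rewrite h hm mulr0 scale0r.
Qed.

Lemma E_hole k (n b : nat) : (0 < b)%N -> E k b (S (hopd (- n%:Z) 0 fset0)) =
  (if (b <= n)%N then - (rho s u b (b%:Z - n%:Z) ^ k) else 0) *: S (hopd (- (n - b)%:Z) 0 fset0).
Proof.
move=> hb; have := @E_S_single k b _ (b%:Z - n%:Z) (if (b <= n)%N then -1 else 0) hb (charge_hole n).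
move=> ->; last first.
  by move=> m; rewrite hopc_hole //; case: eqP => //= _; case: ifP.
case: ifP => hbn; last by rewrite mulr0 !scale0r.
by rewrite mulrN1 hopd_hole.
Qed.

Lemma E_part k (p : int) (b : nat) : (0 < b)%N -> -1 <= p ->
  E k b (S (hopd (-1) p fset0)) =
  (if b%:Z <= p + 1 then rho s u b p ^ k * (if p - b%:Z == -1 then -1 else 1) else 0)
   *: S (hopd (-1) (p - b%:Z) fset0).
Proof.
move=> hb hp; have := @E_S_single k b _ p (if b%:Z <= p + 1 then (if p - b%:Z == -1 then -1 else 1) else 0) hb (charge_part hp).
move=> ->; last first.
  by move=> m; rewrite hopc_part //; case: eqP => //= _; case: ifP.
case: ifP => hbn; last by rewrite mulr0 !scale0r.
by rewrite hopd_part.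
Qed.

End Hooks.

(** * Irreducibility excludes resonances *)

Section Resonance.
Variables (C : fieldType) (s : C) (N : nat) (u : 'I_N -> C).
Hypotheses (hs : s != 0) (hu : forall i, u i != 0).
Hypothesis hsn : forall n : nat, (0 < n)%N -> s ^+ n != 1.
Hypothesis hchar : forall n : nat, n.+1%:R != 0 :> C.
Variable (F : 'I_N -> diffq_action (fock C)).
Hypothesis hF : forall i, fock_module s (u i) (F i).

Notation E := (actE (tensor_action F)).
Notation vacN := ([ffun => one_mon] : tensor_basis N).

Lemma schur_family : exists S : 'I_N -> state -> fock C,
  forall i D, charge D = 0 -> matched s (u i) (F i) (S i D) (@delta C D).
Proof.
have H (p : 'I_N * state) : exists v, charge p.2 = 0 ->
    matched s (u p.1) (F p.1) v (@delta C p.2).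
  case: (eqVneq (charge p.2) 0) => h; last by exists 0 => h'; case/eqP: h.
  by have [v hv] := matched_delta hs (hu p.1) hsn (hF p.1) h; exists v.
have [S hS] := choice H.
by exists (fun i D => S (i, D)) => i D; exact: (hS (i, D)).
Qed.

Variable S : 'I_N -> state -> fock C.
Hypothesis HS : forall i D, charge D = 0 -> matched s (u i) (F i) (S i D) (@delta C D).

Lemma SE_vac i k l : 0 < l -> actE (F i) k l (S i fset0) = 0.
Proof.
move=> hl; rewrite (S_vac hs (hu i) hsn hchar (hF i) (HS i)).
exact: (fockE_vac_pos hs hsn (hF i)).
Qed.

Lemma tens_eq0 (f : 'I_N -> fock C) i : f i = 0 -> tens f = 0.
Proof.
move=> h; rewrite -(tens_ext (updf_id f i)) h.
exact: (lin0 (tens_linear f i)).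
Qed.

Variables (i j : 'I_N) (k : nat).
Hypothesis hij : i != j.
Hypothesis huij : u i = u j * s ^ (2 * k%:Z).

(** Two hooks, a column in position j and a row in position i, with vacua
    elsewhere; by the resonance relation the nodes of their hops coincide. *)
Definition hook_pair (n1 n2 : nat) : 'I_N -> fock C :=
  updf (updf (fun h => S h fset0) i (S i (hopd (-1) (k%:Z - n2%:Z) fset0)))
    j (S j (hopd (- n1%:Z) 0 fset0)).

(** The sign with which a row of length zero replaces a hook whose particle
    has filled its hole. *)
Definition hook_sign (n : nat) : C := if n == k.+1 then -1 else 1.

Lemma E_hook_pair a (b n1 n2 : nat) : (0 < b)%N -> (n2 < k.+2)%N ->
  E a b (tens (hook_pair n1 n2)) =
   (if (b <= n1)%N then - (rho s (u j) b (b%:Z - n1%:Z) ^ a) else 0) *: tens (hook_pair (n1 - b) n2)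
   + (if (n2 + b < k.+2)%N then rho s (u i) b (k%:Z - n2%:Z) ^ a * hook_sign (n2 + b) else 0)
      *: tens (hook_pair n1 (n2 + b)).
Proof.
move=> hb hn2; apply: etrans (tE_tens hF a b _) _.
rewrite (bigD1 j) //= [X in _ + X](bigD1 i) //= [X in _ + (_ + X)]big1 ?addr0; last first.
  move=> h /andP[hj hi]; apply: (@tens_eq0 _ h).
  by rewrite updf_eq /hook_pair !updf_ne // SE_vac.
congr (_ + _).
  rewrite {2}/hook_pair updf_eq (E_hole hs (hu j) hsn hchar (hF j) (HS j) a n1 hb) tens_updZ.
  by congr (_ *: _); apply: tens_ext => h; exact: updf_updf.
rewrite {2}/hook_pair updf_ne // updf_eq.
rewrite (E_part hs (hu i) hsn hchar (hF i) (HS i) a hb); last by lia.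
rewrite tens_updZ; congr (_ *: _).
  rewrite (_ : (b%:Z <= k%:Z - n2%:Z + 1) = (n2 + b < k.+2)%N); last by lia.
  by rewrite /hook_sign (_ : (k%:Z - n2%:Z - b%:Z == -1) = (n2 + b == k.+1)%N) //; lia.
apply: tens_ext => h; rewrite /hook_pair.
rewrite (_ : k%:Z - n2%:Z - b%:Z = k%:Z - (n2 + b)%:Z); last by lia.
rewrite /updf; case: (eqVneq h i) => [->|//].
by rewrite (negbTE hij).
Qed.

(** The sum over n of products of a column of height n and a row of length k +
    1 - n. A hop in the column of one term cancels a hop in the row of another
    one. *)
Definition singular : tensor_fock C N :=
  \sum_(n <- iota 0 k.+2) hook_sign n *: tens (hook_pair n n).

(** Lowering the column of the n-th term by b and lowering the row of the
    (n-b)-th term by b produce the same state with the same node, and opposite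
    signs. *)
Lemma E_singular a (b : nat) : (0 < b)%N -> E a b singular = 0.
Proof.
move=> hb; rewrite /singular (lin_sum (tE_linear F a b)).
pose r n := rho s (u j) b (b%:Z - n%:Z) ^ a.
(* The resonance: the node of the row of the n-th term is that of a column. *)
have hr n : rho s (u i) b (k%:Z - n%:Z) ^ a = r (n + b)%N.
  rewrite /r /rho huij -mulrA -expfzDr //; congr ((_ * s ^ _) ^ _); lia.
pose g n := (- (hook_sign n * r n)) *: tens (hook_pair (n - b) n).
transitivity (\sum_(n <- iota 0 k.+2) (if (b <= n)%N then g n else 0)
   - \sum_(n <- iota 0 k.+2) (if (n + b < k.+2)%N then g (n + b)%N else 0)).
  rewrite -sumrB; apply: eq_big_seq => n; rewrite mem_iota => hn.
  rewrite (linZ (tE_linear F a b)) E_hook_pair // scalerDr !scalerA; congr (_ + _).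
    by case: ifP => _; [rewrite mulrN | rewrite mulr0 scale0r].
  rewrite hr; case: ifP => h; last by rewrite mulr0 scale0r oppr0.
  rewrite /g addnK -scaleNr opprK; congr (_ *: _).
  by rewrite {1}/hook_sign ifF ?mul1r 1?mulrC //; lia.
apply/eqP; rewrite subr_eq0; apply/eqP.
rewrite -(big_map (fun n => n + b)%N xpredT (fun n => if (n < k.+2)%N then g n else 0)).
transitivity (\sum_(n <- [seq (n + b)%N | n <- iota 0 k.+2]) (if (b <= n)%N && (n < k.+2)%N then g n else 0)).
  transitivity (\sum_(n <- iota 0 k.+2) (if (b <= n)%N && (n < k.+2)%N then g n else 0)).
    by apply: eq_big_seq => n; rewrite mem_iota => /andP[_ ->]; rewrite andbT.
  apply: eq_big_supp; rewrite ?iota_uniq //.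
  - by rewrite map_inj_uniq ?iota_uniq // => x y /addIn.
  - move=> n hn hn'; case: ifP => // /andP[h1 h2]; case/mapP: hn'.
    by exists (n - b)%N; [rewrite mem_iota; lia | lia].
  by move=> n _; rewrite mem_iota => h; rewrite ifF //; lia.
by apply: eq_big_seq => n /mapP[m _ ->]; rewrite leq_addl.
Qed.

(** The coefficient at a monomial of the longest row, tensored with vacua,
    comes from the term n = 0 only. *)
Lemma singular_neq0 : singular != 0.
Proof.
have h0 : charge (hopd (-1) k%:Z fset0) = 0 by apply: charge_part.
have [b hb] := malg_neq0 (S_neq0 hs (hu i) hsn (hF i) (HS i) h0).
pose t : tensor_basis N := [ffun h => if h == i then b else one_mon].
have at_vac h D : charge D = 0 -> (S h D)@_one_mon = (D == fset0)%:R.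
  exact: (S_at_vac hs (hu h) hsn (hF h) (HS h)).
have hji : (j == i) = false by rewrite eq_sym (negbTE hij).
suff : singular@_t != 0.
  by apply: contraNneq => ->; rewrite mcoeff0.
rewrite /singular mcoeff_sum (bigD1_seq 0%N) ?iota_uniq //= big1_seq ?addr0; last first.
  move=> n /andP[hn _]; rewrite mcoeffZ mcoeff_tens (bigD1 j) //= /hook_pair updf_eq ffunE.
  rewrite hji at_vac; last exact: charge_hole.
  by rewrite hole_eq0 (negbTE hn) mul0r mulr0.
rewrite mcoeffZ mcoeff_tens /hook_sign /= mul1r; apply/prodf_neq0 => h _.
rewrite /hook_pair ffunE; case: (eqVneq h j) => [->|hj].
  rewrite updf_eq hji at_vac; last exact: charge_hole.
  by rewrite hole_eq0 oner_neq0.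
rewrite updf_ne //; case: (eqVneq h i) => [->|hi]; first by rewrite updf_eq subr0.
by rewrite updf_ne // at_vac ?charge0 // eqxx oner_neq0.
Qed.

Lemma singular_annihilated : annihilated F (fun _ l => 0 < l) singular.
Proof.
case=> [_|[a [[|b]|b]] ws] //=; last first.
  move=> _; rewrite (_ : E a b.+1%:Z singular = 0); last exact: E_singular.
  by apply: mcoeff_lin0; exact: word_linear.
rewrite /singular mcoeff_sum big1_seq // => n _; rewrite mcoeffZ.
rewrite (_ : (tens (hook_pair n n))@_vacN = 0) ?mulr0 //.
have at_vac h D : charge D = 0 -> (S h D)@_one_mon = (D == fset0)%:R.
  exact: (S_at_vac hs (hu h) hsn (hF h) (HS h)).
rewrite mcoeff_tens; apply/eqP/prodf_eq0; case: (posnP n) => [->|hn].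
  exists i => //; rewrite ffunE /hook_pair updf_ne // updf_eq subr0 at_vac; last first.
    exact: charge_part.
  rewrite (_ : (_ == fset0) = false) //; apply/negbTE/fset0Pn; exists (-1).
  by rewrite /hopd !mem_tog in_fset0 eqxx.
exists j => //; rewrite ffunE /hook_pair updf_eq at_vac ?charge_hole // hole_eq0.
by rewrite (_ : (n == 0)%N = false) //; lia.
Qed.

End Resonance.

(** If x_{i,m} = x_{j,m'} for i <> j, then [singular] is a nonzero vector of
    positive degree killed by all E_{a,b} with b > 0, against
    [annihilated_eq0]. *)
Lemma irreducible_nonresonant (C : fieldType) (s : C) (N : nat) (u : 'I_N -> C)
    (F : 'I_N -> diffq_action (fock C)) :
  s != 0 -> (forall i, u i != 0) -> (forall n : nat, (0 < n)%N -> s ^+ n != 1) ->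
  (forall n : nat, n.+1%:R != 0 :> C) ->
  (forall i, fock_module s (u i) (F i)) ->
  diffq_irreducible (tensor_action F) -> injective (place s u).
Proof.
move=> hs hu hsn hchar hF irr.
have [S HS] := schur_family hs hu hsn hF.
have no (i j : 'I_N) (k : nat) : i != j -> u i = u j * s ^ (2 * k%:Z) -> False.
  move=> hij hk; have /eqP[] := singular_neq0 hs hu hsn hF HS k hij.
  apply: (annihilated_eq0 hs hu hsn hF _ irr (singular_annihilated hs hu hsn hchar hF HS hij hk)).
  by move=> a l v hl /(_ [:: (a, l)]); apply; rewrite /= hl.
have H (i j : 'I_N) (m m' : int) : i != j -> m' <= m -> place s u (i, m) = place s u (j, m') -> False.
  move=> hij hm; rewrite /place /= => h; apply: (no i j (absz (m - m')) hij).
  apply: (mulIf (expfz_neq0 (- 2 * m - 2) hs)); rewrite h -mulrA -expfzDr //.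
  by congr (_ * s ^ _); lia.
move=> [i m] [j m'] h; case: (eqVneq i j) h => [->|hij] h.
  congr (_, _); apply: (rho_inj hs (hu j) hsn (l := 0)).
  by move: h; rewrite /place /rho /= => h; rewrite !sub0r -!mulNr.
case: (lerP m' m) => hm; first by case: (H i j m m' hij hm h).
by case: (H j i m' m _ (ltW hm) (esym h)); rewrite eq_sym.
Qed.

(** * Coloured states and their weights *)

Section Coloured.
Variable N : nat.
Notation pos := ('I_N * int)%type.
Notation cstate := {fset pos}.
Implicit Types (p r : pos) (D : cstate) (i j : 'I_N).

(** The lexicographic order; it only serves to fix the signs. *)
Definition plt p r := (p.1 < r.1)%N || ((p.1 == r.1) && (p.2 < r.2)).

Lemma plt_irr p : plt p p = false.
Proof. by rewrite /plt ltnn eqxx ltxx. Qed.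

Lemma plt_tot p r : p != r -> plt r p = ~~ plt p r.
Proof.
case: p r => [i m] [j m']; rewrite /plt xpair_eqE /= => h.
rewrite -val_eqE /= -val_eqE /= in h *; case: ltngtP h => //= E h.
by move: h; rewrite -leNgt le_eqVlt eq_sym => /negbTE ->.
Qed.

Definition slice_of i D : state := [fset p.2 | p in D & p.1 == i].

Lemma mem_slice i D z : (z \in slice_of i D) = ((i, z) \in D).
Proof.
apply/imfsetP/idP => [[[j m]] /=|h].
  by rewrite inE /= => /andP[h /eqP <-] ->.
by exists (i, z) => //; rewrite inE /= h eqxx.
Qed.

Lemma slice_tog i p D :
  slice_of i (tog p D) = if p.1 == i then tog p.2 (slice_of i D) else slice_of i D.
Proof.
case: p => j m; apply/fsetP => z; rewrite mem_slice mem_tog /= xpair_eqE.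
case: (eqVneq j i) => [_|h]; first by rewrite mem_tog mem_slice.
by rewrite addbF mem_slice.
Qed.

Lemma slice0 i : slice_of i fset0 = fset0.
Proof. by apply/fsetP => z; rewrite mem_slice !in_fset0. Qed.

Lemma tog_ind (Q : cstate -> Prop) : Q fset0 ->
  (forall p D, p \notin D -> Q D -> Q (tog p D)) -> forall D, Q D.
Proof.
move=> h0 hs D; have [n] := ubnP (#|` D|); elim: n D => // n IH D hn.
case: (fset_0Vmem D) => [->//|[p hp]].
rewrite -(togK p D); apply: hs; first by rewrite mem_tog hp eqxx.
apply: IH; rewrite /tog hp.
by move: hn; rewrite (cardfsD1 p) hp add1n ltnS.
Qed.

Definition pocc p D := (p.2 < 0) (+) (p \in D).

Lemma occ_slice p D : occ p.2 (slice_of p.1 D) = pocc p D.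
Proof. by rewrite /occ mem_slice -surjective_pairing. Qed.

Lemma pocc_tog p r D : pocc p (tog r D) = pocc p D (+) (p == r).
Proof. by rewrite /pocc mem_tog addbA. Qed.

Definition sgp p : int := if p.2 < 0 then -1 else 1.

Definition tcharge D : int := \sum_(r <- D) sgp r.
Definition tenergy D : int := \sum_i energy (slice_of i D).

Lemma tcharge_slices D : tcharge D = \sum_i charge (slice_of i D).
Proof.
elim/tog_ind: D => [|p D hp IH].
  rewrite /tcharge big_seq_fset0 big1 // => i _.
  by rewrite slice0 charge0.
rewrite /tcharge big_tog // -/(tcharge D) IH [RHS](bigD1 p.1) //= [in LHS](bigD1 p.1) //=.
rewrite slice_tog eqxx charge_tog occ_slice /pocc (negbTE hp) addbF -/(sgp p).
rewrite addrA [sgp p + _]addrC; congr (_ + _).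
by apply: eq_bigr => i hi; rewrite slice_tog eq_sym (negbTE hi).
Qed.

Variable C : fieldType.

Notation sgc := (sg plt C).

(** The sign relative to all colours is the sign within the colour of [p],
    times a factor that depends on the other colours and cancels in each hop. *)
Lemma sg_flat p D : sgc p D =
  sg (fun a b : pos => (a.1 < b.1)%N) C p D * sg lti C p.2 (slice_of p.1 D).
Proof.
elim/tog_ind: D => [|r D _ IH]; first by rewrite /sg slice0 !big_seq_fset0 mulr1.
rewrite !sg_tog IH slice_tog; case: (eqVneq r.1 p.1) => h.
  rewrite sg_tog /plt h ltnn eqxx /= expr0 mul1r.
  by rewrite mulrCA.
by rewrite /plt -val_eqE /= in h *; rewrite (negbTE h) /= orbF mulrA.
Qed.

Lemma hopc_flat i (a b : int) D : a != b ->
  hopc C a b (slice_of i D) =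
  (pocc (i, a) D && ~~ pocc (i, b) D)%:R * (sgc (i, a) D * sgc (i, b) (tog (i, a) D)).
Proof.
move=> hab; rewrite /hopc (negbTE hab) -!occ_slice /=; congr (_ * _).
rewrite !sg_flat /= slice_tog eqxx /= [X in _ = _ * (X * _)]sg_tog /= ltnn expr0 mul1r.
have K : sg (fun a b : pos => (a.1 < b.1)%N) C (i, a) D *
    sg (fun a b : pos => (a.1 < b.1)%N) C (i, b) D = 1.
  exact: (sg2 (fun a b : pos => (a.1 < b.1)%N) C (i, a) D).
by rewrite [RHS]mulrACA K mul1r.
Qed.

Variable x : pos -> C.
Hypothesis xinj : injective x.
Variable B : pos -> C.
Hypothesis B0 : forall p, B p != 0.

Definition gap p r : C := if p == r then 1 else x p - x r.

Lemma gap_neq0 p r : gap p r != 0.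
Proof.
rewrite /gap; case: (eqVneq p r) => [_|h]; first exact: oner_neq0.
by rewrite subr_eq0 (inj_eq xinj).
Qed.

Definition vweight p r : C := if plt p r then (x p - x r) ^ (sgp p * sgp r) else 1.

(** The weight of a coloured state: one-body factors [B] and a Vandermonde
    product of pairwise differences of positions, with exponents 1 for equal
    and -1 for opposite charges. *)
Definition phi D : C := (\prod_(p <- D) B p ^ sgp p) *
  \prod_(p <- D) \prod_(r <- D) vweight p r.

(** The interaction of a particle at [p] with the state; the self-interaction
    is left out by [gap p p = 1]. *)
Definition gfun D p : C := \prod_(r <- D) gap p r ^ sgp r.

Lemma sgp_cases p : sgp p = 1 \/ sgp p = -1.
Proof. by rewrite /sgp; case: ifP; [right|left]. Qed.

Lemma phi_add p D : p \notin D ->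
  sgc p D * phi (tog p D) = phi D * (B p * gfun D p) ^ sgp p.
Proof.
move=> hp; rewrite /phi !(big_tog _ _ hp) /=.
have -> : \prod_(r <- D) \prod_(r0 <- tog p D) vweight r r0 =
   (\prod_(r <- D) vweight r p) * \prod_(r <- D) \prod_(r0 <- D) vweight r r0.
  by rewrite -big_split; apply: eq_bigr => r _; rewrite big_tog.
have -> : vweight p p = 1 by rewrite /vweight plt_irr.
rewrite expfzMl mul1r.
have E : sgc p D * (\prod_(r <- D) vweight p r * \prod_(r <- D) vweight r p) = gfun D p ^ sgp p.
  rewrite /sg -!big_split /= /gfun.
  rewrite (big_morph (fun y => y ^ sgp p) (fun y z => expfzMl y z (sgp p)) (exp1rz _ _)).
  apply: eq_big_seq => r hr; have hpr : p != r by apply: contraNneq hp => ->.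
  rewrite /vweight (plt_tot hpr) /gap (negbTE hpr).
  case: (plt p r) => /=; first by rewrite expr0 mul1r mulr1 exprz_exp mulrC.
  rewrite expr1 mul1r mulN1r -opprB.
  have hx : x r - x p != 0 by rewrite subr_eq0 (inj_eq xinj) eq_sym.
  case: (sgp_cases p) => ->; case: (sgp_cases r) => ->;
    rewrite ?mulr1 ?mul1r ?mulrNN ?exprN1 ?expr1z ?invrN ?opprK ?invrK //.
rewrite -E; ring.
Qed.

Lemma gfun_tog p D : gfun (tog p D) p = gfun D p.
Proof.
case: (boolP (p \in D)) => h; last by rewrite /gfun big_tog //= /gap eqxx exp1rz mul1r.
rewrite -{2}(togK p D) /gfun [RHS]big_tog /=; last by rewrite mem_tog h eqxx.
by rewrite /gap eqxx exp1rz mul1r.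
Qed.

Lemma gfun_neq0 D p : gfun D p != 0.
Proof. by rewrite prodf_seq_neq0; apply/allP => r _; rewrite expfz_neq0 // gap_neq0. Qed.

(** One sign rule for adding or removing a particle or a hole: removal inverts
    the factor. *)
Lemma phi_tog p D : sgc p D * phi (tog p D) =
  phi D * (B p * gfun D p) ^ (if pocc p D then -1 else 1).
Proof.
case: (boolP (p \in D)) => hp; last first.
  by rewrite phi_add // /pocc (negbTE hp) addbF.
have hp' : p \notin tog p D by rewrite mem_tog hp eqxx.
have := phi_add hp'; rewrite togK gfun_tog.
have -> : sgc p (tog p D) = sgc p D by rewrite sg_tog plt_irr expr0 mul1r.
have hn : B p * gfun D p != 0 by rewrite mulf_neq0 ?gfun_neq0.
move=> E; have -> : phi D = sgc p D * (phi (tog p D) * (B p * gfun D p) ^ sgp p).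
  by rewrite -E mulrA sg2 mul1r.
rewrite -!mulrA -expfzDr // (_ : sgp p + _ = 0) ?expr0z ?mulr1 //.
by rewrite /pocc hp addbT /sgp; case: (p.2 < 0).
Qed.

Lemma gfun_tog_ne p r D : p != r -> pocc r D ->
  gfun (tog r D) p = gfun D p / gap p r.
Proof.
move=> h; rewrite /pocc /gfun; case: (boolP (r \in D)) => hr; last first.
  by rewrite addbF big_tog //= /sgp => ->; rewrite exprN1 mulrC.
rewrite addbT => hr2; rewrite -{2}(togK r D) [in RHS]big_tog /=; last by rewrite mem_tog hr eqxx.
by rewrite /sgp (negbTE hr2) expr1z [gap p r * _]mulrC mulfK ?gap_neq0.
Qed.

Definition hop_ratio D p r : C :=
  B p / B r * (gfun D p / gfun D r) / gap p r.

(** The sign of the hop compensates the sign of the Vandermonde product, which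
    leaves a rational function of the positions. *)
Lemma phi_hop p r D : p != r -> pocc r D -> ~~ pocc p D ->
  sgc r D * sgc p (tog r D) * phi (tog p (tog r D)) = phi D * hop_ratio D p r.
Proof.
move=> h hr hp; rewrite -mulrA phi_tog pocc_tog (negbTE hp) (negbTE h) /=.
rewrite mulrA phi_tog hr exprN1 expr1z gfun_tog_ne // /hop_ratio invfM.
by ring.
Qed.

End Coloured.

(** * The ratio of the weights of two states that differ by a hop *)

(** The coefficient of Lagrange's interpolation formula in the top degree. *)
Lemma lagrange_top (C : fieldType) (T : eqType) (Y : seq T) (x : T -> C) (f : {poly C}) :
  uniq Y -> {in Y &, injective x} -> (size f <= size Y)%N ->
  \sum_(p <- Y) f.[x p] / \prod_(y <- Y | y != p) (x p - x y) = f`_(size Y).-1.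
Proof.
move=> uY xi sf.
pose w p := \prod_(y <- Y | y != p) (x p - x y).
pose ell p := \prod_(y <- rem p Y) ('X - (x y)%:P).
have w0 p : p \in Y -> w p != 0.
  move=> hp; rewrite /w -big_filter prodf_seq_neq0; apply/allP => y.
  rewrite mem_filter => /andP[h hy] /=; rewrite subr_eq0.
  by apply: contra h => /eqP/xi ->.
have ell_prod p : ell p = \prod_(y <- Y | y != p) ('X - (x y)%:P).
  by rewrite /ell rem_filter // big_filter; apply: eq_bigl => y.
have ell_eq p : (ell p).[x p] = w p.
  rewrite ell_prod horner_prod; apply: eq_bigr => y _.
  by rewrite !hornerE.
have ell_ne p y : y \in Y -> y != p -> (ell p).[x y] = 0.
  move=> hy hyp; rewrite /ell horner_prod (big_rem y) /=; last first.
    by rewrite mem_rem_uniq // inE hyp.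
  by rewrite !hornerE subrr mul0r.
have sell p : p \in Y -> size (ell p) = size Y.
  by move=> hp; rewrite size_prod_XsubC size_rem // prednK //; case: (Y) hp.
pose L := \sum_(p <- Y) (f.[x p] / w p) *: ell p.
have Lp p : p \in Y -> L.[x p] = f.[x p].
  move=> hp; rewrite /L horner_sum (bigD1_seq p) //= big_seq_cond big1 ?addr0; last first.
    by move=> r /andP[hr hrp]; rewrite hornerZ ell_ne ?mulr0 // eq_sym.
  by rewrite hornerZ ell_eq divfK ?w0.
have EL : f = L.
  apply/eqP; rewrite -subr_eq0; apply/negPn/negP => hne.
  have := max_poly_roots hne (rs := map x Y) _ _.
  rewrite map_inj_in_uniq // uY size_map => /(_ _ isT) h.
  have : (size Y < size (f - L)%R)%N.
    by apply: h; apply/allP => y /mapP[p hp ->]; rewrite rootE !hornerE Lp // subrr.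
  rewrite ltnNge => /negP; apply.
  rewrite (leq_trans (size_polyD _ _)) // geq_max sf size_polyN.
  rewrite (leq_trans (size_sum _ _ _)) //; apply/bigmax_leqP_seq => p hp _.
  by rewrite (leq_trans (size_scale_leq _ _)) // sell.
rewrite {2}EL /L coef_sum; apply: eq_big_seq => p hp.
have /monicP : ell p \is monic by apply: monic_prod_XsubC.
by rewrite coefZ lead_coefE sell // => ->; rewrite mulr1.
Qed.

Lemma prod_delta (R : comPzRingType) (T : eqType) (s : seq T) (x : T) (F : T -> R) :
  uniq s -> \prod_(m <- s) (if m == x then F m else 1) = if x \in s then F x else 1.
Proof.
move=> us; case: (boolP (x \in s)) => h; last first.
  by rewrite big_seq big1 // => m hm; case: eqP hm h => // -> ->.
rewrite (bigD1_seq x) //= eqxx big1 ?mulr1 // => m /negbTE ->.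
by [].
Qed.

Section Ratio.
Variables (C : fieldType) (s : C) (N : nat) (u : 'I_N -> C) (z : C).
Hypotheses (hs : s != 0) (hu : forall i, u i != 0).
Hypothesis hsn : forall n : nat, (0 < n)%N -> s ^+ n != 1.
Hypothesis xinj : injective (place s u).
Notation pos := ('I_N * int)%type.
Notation cstate := {fset pos}.
Implicit Types (p r : pos) (D : cstate) (i j : 'I_N).

Notation x := (place s u).
Notation gap := (gap x).
Notation U := (\prod_(i < N) u i).

Definition shift (b : int) p : pos := (p.1, p.2 + b).

(** A shift by b multiplies all positions by q^(-b), so that products over a
    state and over its shift share their factors up to powers of q. *)
Lemma x_shift b p : x (shift b p) = s ^ (- 2 * b) * x p.
Proof.
rewrite /place /shift /= [RHS]mulrCA -expfzDr //; congr (_ * s ^ _); lia.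
Qed.

Lemma x_neq0 p : x p != 0.
Proof. by rewrite mulf_neq0 ?expfz_neq0. Qed.

Lemma shift_eq b p r : (shift (- b) p == r) = (p == shift b r).
Proof.
case: p r => [i m] [j m']; rewrite /shift !xpair_eqE /=; congr (_ && _); lia.
Qed.

Lemma gap_shift (b : int) p r :
  gap (shift (- b) p) r = (if p == shift b r then 1 else s ^ (2 * b)) * gap p (shift b r).
Proof.
rewrite /gap shift_eq; case: (eqVneq p (shift b r)) => [_|_]; first by rewrite mul1r.
rewrite !x_shift mulrBr [s ^ _ * (s ^ _ * _)]mulrA -expfzDr //.
have -> : - 2 * - b = 2 * b by lia.
have -> : 2 * b + - 2 * b = 0 by lia.
by rewrite expr0z mul1r.
Qed.

(** Neutrality makes the powers of q from the individual shifts cancel, except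
    for the self-interaction. *)
Lemma gfun_shift D (b : int) p : tcharge D = 0 ->
  pocc (shift (- b) p) D ->
  gfun x D (shift (- b) p) =
  (if shift (- b) p \in D then s ^ (- 2 * b) else 1) * \prod_(r <- D) gap p (shift b r) ^ sgp r.
Proof.
move=> hD; rewrite /pocc /gfun => ho.
under eq_bigr => r _ do rewrite gap_shift expfzMl.
rewrite big_split /=; congr (_ * _).
set a := shift (- b) p.
have E : (\prod_(r <- D) (if p == shift b r then 1 else s ^ (2 * b)) ^ sgp r) *
   (\prod_(r <- D) (if r == a then (s ^ (2 * b)) ^ sgp r else 1)) = 1.
  rewrite -big_split /=.
  transitivity (\prod_(r <- D) (s ^ (2 * b)) ^ sgp r).
    apply: eq_bigr => r _; rewrite -shift_eq -/a eq_sym.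
    by case: eqP => _; rewrite ?exp1rz ?mul1r ?mulr1.
  rewrite -(big_morph (fun e : int => (s ^ (2 * b)) ^ e) (op1 := *%R) (id1 := 1) (id2 := 0) (op2 := +%R)).
  - by rewrite -/(tcharge D) hD expr0z.
  - by move=> e e'; rewrite expfzDr // expfz_neq0.
  by rewrite expr0z.
rewrite prod_delta ?fset_uniq // in E.
move: E; case: (boolP (a \in D)) => ha; last by rewrite mulr1.
move: ho; rewrite -/a ha addbT => /negbTE ho; rewrite /sgp ho expr1z => E.
apply: (mulIf (expfz_neq0 (2 * b) hs)); rewrite E -expfzDr //.
have -> : - 2 * b + 2 * b = 0 by lia.
by rewrite expr0z.
Qed.

(** The two exceptional factors, at nonpositive modes and at the
    self-interaction, combine to a constant power of q on the sea. *)
Lemma regular_prod (b : nat) (m : int) :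
  \prod_(t < b) ((if m - t%:Z <= 0 then s ^ 2 else 1) * (if m == t%:Z then s ^ (2 * t%:Z) else 1))
  = (if m < b%:Z then s ^ (2 * b%:Z) else 1).
Proof.
elim: b => [|b IH]; first by rewrite big_ord0 mulr0 expr0z if_same.
have e : s ^ (2 * b.+1%:Z) = s ^ (2 * b%:Z) * s ^ 2.
  by rewrite -expfzDr //; congr (s ^ _); lia.
rewrite big_ord_recr /= IH e; case: (eqVneq m b%:Z) => [->|h2].
  rewrite ltxx subrr lexx mul1r mulrC.
  by rewrite (_ : b%:Z < b.+1%:Z) //; lia.
rewrite mulr1; case: (ltrP m b%:Z) => h3.
  rewrite (_ : m - b%:Z <= 0); last by lia.
  by rewrite (_ : m < b.+1%:Z) //; lia.
rewrite (_ : (m - b%:Z <= 0) = false); last by lia.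
by rewrite mul1r (_ : (m < b.+1%:Z) = false) //; lia.
Qed.

Lemma prod_powers (b : nat) :
  \prod_(t < b) s ^ (2 * t%:Z) = s ^ (b%:Z * (b%:Z - 1)).
Proof.
elim: b => [|b IH]; first by rewrite big_ord0 mul0r expr0z.
by rewrite big_ord_recr /= IH -expfzDr //; congr (s ^ _); lia.
Qed.

Lemma prod_colour (Q : C) i (m t : int) : Q != 0 ->
  \prod_j (if (i, m) == (j, t) then 1 else Q) = (if m == t then Q^-1 else 1) * Q ^+ N.
Proof.
move=> hQ; rewrite (bigD1 i) //= xpair_eqE eqxx /=.
have -> : \prod_(j | j != i) (if (i, m) == (j, t) then 1 else Q) = Q ^+ N.-1.
  rewrite -[N in N.-1]card_ord -(cardC1 i) -prodr_const; apply: eq_bigr => j hj.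
  by rewrite xpair_eqE eq_sym (negbTE hj).
have -> : Q ^+ N = Q * Q ^+ N.-1.
  by rewrite -exprS prednK //; case: (N) i => // -[].
by case: eqP => _; rewrite ?mul1r ?mulKf.
Qed.

Definition kap : C := z * s^-1 * (-1) ^+ N * U * s ^ (- 2 * N%:Z).

(** The ratio of the one-body factors of neighbouring modes; up to constants
    it is the inverse of the interaction with the modes 0 of all colours,
    which is what a shift of the sea by one step produces. *)
Definition onebody_ratio i (m : int) : C :=
  kap * (if m <= 0 then s ^ 2 else 1) / \prod_j gap (i, m) (j, 0).

Lemma onebody_ratio_prod (b : nat) i m :
  \prod_(t < b) onebody_ratio i (m - t%:Z) =
  kap ^+ b * (if m < b%:Z then s ^ (2 * b%:Z) else 1) * s ^ (- (N%:Z * (b%:Z * (b%:Z - 1))))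
   / \prod_(t < b) \prod_j gap (i, m) (j, t%:Z).
Proof.
have E (t : 'I_b) : onebody_ratio i (m - t%:Z) = kap *
    ((if m - t%:Z <= 0 then s ^ 2 else 1) * (if m == t%:Z then s ^ (2 * t%:Z) else 1)) *
    ((s ^ (2 * t%:Z)) ^ (- N%:Z)) * (\prod_j gap (i, m) (j, t%:Z))^-1.
  rewrite /onebody_ratio; have -> : (i, m - t%:Z) = shift (- t%:Z) (i, m) by [].
  under eq_bigr => j _ do rewrite gap_shift /shift /= add0r.
  have h0 : s ^ (2 * t%:Z) != 0 by rewrite expfz_neq0.
  rewrite big_split /= prod_colour // -exprnN !invfM.
  move: (s ^ (2 * t%:Z)) (if m - t%:Z <= 0 then s ^ 2 else 1) kap (\prod_j gap (i, m) (j, t%:Z)).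
  move=> Q a k P; case: eqP => _; rewrite ?invrK ?invr1 ?mulr1 ?mul1r.
    by rewrite !mulrA.
  by rewrite !mulrA.
under eq_bigr => t _ do rewrite E.
rewrite 3!big_split /= regular_prod prodr_const card_ord prodfV; congr (_ * _ * _ * _).
rewrite -(big_morph (fun y => y ^ (- N%:Z)) (fun y w => expfzMl y w _) (exp1rz _ _)).
by rewrite prod_powers exprz_exp; congr (s ^ _); lia.
Qed.

Hypothesis hz : z != 0.

Lemma U_neq0 : U != 0.
Proof. by apply/prodf_neq0 => i _; exact: hu. Qed.

Lemma kap_neq0 : kap != 0.
Proof.
rewrite /kap !mulf_neq0 ?invr_eq0 ?expfz_neq0 ?U_neq0 //.
by rewrite expf_neq0 // oppr_eq0 oner_eq0.
Qed.

Lemma onebody_ratio_neq0 i m : onebody_ratio i m != 0.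
Proof.
have h : (if m <= 0 then s ^ 2 else 1) != 0.
  by case: ifP => _; [exact: expfz_neq0 | exact: oner_neq0].
rewrite /onebody_ratio mulf_neq0 ?(mulf_neq0 kap_neq0 h) // invr_eq0.
by apply/prodf_neq0 => j _; exact: gap_neq0.
Qed.

(** Solves [onebody (i, m) = onebody_ratio i m * onebody (i, m - 1)] with
    value 1 at m = 0. Both recursion directions are needed, for the particles
    and for the holes. *)
Definition onebody p : C :=
  match p.2 with
  | Posz n => \prod_(t < n) onebody_ratio p.1 t.+1
  | Negz n => \prod_(t < n.+1) (onebody_ratio p.1 (- t%:Z))^-1
  end.

Lemma onebody_neq0 p : onebody p != 0.
Proof.
case: p => i [n|n]; rewrite /onebody /=; apply/prodf_neq0 => t _; rewrite ?invr_eq0; exact: onebody_ratio_neq0.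
Qed.

Lemma onebody_step i m : onebody (i, m) = onebody_ratio i m * onebody (i, m - 1).
Proof.
case: m => [[|n]|n].
- rewrite (_ : Posz 0 - 1 = Negz 0) // /onebody /= big_ord0 big_ord1 oppr0.
  by rewrite mulfV // onebody_ratio_neq0.
- rewrite (_ : n.+1%:Z - 1 = n%:Z); last by lia.
  by rewrite /onebody /= big_ord_recr /= mulrC.
rewrite (_ : Negz n - 1 = Negz n.+1); last by lia.
rewrite /onebody /= [in RHS]big_ord_recr /= NegzE mulrCA mulfV ?mulr1 //.
exact: onebody_ratio_neq0.
Qed.

Lemma onebody_steps (b : nat) i m :
  onebody (i, m) = (\prod_(t < b) onebody_ratio i (m - t%:Z)) * onebody (i, m - b%:Z).
Proof.
elim: b => [|b IH]; first by rewrite big_ord0 mul1r subr0.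
rewrite IH big_ord_recr /= -mulrA; congr (_ * _).
rewrite onebody_step; congr (_ * onebody (_, _)); lia.
Qed.

(** The quotient of the products of g over [blocked] and over [targets] (see
    [grid_balance]), written through the elements of [D]: the first factor
    accounts for the shift of the sea. *)
Definition shift_prod D (b : nat) (g : pos -> C) : C :=
  (\prod_(t < b) \prod_j g (j, t%:Z))^-1 *
  \prod_(r <- D) (g r ^ sgp r * (g (shift b%:Z r) ^ sgp r)^-1).

(** The constant that a hop of length b contributes whatever the state and the
    mode. *)
Definition hop_const (b : nat) : C :=
  kap ^+ b * s ^ (2 * b%:Z) * s ^ (- (N%:Z * (b%:Z * (b%:Z - 1)))) / (1 - s ^ (2 * b%:Z)).

(** The one-body factors contribute the shift of the sea, [gfun] that of the
    particles and holes; together they form [shift_prod]. *)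
Lemma hop_ratioE D (b : nat) p : (0 < b)%N -> tcharge D = 0 ->
  pocc (shift (- b%:Z) p) D ->
  hop_ratio x onebody D p (shift (- b%:Z) p) = hop_const b / x p * shift_prod D b (gap p).
Proof.
case: p => i m hb hD ho.
have h1 : 1 - s ^ (2 * b%:Z) != 0 by rewrite subr_eq0 eq_sym exprz_neq1 //; lia.
rewrite /hop_ratio gfun_shift //.
have -> : gap (i, m) (shift (- b%:Z) (i, m)) = x (i, m) * (1 - s ^ (2 * b%:Z)).
  rewrite /gap ifF; last first.
    by rewrite eq_sym shift_eq /shift xpair_eqE /=; lia.
  have e : - 2 * - b%:Z = 2 * b%:Z by lia.
  by rewrite x_shift e mulrBr mulr1 [x _ * s ^ _]mulrC.
rewrite {1}(onebody_steps b) {1}/shift /= mulfK ?onebody_neq0 // onebody_ratio_prod.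
rewrite /shift_prod big_split /= prodfV /gfun.
(* The hypothesis makes exactly one of the two conditions responsible: m - b
   is either in the sea or an added particle. *)
have Eq : (if m < b%:Z then s ^ (2 * b%:Z) else 1) *
   (if shift (- b%:Z) (i, m) \in D then s ^ (- 2 * b%:Z) else 1)^-1 = s ^ (2 * b%:Z).
  move: ho; rewrite /pocc /=.
  case: (boolP (_ \in D)) => _ /=.
    rewrite addbT -leNgt => h; rewrite (_ : (m < b%:Z) = false); last by lia.
    by rewrite mul1r invr_expz; congr (s ^ _); lia.
  by rewrite addbF => h; rewrite (_ : m < b%:Z) ?invr1 ?mulr1 //; lia.
have -> : hop_const b = kap ^+ b * ((if m < b%:Z then s ^ (2 * b%:Z) else 1) *
   (if shift (- b%:Z) (i, m) \in D then s ^ (- 2 * b%:Z) else 1)^-1) *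
   s ^ (- (N%:Z * (b%:Z * (b%:Z - 1)))) / (1 - s ^ (2 * b%:Z)) by rewrite /hop_const Eq.
rewrite /shift /=.
move: (\prod_(t < b) _) (\prod_(r <- D) gap _ _ ^ _) (\prod_(r <- D) gap _ _ ^ _) => P1 P2 P3.
move: (1 - _) (kap ^+ b) (x (i, m)) (s ^ - _) => Q1 Q2 Q3 Q4.
move: (if m < b%:Z then _ else _) (if _ \in D then _ else _) => Q5 Q6.
rewrite !invfM; ring.
Qed.

End Ratio.

(** * The interpolation sum *)

Section WhitSum.
Variables (C : fieldType) (s : C) (N : nat) (u : 'I_N -> C) (z : C).
Hypotheses (hs : s != 0) (hu : forall i, u i != 0).
Hypothesis hsn : forall n : nat, (0 < n)%N -> s ^+ n != 1.
Hypothesis xinj : injective (place s u).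
Notation pos := ('I_N * int)%type.
Notation cstate := {fset pos}.
Implicit Types (p r : pos) (D : cstate) (i j : 'I_N).
Notation x := (place s u).
Notation gap := (gap x).
Notation U := (\prod_(i < N) u i).
Notation shift := (@shift N).
Notation hop_const := (hop_const s u z).
Notation kap := (kap s u z).

Definition grid n : seq pos := [seq (i, m) | i <- enum 'I_N, m <- win n].

Lemma mem_grid n p : (p \in grid n) = (p.2 \in win n).
Proof.
case: p => i m; apply/allpairsP/idP => [[[j l] [_ h [_ ->]]] //|h].
by exists (i, m); rewrite mem_enum.
Qed.

Lemma grid_uniq n : uniq (grid n).
Proof. by apply: allpairs_uniq; rewrite ?enum_uniq ?win_uniq // => -[a b] [c d]. Qed.

(** The modes to which a hop of length b can lead. *)
Definition targets D (b : nat) n := [seq p <- grid n | ~~ pocc p D && pocc (shift (- b%:Z) p) D].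
(** Together with [targets], the symmetric difference of the state and its
    shift by b. *)
Definition blocked D (b : nat) n := [seq p <- grid n | pocc p D && ~~ pocc (shift (- b%:Z) p) D].

Definition hole p : int := (p.2 < 0)%R%:R.

Lemma pocc_hole p D : (pocc p D)%:R = hole p + (p \in D)%:R * sgp p :> int.
Proof. by rewrite /pocc /hole /sgp; case: (p.2 < 0); case: (p \in D). Qed.

(** Both sides are products over all modes with exponent the difference of the
    occupation numbers of p and p - b; the occupation number is the indicator
    of the sea corrected by a charge on the elements of [D]. *)
Lemma grid_balance (g : pos -> C) D (b n : nat) : (forall p, g p != 0) ->
  (b <= n)%N -> (forall p, p \in D -> (absz p.2 + b < n)%N) ->
  (\prod_(p <- blocked D b n) g p) / \prod_(p <- targets D b n) g p = shift_prod D b g.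
Proof.
move=> g0 hbn hD.
have -> : (\prod_(p <- blocked D b n) g p) / \prod_(p <- targets D b n) g p =
   \prod_(p <- grid n) g p ^ ((pocc p D)%:R - (pocc (shift (- b%:Z) p) D)%:R : int).
  rewrite /blocked /targets !big_filter big_mkcond [X in _ / X]big_mkcond /= -prodfV -big_split /=.
  apply: eq_bigr => p _; case: (pocc p D); case: (pocc _ D) => /=;
    rewrite ?subrr ?subr0 ?sub0r ?expr0z ?expr1z ?exprN1 ?invr1 ?mulr1 ?mul1r //.
have E p : g p ^ ((pocc p D)%:R - (pocc (shift (- b%:Z) p) D)%:R : int) =
   (if 0 <= p.2 < b%:Z then (g p)^-1 else 1) *
   ((if p \in D then g p ^ sgp p else 1) *
    (if shift (- b%:Z) p \in D then (g p ^ sgp (shift (- b%:Z) p))^-1 else 1)).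
  rewrite !pocc_hole.
  have -> : (if 0 <= p.2 < b%:Z then (g p)^-1 else 1) = g p ^ (hole p - hole (shift (- b%:Z) p)).
    rewrite /hole /shift /=; case: (ltrP p.2 0) => h1.
      by rewrite /= (_ : p.2 + _ < 0) ?subrr ?expr0z //; lia.
    case: (ltrP p.2 b%:Z) => h2.
      by rewrite (_ : p.2 + _ < 0) ?sub0r ?exprN1 //; lia.
    by rewrite (_ : (p.2 + _ < 0) = false) ?subrr ?expr0z //; lia.
  have -> : (if p \in D then g p ^ sgp p else 1) = g p ^ ((p \in D)%:R * sgp p).
    by case: (p \in D); rewrite ?mul1r ?mul0r ?expr0z.
  have -> : (if shift (- b%:Z) p \in D then (g p ^ sgp (shift (- b%:Z) p))^-1 else 1) =
     g p ^ (- ((shift (- b%:Z) p \in D)%:R * sgp (shift (- b%:Z) p))).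
    by case: (_ \in D); rewrite ?mul1r ?mul0r ?oppr0 ?expr0z // invr_expz.
  rewrite -!expfzDr //; congr (g p ^ _); ring.
under eq_bigr => p _ do rewrite E.
rewrite 2!big_split /shift_prod big_split /=; congr (_ * (_ * _)).
- rewrite -prodfV; under [RHS]eq_bigr => t _ do rewrite -prodfV.
  rewrite exchange_big /= -big_mkcond /=.
  rewrite pair_big /= -big_filter.
  rewrite -(big_map (fun q : 'I_N * 'I_b => ((q.1, q.2%:Z) : pos)) xpredT (fun p => (g p)^-1)).
  apply: perm_big; apply: uniq_perm.
  + by rewrite filter_uniq // grid_uniq.
  + rewrite map_inj_uniq ?index_enum_uniq // => -[a c] [a' c'] [-> /= h].
    by congr (_, _); apply/val_inj.
  move=> [i m]; rewrite mem_filter mem_grid /= mem_win; apply/idP/mapP => [h|].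
    have hm : (absz m < b)%N by lia.
    exists (i, Ordinal hm); rewrite ?mem_index_enum //=; congr (_, _); lia.
  by case=> -[j t] _ [_ ->] /=; have := ltn_ord t; lia.
- rewrite -big_mkcond -big_filter; apply: perm_big; apply: uniq_perm.
  + by rewrite filter_uniq // grid_uniq.
  + exact: fset_uniq.
  move=> p; rewrite mem_filter mem_grid mem_win andbC.
  case: (boolP (p \in D)) => h; last by rewrite andbF.
  by have := hD _ h; lia.
rewrite -big_mkcond -big_filter.
under [RHS]eq_bigr => r _.
  have e : r = shift (- b%:Z) (shift b%:Z r) by case: (r) => i m; rewrite /shift /= addrK.
  rewrite [in sgp r]e; over.
rewrite -(big_map (shift b%:Z) xpredT (fun p => (g p ^ sgp (shift (- b%:Z) p))^-1)).
apply: perm_big; apply: uniq_perm.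
- by rewrite filter_uniq // grid_uniq.
- by rewrite map_inj_uniq ?fset_uniq // => -[a c] [a' c']; rewrite /shift /= => -[-> /addIr ->].
move=> p; rewrite mem_filter mem_grid mem_win; apply/andP/mapP => [[h _]|[r hr ->]].
  exists (shift (- b%:Z) p) => //; case: (p) => i m; rewrite /shift /= subrK //.
have e : shift (- b%:Z) (shift b%:Z r) = r by case: (r) => i m; rewrite /shift /= addrK.
by rewrite e hr; split=> //; have := hD _ hr; rewrite /shift /=; lia.
Qed.

Lemma prod_neg_place b : \prod_(t < b) \prod_j - x (j, t%:Z) =
  ((-1) ^+ N * U) ^+ b * s ^ (- (N%:Z * (b%:Z * (b%:Z + 1)))).
Proof.
transitivity (\prod_(t < b) ((-1) ^+ N * U * (s ^ (- (2 * t%:Z + 2))) ^+ N)).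
  apply: eq_bigr => t _; rewrite prodrN card_ord -mulrA; congr (_ * _).
  rewrite /place big_split /= prodr_const card_ord; congr (_ * _ ^+ _).
  congr (s ^ _); lia.
rewrite big_split /= prodr_const card_ord; congr (_ * _).
have -> : \prod_(t < b) (s ^ (- (2 * t%:Z + 2))) ^+ N = (\prod_(t < b) (s ^ (- (2 * t%:Z + 2)))) ^+ N.
  by rewrite prodrXl.
have -> : \prod_(t < b) (s ^ (- (2 * t%:Z + 2))) = s ^ (- (b%:Z * (b%:Z + 1))).
  elim: (b) => [|c IH]; first by rewrite big_ord0 mul0r expr0z.
  by rewrite big_ord_recr /= IH -expfzDr //; congr (s ^ _); lia.
by rewrite exprnP exprz_exp; congr (s ^ _); lia.
Qed.

Lemma hop_constE b : hop_const b = z ^+ b * ((-1) ^+ N * U) ^+ b * s ^ (b%:Z - N%:Z * (b%:Z * (b%:Z + 1))) /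
  (1 - s ^ (2 * b%:Z)).
Proof.
rewrite /hop_const /kap; congr (_ / _).
have -> : z / s * (-1) ^+ N * U * s ^ (- 2 * N%:Z) =
  z * ((-1) ^+ N * U) * s ^ (- 1 - 2 * N%:Z).
  have -> : s ^ (- 1 - 2 * N%:Z) = s^-1 * s ^ (- 2 * N%:Z).
    by rewrite -[s^-1]exprN1 -expfzDr //; congr (s ^ _); lia.
  by ring.
move: ((-1) ^+ N * U) => V; rewrite !exprMn -!mulrA; do 2 congr (_ * _).
by rewrite exprnP exprz_exp -!expfzDr //; congr (s ^ _); lia.
Qed.

Section Fixed.
Variables (D : cstate) (b n : nat).
Hypotheses (hb : (0 < b)%N) (hbn : (b <= n)%N)
  (hDn : forall p, p \in D -> (absz p.2 + b < n)%N) (hD0 : tcharge D = 0).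
Notation Ys := (targets D b n).
Notation Zs := (blocked D b n).

(** When g is multiplied by a constant under the shift, the contribution of a
    neutral state is trivial and only that of the sea remains. *)
Lemma ratio_charge (g : pos -> C) (a : C) : a != 0 -> (forall p, g p != 0) ->
  (forall p, g (shift b%:Z p) = a^-1 * g p) ->
  (\prod_(p <- Zs) g p) / \prod_(p <- Ys) g p = (\prod_(t < b) \prod_j g (j, t%:Z))^-1.
Proof.
move=> ha g0 hg; rewrite grid_balance // /shift_prod [X in _ * X](_ : _ = 1) ?mulr1 //.
transitivity (\prod_(r <- D) a ^ sgp r).
  apply: eq_bigr => r _; rewrite hg expfzMl invfM mulrCA mulfV ?expfz_neq0 //.
  by rewrite mulr1 exprz_inv invr_expz opprK.
rewrite -(big_morph (fun e : int => a ^ e) (op1 := *%R) (id1 := 1) (id2 := 0) (op2 := +%R)).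
- by rewrite -/(tcharge D) hD0 expr0z.
- by move=> e e'; rewrite expfzDr.
by rewrite expr0z.
Qed.

(** Apply [ratio_charge] to the constant function s and compare exponents; s
    is not a root of unity. *)
Lemma size_targets : size Ys = (size Zs + N * b)%N.
Proof.
have := @ratio_charge (fun=> s) 1 (oner_neq0 _) (fun=> hs) (fun=> _).
rewrite invr1 mul1r => /(_ (fun=> erefl)).
have pc (l : seq pos) : \prod_(p <- l) s = s ^+ size l.
  by rewrite big_const_seq count_predT iter_mulr_1.
rewrite /= !pc; under eq_bigr => t _ do rewrite prodr_const card_ord.
rewrite prodr_const card_ord -exprM => h.
have h2 : s ^ ((size Zs)%:Z - (size Ys)%:Z + (N * b)%:Z) = 1.
  rewrite !expfzDr // -invr_expz h mulVf // expf_neq0 //.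
apply/eqP; apply: contraT => hne; have := exprz_neq1 hsn _ (k := (size Zs)%:Z - (size Ys)%:Z + (N * b)%:Z).
by rewrite h2 eqxx => /(_ ltac:(lia)).
Qed.

Lemma targets_uniq : uniq Ys. Proof. by rewrite filter_uniq ?grid_uniq. Qed.

Definition numer : {poly C} := \prod_(r <- Zs) ('X - (x r)%:P).

Lemma size_numer : size numer = (size Zs).+1.
Proof. by rewrite size_prod_XsubC. Qed.

(** At a target p, the products over blocked modes and over the other targets
    are the numerator and the denominator of Lagrange's formula. *)
Lemma shift_prod_target p : p \in Ys ->
  shift_prod D b (gap p) = numer.[x p] / \prod_(y <- Ys | y != p) (x p - x y).
Proof.
move=> hp; rewrite -(grid_balance (n := n)) //; last by move=> r; exact: gap_neq0.
congr (_ / _).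
  rewrite /numer horner_prod; apply: eq_big_seq => r hr.
  rewrite !hornerE /gap; case: eqP => // e; move: hp hr.
  by rewrite !mem_filter e => /andP[/andP[/negbTE ->]].
rewrite [RHS]big_mkcond; apply: eq_bigr => y _.
by rewrite /gap eq_sym; case: eqP.
Qed.

(** The numerator has degree k plus the number of blocked modes. As there are
    N b more targets than blocked modes, this is the top degree of
    interpolation only for k + 1 = N b. *)
Lemma sum_targets_pos k :  (k.+1 <= N * b)%N ->
  \sum_(p <- Ys) x p ^+ k * shift_prod D b (gap p) = (k.+1 == N * b)%N%:R.
Proof.
move=> hk.
have h := lagrange_top (f := 'X^k * numer) targets_uniq (in2W xinj).
have sf : size ('X^k * numer) = (size Zs + k.+1)%N.
  by rewrite size_monicM ?monicXn ?monic_neq0 ?monic_prod_XsubC // size_polyXn size_numer; lia.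
rewrite (eq_big_seq (fun p => ('X^k * numer).[x p] / \prod_(y <- Ys | y != p) (x p - x y))); last first.
  by move=> p hp; rewrite shift_prod_target // hornerM hornerXn mulrA.
rewrite h; last by rewrite sf size_targets leq_add2l.
case: eqP => e.
  have /monicP : 'X^k * numer \is monic by rewrite monicMl ?monicXn ?monic_prod_XsubC.
  by rewrite lead_coefE sf size_targets -e.
by rewrite nth_default // sf size_targets; lia.
Qed.

Hypothesis hN : (0 < N)%N.

(** Adding the node 0 to the targets turns the factor 1 / x_p into one more
    linear factor of the denominator. The full interpolation sum then vanishes
    for degree reasons, and the right-hand side is minus the term of the node
    0. *)
Lemma sum_targets_inv :
  \sum_(p <- Ys) (x p)^-1 * shift_prod D b (gap p) = - ((\prod_(p <- Zs) - x p) / \prod_(p <- Ys) - x p).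
Proof.
(* None is the added node 0. *)
pose y (o : option pos) := if o is Some p then x p else 0.
have hy : {in None :: map some Ys &, injective y}.
  move=> [p|] [r|] _ _ //= e; first by rewrite (xinj e).
  - by have := x_neq0 hs hu p; rewrite e eqxx.
  by have := x_neq0 hs hu r; rewrite -e eqxx.
have uy : uniq (None :: map some Ys).
  rewrite /= map_inj_uniq ?targets_uniq ?andbT; first by apply/mapP => -[].
  by move=> ? ? [].
have := lagrange_top (f := numer) uy hy.
rewrite /= size_map nth_default; last by rewrite size_numer size_targets; have := muln_gt0 N b; lia.
rewrite size_numer => /(_ _)/wrap[]; first by rewrite size_targets; lia.
rewrite big_cons big_map /= => h.
have {h} : \sum_(p <- Ys) (x p)^-1 * shift_prod D b (gap p) = 
  - (numer.[0] / \prod_(i <- None :: map some Ys | i != None) (0 - y i)).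
  apply/eqP; rewrite -addr_eq0 addrC -[X in _ == X]h; apply/eqP; congr (_ + _).
  apply: eq_big_seq => p hp; rewrite shift_prod_target // big_cons big_map /= subr0 mulrCA -invfM.
  by [].
move=> ->; congr (- (_ / _)).
  by rewrite /numer horner_prod; apply: eq_bigr => r _; rewrite !hornerE.
by rewrite big_cons big_map /=; apply: eq_bigr => r _; rewrite sub0r.
Qed.

Hypothesis hz : z != 0.
Notation chi := (chi s u z).

Lemma one_sub_neq0 : 1 - s ^ (2 * b%:Z) != 0.
Proof. by rewrite subr_eq0 eq_sym exprz_neq1 //; lia. Qed.

(** For k > 0 the sum is a top coefficient of an interpolation polynomial and
    vanishes unless k = N b; for k = 0 it is minus the term of the added node
    0. The two nonzero values are the eigenvalues of the Whittaker conditions.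
    *)
Lemma whit_sum (k : nat) : (k <= N * b)%N ->
  \sum_(p <- Ys) (s ^ b%:Z * x p) ^+ k * hop_ratio x (onebody s u z) D p (shift (- b%:Z) p) =
  chi k%:Z b%:Z.
Proof.
move=> hk.
have E p : p \in Ys -> hop_ratio x (onebody s u z) D p (shift (- b%:Z) p) =
    hop_const b * ((x p)^-1 * shift_prod D b (gap p)).
  rewrite mem_filter => /andP[/andP[_ h] _].
  by rewrite (hop_ratioE hs hu hsn xinj hz hb hD0 h) -mulrA.
rewrite (eq_big_seq (fun p => hop_const b * (s ^ b%:Z) ^+ k * (x p ^+ k * ((x p)^-1 * shift_prod D b (gap p))))); last first.
  by move=> p hp; rewrite E // exprMn; ring.
rewrite -big_distrr /=.
have d0 := one_sub_neq0.
have sb : s ^ b%:Z != 0 by rewrite expfz_neq0.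
have e2 : s ^ (2 * b%:Z) = s ^ b%:Z * s ^ b%:Z by rewrite -expfzDr //; congr (s ^ _); lia.
have eN : s ^ (- b%:Z) = (s ^ b%:Z)^-1 by rewrite invr_expz.
case: k hk => [|k] hk.
  rewrite /chi eqxx expr0 mulr1.
  under eq_bigr => p _ do rewrite mul1r.
  rewrite sum_targets_inv.
  have a0 : s ^ (2 * b%:Z) != 0 by rewrite expfz_neq0.
  have x0 p : - x p != 0 by rewrite oppr_eq0 x_neq0.
  have xs p : - x (shift b%:Z p) = (s ^ (2 * b%:Z))^-1 * - x p.
    by rewrite (x_shift u hs) mulrN invr_expz mulNr.
  rewrite (ratio_charge a0 x0 xs) prod_neg_place hop_constE.
  move: d0; rewrite expfzDr // eN -[z ^ b%:Z]exprnP e2.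
  move: (s ^ (- _)) (expfz_neq0 (- (N%:Z * (b%:Z * (b%:Z + 1)))) hs) => w hw.
  have : ((-1) ^+ N * U) ^+ b != 0.
    by rewrite expf_neq0 // mulf_neq0 ?expf_neq0 ?oppr_eq0 ?oner_eq0 ?U_neq0.
  move: (_ ^+ b) (z ^+ b) (s ^ b%:Z) sb => V Z sb hs' hV hd.
  have hd' : sb * sb - 1 != 0 by rewrite -opprB oppr_eq0.
  by field; rewrite hs' hd' hw hV hd.
rewrite (eq_bigr (fun p => x p ^+ k * shift_prod D b (gap p))); last first.
  by move=> p _; rewrite exprSr -mulrA mulVKf // x_neq0.
rewrite sum_targets_pos // /chi.
have -> : (k.+1%:Z == 0) = false by [].
have -> : (k.+1%:Z == N%:Z * b%:Z) = (k.+1 == N * b)%N by lia.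
case: eqP => e; last by rewrite mulr0.
have -> : (- s^-1) ^+ N * U * z = z * ((-1) ^+ N * U) * s ^ (- N%:Z).
  rewrite (exprNn s^-1) exprVn -exprnN; move: (s ^- N) => y; ring.
have -> : (s ^ b%:Z) ^+ k.+1 = s ^ (N%:Z * (b%:Z * b%:Z)).
  by rewrite exprnP exprz_exp; congr (s ^ _); lia.
rewrite mulr1 hop_constE -[X in _ = X / _]exprnP !exprMn.
have -> : (s ^ (- N%:Z)) ^+ b = s ^ (- b%:Z) * s ^ (b%:Z - N%:Z * (b%:Z * (b%:Z + 1))) *
    s ^ (N%:Z * (b%:Z * b%:Z)).
  by rewrite exprnP exprz_exp -!expfzDr //; congr (s ^ _); lia.
move: d0; rewrite eN e2.
move: (s ^ (b%:Z - _)) (s ^ (N%:Z * _)) (((-1) ^+ N) ^+ b * U ^+ b) => w w' V.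
move: (z ^+ b) (s ^ b%:Z) sb => Z sb hs' hd.
have hd' : sb * sb - 1 != 0 by rewrite -opprB oppr_eq0.
by field; rewrite hs' mulNr hd.
Qed.

End Fixed.
End WhitSum.

(** * Existence *)

Section Hops.
Variable N : nat.
Notation pos := ('I_N * int)%type.
Notation cstate := {fset pos}.
Implicit Types (p r : pos) (D : cstate) (i j : 'I_N) (m d : int).

Definition balanced D := [forall i, charge (slice_of i D) == 0].

(** The state from which a lowering hop of length b leads to [D]; an
    involution. *)
Definition thop (b : nat) i m D : cstate := tog (i, m) (tog (i, m - b%:Z) D).

Lemma thopK b i m D : thop b i m (thop b i m D) = D.
Proof. by rewrite /thop [tog _ (tog _ (tog _ _))]togC togK togK. Qed.

Lemma slice_thop b i m j D : (0 < b)%N ->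
  slice_of j (thop b i m D) = if i == j then hopd (m - b%:Z) m (slice_of j D) else slice_of j D.
Proof.
move=> hb; rewrite /thop !slice_tog /=; case: eqP => // _.
by rewrite /hopd (_ : (_ == _) = false) //; lia.
Qed.

Lemma abs_energy z (D : state) : z \in D -> (absz z)%:Z <= energy D.
Proof.
move=> h; rewrite /energy (big_rem z) //= lerDl; apply: sumr_ge0 => //.
Qed.

Lemma energy_ge0 (D : state) : 0 <= energy D.
Proof. by apply: sumr_ge0. Qed.

Lemma slice_energy i D : energy (slice_of i D) <= tenergy D.
Proof.
rewrite /tenergy (bigD1 i) //= lerDl; apply: sumr_ge0 => j _; exact: energy_ge0.
Qed.

Lemma abs_tenergy p D : p \in D -> (absz p.2)%:Z <= tenergy D.
Proof.
case: p => i m h; apply: le_trans (slice_energy i D).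
by apply: abs_energy; rewrite mem_slice.
Qed.

(** A neutral state of one colour has at least energy 1 if it is not empty:
    its elements cannot all be 0, as they have both signs of charge. *)
Lemma tenergy_eq0 D : tenergy D = 0 -> balanced D -> D = fset0.
Proof.
move=> h0 /forallP hb; apply/eqP/negPn/negP => /fset0Pn[[i m] hp].
have e z : z \in slice_of i D -> z = 0.
  rewrite mem_slice => /abs_tenergy /=; rewrite h0; lia.
have hD : slice_of i D = [fset 0].
  apply/fsetP => y; rewrite in_fset1; apply/idP/eqP => [/e //|->].
  by move: hp; rewrite -mem_slice => hm; move: (hm); rewrite (e _ hm).
by have := hb i; rewrite hD /charge big_seq_fset1.
Qed.

Lemma balanced_charge D : balanced D -> tcharge D = 0.
Proof.
by move=> /forallP h; rewrite tcharge_slices big1 // => i _; apply/eqP.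
Qed.

Variable C : fieldType.

Lemma balanced_thop b i m D : (0 < b)%N -> hopc C (m - b%:Z) m (slice_of i D) != 0 ->
  balanced (thop b i m D) = balanced D.
Proof.
move=> hb h; apply: eq_forallb => j; rewrite slice_thop //.
by case: (eqVneq i j) => [<-|//]; rewrite (charge_hopd h).
Qed.

Lemma tenergy_thop b i m D : (0 < b)%N -> hopc C (m - b%:Z) m (slice_of i D) != 0 ->
  tenergy (thop b i m D) = tenergy D + b%:Z.
Proof.
move=> hb h; rewrite /tenergy (bigD1 i) //= [in RHS](bigD1 i) //=.
rewrite slice_thop // eqxx (energy_hopd h).
rewrite (eq_bigr (fun j => energy (slice_of j D))); first by lia.
by move=> j hj; rewrite slice_thop // eq_sym (negbTE hj).
Qed.

(** All the states inside a finite window; those of energy d lie in every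
    window larger than d. *)
Definition stretch n : seq cstate := enum_fset (fpowerset [fset p in grid N n]).

Lemma mem_stretch n D : (D \in stretch n) = (D `<=` [fset p in grid N n]).
Proof. exact: fpowersetE. Qed.

Lemma stretch_uniq n : uniq (stretch n).
Proof. exact: fset_uniq. Qed.

Lemma tenergy_stretch n D : tenergy D < n%:Z -> D \in stretch n.
Proof.
move=> h; rewrite mem_stretch; apply/fsubsetP => p /abs_tenergy hp.
by rewrite in_fset_ mem_grid mem_win; lia.
Qed.

End Hops.

Section Existence.
Variables (C : fieldType) (s : C) (N : nat) (u : 'I_N -> C) (z : C).
Hypotheses (hs : s != 0) (hu : forall i, u i != 0) (hz : z != 0).
Hypothesis hsn : forall n : nat, (0 < n)%N -> s ^+ n != 1.
Hypothesis hchar : forall n : nat, n.+1%:R != 0 :> C.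
Hypothesis xinj : injective (place s u).
Hypothesis hN : (0 < N)%N.
Notation pos := ('I_N * int)%type.
Notation cstate := {fset pos}.
Implicit Types (p r : pos) (D : cstate) (i j : 'I_N) (m d : int).
Notation x := (place s u).
Notation phi := (phi x (onebody s u z)).
Notation chi := (chi s u z).

(** The coefficient of a given state in E_{k,b} W, as a sum over the hops that
    lead to it. *)
Lemma whit_hops D (b n k : nat) : (0 < b)%N -> (b <= n)%N -> (k <= N * b)%N ->
  (forall p, p \in D -> (absz p.2 + b < n)%N) -> tcharge D = 0 ->
  \sum_i \sum_(m <- win n) rho s (u i) b m ^+ k * hopc C (m - b%:Z) m (slice_of i D) *
     phi (thop b i m D) = chi k b * phi D.
Proof.
move=> hb hbn hk hDn hD0.
rewrite -(whit_sum hs hu hsn xinj hb hbn hDn hD0 hN hz hk) /targets big_filter.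
rewrite big_distrl /= /grid [RHS]big_mkcond big_allpairs_dep /= big_enum /=; apply: eq_bigr => i _.
apply: eq_bigr => m _; rewrite hopc_flat; last by lia.
rewrite rho_place // /thop; set r := (i, m - b%:Z).
have -> : shift (- b%:Z) (i, m) = r by [].
rewrite andbC; case: ifP => [/andP[h1 h2]|_]; last by rewrite mul0r mulr0 !mul0r.
rewrite mul1r -mulrA phi_hop //; first by rewrite mulrCA [phi D * _]mulrC !mulrA.
  by move=> p; exact: onebody_neq0.
by rewrite /r xpair_eqE eqxx /=; lia.
Qed.

Variable F : 'I_N -> diffq_action (fock C).
Hypothesis hF : forall i, fock_module s (u i) (F i).
Variable S : 'I_N -> state -> fock C.
Hypothesis HS : forall i (D : state), charge D = 0 -> matched s (u i) (F i) (S i D) (@delta C D).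
Notation E k l := (actE (tensor_action F) k l).

Definition product_state D : tensor_fock C N := tens (fun i => S i (slice_of i D)).

Definition weight d D : C := (balanced D && (tenergy D == d))%:R * phi D.

(** The component of degree d: neutral states in each colour, of total energy
    d, weighted by [phi]. The window only has to be large enough, by [wvecE]. *)
Definition wpart n d : tensor_fock C N := \sum_(D <- stretch N n) weight d D *: product_state D.

Definition wvec d := wpart (absz d).+1 d.

Lemma weight_supp n d D : d < n%:Z -> D \notin stretch N n -> weight d D = 0.
Proof.
move=> hd h; rewrite /weight; case: eqP => [e|_]; last by rewrite andbF mul0r.
by case/negP: h; apply: tenergy_stretch; rewrite e.
Qed.

Lemma wvecE n d : d < n%:Z -> wvec d = wpart n d.
Proof.
move=> hd; apply: eq_big_supp; try exact: stretch_uniq; move=> D _ h.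
  by rewrite (weight_supp hd h) scale0r.
by rewrite (weight_supp _ h) ?scale0r //; lia.
Qed.

Lemma E_product_state (b k n : nat) D : (0 < b)%N -> (b <= n)%N -> balanced D ->
  (forall p, p \in D -> (absz p.2 + b < n)%N) ->
  E k b (product_state D) =
  \sum_i \sum_(m <- win n) (rho s (u i) b m ^+ k * hopc C m (m - b%:Z) (slice_of i D))
    *: product_state (thop b i m D).
Proof.
move=> hb hbn /forallP hbal hD; rewrite /product_state (tE_tens hF); apply: eq_bigr => i _.
have hi : charge (slice_of i D) = 0 by apply/eqP.
rewrite (E_S hs (hu i) hsn hchar (hF i) (@HS i) (n := n) hi); last 2 first.
- have : (bound (slice_of i D) <= n - b)%N.
    by apply: bound_le => y; rewrite mem_slice => /hD /=; lia.
  by rewrite /=; lia.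
- by right; lia.
have -> : (b%:Z == 0) = false by lia.
rewrite mul0r scale0r addr0 tens_upd_sum; apply: eq_bigr => m _.
rewrite tens_updZ; congr (_ *: tens _); apply/funext => j.
rewrite /updf slice_thop // eq_sym; case: eqP => // <-.
by rewrite hopdC.
Qed.

(** Regroup the sum by the final state of each hop; [whit_hops] then gives the
    same scalar for every final state. *)
Lemma E_wvec (b k : nat) d : (0 < b)%N -> (k <= N * b)%N ->
  E k b (wvec (d + b%:Z)) = chi k b *: wvec d.
Proof.
move=> hb hk; (* Larger than the energies before and after, with room for a hop. *)
pose n := (absz d + b + b).+2.
have hd1 : d + b%:Z < n%:Z by rewrite /n; lia.
have hd2 : d < n%:Z by rewrite /n; lia.
rewrite (wvecE hd1) (wvecE hd2) /wpart (lin_sum (tE_linear F k b)).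
have L1 D : E k b (weight (d + b%:Z) D *: product_state D) =
   \sum_i \sum_(m <- win n) (weight (d + b%:Z) D * (rho s (u i) b m ^+ k * 
      hopc C m (m - b%:Z) (slice_of i D))) *: product_state (thop b i m D).
  rewrite (linZ (tE_linear F k b)); case: (boolP (balanced D && (tenergy D == d + b%:Z))) => h.
    case/andP: h => h1 /eqP h2; rewrite (@E_product_state b k n) //; last 2 first.
    - by rewrite /n; lia.
    - by move=> p /abs_tenergy; rewrite h2 /n; lia.
    rewrite scaler_sumr; apply: eq_bigr => i _; rewrite scaler_sumr; apply: eq_bigr => m _.
    by rewrite scalerA.
  rewrite /weight (negbTE h) mul0r scale0r big1 // => i _; rewrite big1 // => m _.
  by rewrite !mul0r scale0r.
under eq_bigr => D _ do rewrite L1.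
rewrite exchange_big /=; under eq_bigr => i _ do rewrite exchange_big /=.
have W1 i m D : weight (d + b%:Z) (thop b i m D) * (rho s (u i) b m ^+ k *
      hopc C m (m - b%:Z) (slice_of i (thop b i m D))) =
   (balanced D && (tenergy D == d))%:R * (rho s (u i) b m ^+ k *
      hopc C (m - b%:Z) m (slice_of i D) * phi (thop b i m D)).
  rewrite slice_thop // eqxx [hopd (m - b%:Z) m _]hopdC hopc_hopd /weight.
  case: (eqVneq (hopc C (m - b%:Z) m (slice_of i D)) 0) => [->|h]; first by rewrite !(mulr0, mul0r).
  rewrite (balanced_thop hb h) (tenergy_thop hb h) (inj_eq (addIr _)).
  by move: (phi _) (hopc _ _ _ _) (rho _ _ _ _) => a c r; ring.
have L2 i m : \sum_(D <- stretch N n) (weight (d + b%:Z) D * (rho s (u i) b m ^+ k * 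
      hopc C m (m - b%:Z) (slice_of i D))) *: product_state (thop b i m D) =
   \sum_(D <- stretch N n) ((balanced D && (tenergy D == d))%:R * (rho s (u i) b m ^+ k *
      hopc C (m - b%:Z) m (slice_of i D) * phi (thop b i m D))) *: product_state D.
  pose H D := (weight (d + b%:Z) (thop b i m D) * (rho s (u i) b m ^+ k *
      hopc C m (m - b%:Z) (slice_of i (thop b i m D)))) *: product_state D.
  transitivity (\sum_(D <- stretch N n) H (thop b i m D)).
    by apply: eq_bigr => D _; rewrite /H thopK.
  transitivity (\sum_(D <- stretch N n) H D); last by apply: eq_bigr => D _; rewrite /H W1.
  rewrite -(big_map (thop b i m) xpredT H); apply: eq_big_supp.
  - by rewrite map_inj_uniq ?stretch_uniq //; exact: can_inj (thopK b i m).
  - exact: stretch_uniq.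
  - move=> D _ h; rewrite /H W1; case: eqP => [e|_]; last by rewrite andbF mul0r scale0r.
    by case/negP: h; apply: tenergy_stretch; rewrite e.
  move=> D _ h; rewrite /H (weight_supp (n := n)) ?mul0r ?scale0r //.
  by apply: contra h => h; apply/mapP; exists (thop b i m D); rewrite ?thopK.
under eq_bigr => i _ do under eq_bigr => m _ do rewrite L2.
under eq_bigr => i _ do rewrite exchange_big /=.
rewrite exchange_big /= scaler_sumr; apply: eq_bigr => D _.
under eq_bigr => i _ do rewrite -scaler_suml -mulr_sumr.
rewrite -scaler_suml -mulr_sumr scalerA; congr (_ *: _).
rewrite /weight; case: (boolP (balanced D && (tenergy D == d))) => h; last by rewrite !mul0r mulr0.
case/andP: h => h1 /eqP h2; rewrite !mul1r whit_hops //.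
- by rewrite /n; lia.
- by move=> p /abs_tenergy; rewrite h2 /n; lia.
exact: balanced_charge.
Qed.

Lemma wvec_graded : graded_completion wvec.
Proof.
move=> d t; rewrite -mcoeff_neq0 /wvec /wpart mcoeff_sum => h.
have [D hD] : exists D, (weight d D *: product_state D)@_t != 0.
  have := h; rewrite big_seq; apply: contraNP => /forallNP hn.
  by apply/eqP; rewrite big1 // => D _; apply/eqP/negPn/negP/hn.
move: hD; rewrite mcoeffZ mcoeff_tens mulf_eq0 negb_or /weight.
case: (boolP (balanced D)) => hb; last by rewrite ?(andTb, andFb) mul0r eqxx.
case: (eqVneq (tenergy D) d) => [<-|_]; last by rewrite mul0r eqxx.
move=> /andP[_ /prodf_neq0 hp]; rewrite /tensor_deg /tenergy (big_morph Posz PoszD (erefl : Posz 0 = 0)).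
apply: eq_bigr => i _; apply: (S_homogeneous (hs) (hu i) hsn hchar (hF i) (@HS i)).
  by move/forallP: hb => /(_ i)/eqP.
exact: hp.
Qed.

Lemma wvec_vac : wvec 0 = tensor_vac C N.
Proof.
rewrite /wvec /wpart (big_fsetD1 fset0) /=; last by rewrite mem_stretch fsub0set.
rewrite [X in _ + X]big_seq [X in _ + X]big1 ?addr0; last first.
  move=> D; rewrite in_fsetD1 => /andP[hD _]; rewrite /weight.
  case: (boolP (balanced D)) => hb; last by rewrite ?(andTb, andFb) mul0r scale0r.
  case: eqP => [e|_]; last by rewrite ?(andTb, andFb) mul0r scale0r.
  by rewrite (tenergy_eq0 e hb) eqxx in hD.
have -> : weight 0 fset0 = 1.
  rewrite /weight /phi !big_seq_fset0 !mulr1.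
  have -> : balanced (fset0 : cstate) by apply/forallP => i; rewrite slice0 charge0.
  have -> : tenergy (fset0 : cstate) = 0 by rewrite /tenergy big1 // => i _; rewrite slice0 energy0.
  by [].
rewrite scale1r /product_state /tensor_vac -tens_basis; congr tens; apply/funext => i.
by rewrite slice0 ffunE (S_vac hs (hu i) hsn hchar (hF i) (@HS i)).
Qed.

Lemma wvec_whittaker : whittaker s u z (tensor_action F) wvec.
Proof.
split; [exact: wvec_graded | | | | exact: wvec_vac].
- move=> [[|b]|b] // _ d; rewrite /completed_actE (@E_wvec b.+1 0) //.
- move=> [[|b]|b] // _ d; rewrite /completed_actE.
  rewrite (@E_wvec b.+1 (N * b.+1)%N) // /chi.
  rewrite ifF; last by lia.
  by rewrite ifT //; lia.
move=> [k|k] [b|b] // h1 h2 d; try lia.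
rewrite /completed_actE (@E_wvec b k) ?scale0r; try lia.
rewrite /chi ifF; last by lia.
by rewrite ifF ?scale0r //; lia.
Qed.

End Existence.

Lemma whittaker_exists (C : fieldType) (s : C) (N : nat) (u : 'I_N -> C) (z : C)
    (F : 'I_N -> diffq_action (fock C)) :
  s != 0 -> (forall i, u i != 0) -> z != 0 ->
  (forall n : nat, (0 < n)%N -> s ^+ n != 1) -> (forall n : nat, n.+1%:R != 0 :> C) ->
  injective (place s u) -> (0 < N)%N -> (forall i, fock_module s (u i) (F i)) ->
  exists W, whittaker s u z (tensor_action F) W.
Proof.
move=> hs hu hz hsn hchar xinj hN hF.
have [S HS] := schur_family hs hu hsn hF.
by exists (wvec s u z S); apply: wvec_whittaker.
Qed.

(** * The theorem *)

Theorem theorem9p5 (R : realType) (q s : R[i])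
    (hq0 : q != 0) (hq1 : `|q| != 1) (hs : s ^+ 2 = q)
    (N : nat) (hN : (0 < N)%N)
    (u : 'I_N -> R[i]) (hu : forall i, u i != 0)
    (z : R[i]) (hz : z != 0)
    (F : 'I_N -> diffq_action (fock R[i]))
    (hF : forall i, fock_module s (u i) (F i)) :
  diffq_irreducible (tensor_action F) ->
  exists! W : int -> tensor_fock R[i] N, whittaker s u z (tensor_action F) W.
Proof.
move=> irr.
have s0 : s != 0 by apply: contraNneq hq0 => s0; rewrite -hs s0 expr0n.
have hsn n : (0 < n)%N -> s ^+ n != 1.
  move=> n0; apply: contraNneq hq1 => sn.
  have s1 : `|s| = 1.
    by apply/eqP; rewrite -(pexpr_eq1 n0 (normr_ge0 s)) -normrX sn normr1.
  by rewrite -hs normrX s1 expr1n.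
have hchar n : n.+1%:R != 0 :> R[i] by rewrite pnatr_eq0.
have xinj := irreducible_nonresonant s0 hu hsn hchar hF irr.
have [W hW] := whittaker_exists s0 hu hz hsn hchar xinj hN hF.
by exists W; split=> // W' hW'; apply: (whittaker_unique s0 hu hsn hF irr hN xinj hW hW').
Qed.
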